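(* Let $\lambda>(4n+3)/5$. Then there is a constant $C$ such that $$\|T_*^\lambda(f,g)\|_{L^1(\mathbb R^n)}\le C\|f\|_{L^{2}(\mathbb R^n)}\|g\|_{L^{2}(\mathbb R^n)}$$ for all Schwartz functions $f,g$ on $\mathbb R^n$.
   Context: For Schwartz functions $f,g$ on $\mathbb R^n$ and $\lambda>0$, the bilinear maximal Bochner-Riesz operator is $$T^{\lambda}_*(f,g)(x)=\sup_{t>0}\Big|\int_{\mathbb R^n}\int_{\mathbb R^n}m^\lambda(t\xi,t\eta)\widehat f(\xi)\widehat g(\eta)e^{2\pi i x\cdot(\xi+\eta)}\,d\xi\, d\eta\Big|,$$ where $\widehat f(\xi)=\int_{\mathbb R^n} f(x)e^{-2\pi i x\cdot\xi}dx$ and $m^{\lambda}(\xi,\eta)=(1-(|\xi|^2+|\eta|^2))_+^{\lambda}$, which equals $(1-(|\xi|^2+|\eta|^2))^{\lambda}$ when $|(\xi,\eta)|\le 1$ and $0$ when $|(\xi,\eta)|>1$. *)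

(* Defs.v *)
From HB Require Import structures.
From mathcomp Require Import all_boot all_order all_algebra.
From mathcomp Require Import complex.
From mathcomp Require Import all_classical all_reals all_analysis.

Set Implicit Arguments.
Unset Strict Implicit.
Unset Printing Implicit Defensive.

Import Order.TTheory GRing.Theory Num.Theory.
Import numFieldNormedType.Exports.
Import ComplexField.Normc.

Local Open Scope classical_set_scope.
Local Open Scope ring_scope.
Local Open Scope complex_scope.

Definition measure_rV_display : measure_display -> measure_display.
Proof. exact. Qed.

Section measurable_rV.
Context {d} {T : sigmaRingType d}.
Variable n : nat.

Let coords : 'I_n -> 'rV[T]_n -> T := fun i x => x ord0 i.

Let rV_set0 : g_sigma_preimage coords set0.
Proof. exact: sigma_algebra0. Qed.

Let rV_setC A : g_sigma_preimage coords A -> g_sigma_preimage coords (~` A).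
Proof. exact: sigma_algebraC. Qed.

Let rV_bigcup (F : (set 'rV[T]_n)^nat) :
  (forall i, g_sigma_preimage coords (F i)) ->
  g_sigma_preimage coords (\bigcup_i (F i)).
Proof. exact: sigma_algebra_bigcup. Qed.

(* The product sigma-algebra of T^n; it is the Borel one for T = R. *)
HB.instance Definition _ := @isMeasurable.Build (measure_rV_display d)
  'rV[T]_n (g_sigma_preimage coords) rV_set0 rV_setC rV_bigcup.

End measurable_rV.

Lemma measurable_coord d (T : sigmaRingType d) n (i : 'I_n) :
  measurable_fun [set: 'rV[T]_n] (fun x : 'rV[T]_n => x ord0 i).
Proof.
move=> _ Y mY; rewrite setTI; apply: sub_sigma_algebra => /=.
rewrite -bigcup_seq/=; exists i => /=; first by rewrite mem_index_enum.
by exists Y => //; rewrite setTI.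
Qed.

Lemma measurable_fun_rV d1 d2 (T1 : measurableType d1) (T2 : measurableType d2)
    n (f : T1 -> 'rV[T2]_n) :
  (forall i, measurable_fun [set: T1] (fun x => f x ord0 i)) ->
  measurable_fun [set: T1] f.
Proof.
move=> mf _ A mA; rewrite setTI.
pose G := [set B : set 'rV[T2]_n | measurable (f @^-1` B)].
suff : (@measurable _ 'rV[T2]_n) `<=` G by exact.
apply: smallest_sub; first split.
- by rewrite /G/= preimage_set0.
- by move=> B GB; rewrite /G/= setTD preimage_setC; exact: measurableC.
- move=> F GF; rewrite /G/= preimage_bigcup.
  by apply: bigcup_measurable => k _; exact: GF.
rewrite -bigcup_seq => B [i _ /= [Y mY <-]]; rewrite setTI.
by have := mf i measurableT _ mY; rewrite setTI.
Qed.

Section lebesgue_rV.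
Context {R : realType}.

Definition rV_cons n (p : 'rV[R]_n * R) : 'rV[R]_n.+1 := row_mx p.2%:M p.1.

Lemma measurable_rV_cons n : measurable_fun [set: 'rV[R]_n * R] (@rV_cons n).
Proof.
apply: measurable_fun_rV => i.
rewrite /rV_cons; under eq_fun do rewrite /rV_cons mxE.
case: (split_ordP (i : 'I_(1 + n))) => j _.
  under eq_fun do rewrite mxE !ord1 eqxx mulr1n.
  exact: measurable_snd.
apply: (measurableT_comp (f := fun x : 'rV[R]_n => x ord0 j)) => //.
exact: measurable_coord.
Qed.

Section measure_rV_cons.
Context n (mu : {measure set 'rV[R]_n -> \bar R}).

Definition measure_rV_cons : set 'rV[R]_n.+1 -> \bar R :=
  pushforward (mu \x @lebesgue_measure R)%E (@rV_cons n).

Let mf := @measurable_rV_cons n.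

Let measure_rV_cons0 : measure_rV_cons set0 = 0%E.
Proof. by rewrite /measure_rV_cons /pushforward preimage_set0 measure0. Qed.

Let measure_rV_cons_ge0 A : (0 <= measure_rV_cons A)%E.
Proof. exact: measure_ge0. Qed.

Let measure_rV_cons_sigma_additive : semi_sigma_additive measure_rV_cons.
Proof. exact: measure_semi_sigma_additive. Qed.

HB.instance Definition _ := isMeasure.Build _ _ _ measure_rV_cons
  measure_rV_cons0 measure_rV_cons_ge0 measure_rV_cons_sigma_additive.

End measure_rV_cons.

(* Lebesgue measure on R^n, as an iterated product of the one on R. *)
Fixpoint lebesgue_rV n : {measure set 'rV[R]_n -> \bar R} :=
  if n is n'.+1 then measure_rV_cons (lebesgue_rV n')
  else \d_(0 : 'rV[R]_0).

Lemma lebesgue_rV_box n (A : 'I_n -> set R) : (forall i, measurable (A i)) ->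
  lebesgue_rV n [set x | forall i, A i (x ord0 i)] =
  (\prod_(i < n) lebesgue_measure (A i))%E.
Proof.
elim: n A => [|n IH] A mA.
  rewrite big_ord0 /= diracE mem_set//= => -[//].
rewrite big_ord_recl /= /measure_rV_cons /pushforward.
rewrite (_ : _ @^-1` _ =
  [set x : 'rV[R]_n | forall i, A (lift ord0 i) (x ord0 i)] `*` A ord0); last first.
  apply/seteqP; split=> -[x y] /=.
  - move=> h; split.
    + move=> i; have := h (lift ord0 i); rewrite /rV_cons mxE.
      rewrite (_ : lift ord0 i = rshift 1 i); last exact: val_inj.
      by case: split_ordP => j /eqP; rewrite eq_shift// => /eqP ->.
    + have := h ord0; rewrite /rV_cons mxE.
      case: split_ordP => j; last by move/(congr1 val).
      by rewrite mxE ord1.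
  - case=> h hy i; rewrite /rV_cons mxE.
    case: split_ordP => j -> /=.
      rewrite mxE !ord1 eqxx mulr1n.
      by rewrite (_ : @lshift 1 n ord0 = @ord0 n)//; exact: val_inj.
    by rewrite (_ : @rshift 1 n j = lift (@ord0 n) j)//; exact: val_inj.
have mB : measurable [set x : 'rV[R]_n | forall i, A (lift ord0 i) (x ord0 i)].
  rewrite (_ : mkset _ = \big[setI/setT]_(i < n)
      ((fun x : 'rV[R]_n => x ord0 i) @^-1` A (lift ord0 i))).
    apply: bigsetI_measurable => i _; rewrite -[X in measurable X]setTI.
    exact: measurable_coord.
  rewrite -bigcap_seq; apply/seteqP; split => x /= h i; first by move=> _.
  by apply: h; rewrite /= mem_index_enum.
rewrite product_measure1E//; last exact: (mA ord0).
rewrite muleC; congr (_ * _)%E.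
exact: (IH (fun i => A (lift ord0 i))).
Qed.

End lebesgue_rV.

Section schwartz.
Context {R : realType} {n : nat}.
Implicit Types (f : 'rV[R]_n -> R[i]) (i : 'I_n) (s : seq 'I_n).

Definition pderivable f i := forall x,
  derivable (fun y => complex.Re (f y)) x (delta_mx ord0 i) /\
  derivable (fun y => complex.Im (f y)) x (delta_mx ord0 i).

Definition pderiv i f : 'rV[R]_n -> R[i] := fun x =>
  'D_(delta_mx ord0 i) (fun y => complex.Re (f y)) x +i*
  'D_(delta_mx ord0 i) (fun y => complex.Im (f y)) x.

Definition pderivs s f : 'rV[R]_n -> R[i] := foldr pderiv f s.

Definition ccontinuous f :=
  continuous (fun x => complex.Re (f x)) /\
  continuous (fun x => complex.Im (f x)).

Definition smooth f := forall s,
  ccontinuous (pderivs s f) /\ forall i, pderivable (pderivs s f) i.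

Definition monomial (a : 'I_n -> nat) (x : 'rV[R]_n) : R :=
  \prod_(i < n) x ord0 i ^+ a i.

(* A list s of directions stands for the derivative d_(s_1) ... d_(s_k); as
   partial derivatives of a smooth function commute, these are exactly the
   derivatives indexed by multi-indices. *)
Definition schwartz f := smooth f /\
  forall (a : 'I_n -> nat) s, exists M : R, forall x,
    normc ((monomial a x)%:C * pderivs s f x) <= M.

End schwartz.

Section bochner_riesz.
Context {R : realType} {n : nat}.
Implicit Types (f g : 'rV[R]_n -> R[i]) (x xi eta : 'rV[R]_n) (lam t : R).

Definition cintegral (h : 'rV[R]_n -> R[i]) : R[i] :=
  (\int[lebesgue_rV n]_x complex.Re (h x)) +i*
  (\int[lebesgue_rV n]_x complex.Im (h x)).

(* The canonical norm of 'rV[R]_n is the sup norm, whence the explicit inner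
   product for the Euclidean structure. *)
Definition dotp x xi : R := \sum_(i < n) x ord0 i * xi ord0 i.

Definition cexpi (theta : R) : R[i] := cos theta +i* sin theta.

Definition fourier f xi : R[i] :=
  cintegral (fun x => f x * cexpi (- (2 * pi * dotp x xi))).

(* (1 - |xi|^2 - |eta|^2)_+ ^ lam; it vanishes outside the unit ball because
   0 `^ lam = 0 for lam != 0. *)
Definition br_multiplier lam xi eta : R :=
  (Num.max (1 - (dotp xi xi + dotp eta eta)) 0) `^ lam.

Definition bilinear_br lam t f g x : R[i] :=
  cintegral (fun eta => cintegral (fun xi =>
    (br_multiplier lam (t *: xi) (t *: eta))%:C * fourier f xi * fourier g eta *
    cexpi (2 * pi * dotp x (xi + eta)))).

Definition maximal_br lam f g x : \bar R :=
  ereal_sup [set (normc (bilinear_br lam t f g x))%:E | t in [set t | 0 < t]].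

Definition cLnorm (p : \bar R) f : \bar R :=
  'N[lebesgue_rV n]_p[EFin \o @normc R \o f].

End bochner_riesz.

(* Main.v *)
Require Import Defs.
From HB Require Import structures.
From mathcomp Require Import all_boot all_order all_algebra.
From mathcomp Require Import complex.
From mathcomp Require Import all_classical all_reals all_analysis.
From mathcomp Require Import measurable_realfun ring lra.

Set Implicit Arguments.
Unset Strict Implicit.
Unset Printing Implicit Defensive.

Import Order.TTheory GRing.Theory Num.Theory.
Import numFieldNormedType.Exports.

Local Open Scope classical_set_scope.
Local Open Scope ring_scope.

(* With tau = t^-2, for lam > 1,
     (tau - |xi|^2 - |eta|^2)_+^lam
       = lam \int_0^tau (u - |xi|^2)_+^(lam - 1) 1_(|eta|^2 < tau - u) du,
   so the bilinear mean of (f, g) at scale t is an average over 0 < u < tau of products of a linear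
   Bochner-Riesz mean of f at level u and a ball mean of g at level tau - u. The inequality
   2 a b <= eps a^2 + b^2 / eps reduces the theorem to L^2 bounds, for each of these two linear
   means S_u, of the maximal function sup_tau (tau^-1 \int_0^tau |S_u f|^2 du)^(1/2).
   The multiplier of S_u is compared with the Laplace weight exp (- sum_i |xi_i| / sqrt u). The
   latter gives a Poisson integral, whose maximal function is bounded on L^2 by linearising the
   supremum and a T T^* argument resting on P_r P_s <= 4^n P_r for s <= r. The difference is bounded
   by its square function, since by Plancherel it suffices that the square of the difference of the
   multipliers has a bounded integral against du / u. *)

(** * Lebesgue measure on row vectors *)

Section rV_measure.
Context {R : realType}.

(** The ball multiplier jumps, which would spoil any pointwise comparison of its kernel with a
    Poisson kernel. It enters only through a mean square over the level [u], however, and there the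
    jump is harmless: with [q = |xi|^2], the squared difference from the Laplace weight is at most a
    constant times [u q / (u^2 + q^2)], whose integral against [du / u] is bounded uniformly in
    [xi]. The exponent of the weight is the l^1 norm of [xi] so that the weight factors over the
    coordinates. Its transform is then a product of one-dimensional Poisson kernels, and the
    inequalities between kernels are inequalities between rational functions. All oscillatory
    integrals are real, with a phase [th] inside the cosine; real and imaginary parts of Fourier
    transforms are sums of such integrals. Plancherel is only needed as an inequality, and it
    follows from the same Poisson kernels being symmetric and of mass 1. For each [t] the bilinear
    mean is bounded by a function of [x] that does not depend on [t], so that the supremum over [t]
    costs nothing more. *)

Lemma lebesgue_rV_sigma_finite n : sigma_finite [set: 'rV[R]_n] (lebesgue_rV n).
Proof.
pose I k (i : 'I_n) : set R := `[- k%:R, k%:R]%classic.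
have mI k i : measurable (I k i) by exact: measurable_itv.
exists (fun k => [set x : 'rV[R]_n | forall i, I k i (x ord0 i)]).
  apply/esym/seteqP; split=> // x _.
  pose M := \sum_(i < n) `|x ord0 i|.
  have M0 : 0 <= M by exact: sumr_ge0.
  exists (Num.bound M) => // i; rewrite /I /= in_itv /= -ler_norml.
  apply: (le_trans _ (ltW (archi_boundP M0))).
  by rewrite /M (bigD1 i)//= lerDl sumr_ge0.
move=> k; split.
  rewrite (_ : mkset _ = \big[setI/setT]_(i < n)
      ((fun x : 'rV[R]_n => x ord0 i) @^-1` I k i)).
    apply: bigsetI_measurable => i _; rewrite -[X in measurable X]setTI.
    exact: measurable_coord.
  rewrite -bigcap_seq; apply/seteqP; split => x /= h i; first by move=> _; exact: h.
  by apply: h; rewrite /= mem_index_enum.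
rewrite lebesgue_rV_box//.
have -> : (\prod_(i < n) lebesgue_measure (I k i) = (\prod_(i < n) (k%:R + k%:R : R))%:E)%E.
  rewrite -prodEFin; apply: eq_bigr => i _; rewrite /I lebesgue_measure_itv /= lte_fin.
  case: ifPn => [_|]; first by rewrite -EFinD opprK.
  by case: k => [|k]; [rewrite addr0 | rewrite -subr_gt0 opprK -natrD ltr0n].
by rewrite ltry.
Qed.

(* [lebesgue_rV n] with the sigma-finite structure that Fubini's theorem needs. *)
Definition leb_rV n : set 'rV[R]_n -> \bar R := Measure.sort (lebesgue_rV n).

HB.instance Definition _ n := Measure.copy (@leb_rV n) (Measure.sort (lebesgue_rV n)).

HB.instance Definition _ n := Measure_isSigmaFinite.Build _ _ _ (@leb_rV n)
  (lebesgue_rV_sigma_finite n).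

End rV_measure.
Arguments leb_rV {R} n.

Section rV_integral.
Context {R : realType}.
Local Open Scope ereal_scope.

Lemma ge0_integral_rV_cons n (f : 'rV[R]_n.+1 -> \bar R) :
  measurable_fun [set: 'rV[R]_n.+1] f -> (forall x, 0 <= f x) ->
  \int[leb_rV n.+1]_x f x =
  \int[leb_rV n]_x \int[lebesgue_measure]_y f (rV_cons (x, y)).
Proof.
move=> mf f0; rewrite /leb_rV /= /measure_rV_cons.
rewrite ge0_integral_pushforward//; last exact: measurable_rV_cons.
rewrite preimage_setT.
have mfc : measurable_fun setT (f \o @rV_cons R n).
  by apply: measurableT_comp => //; exact: measurable_rV_cons.
have := @fubini_tonelli1 _ _ _ _ R (@leb_rV R n) lebesgue_measure _ mfc (fun x => f0 _).
by [].
Qed.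

Lemma rV_cons0 n (x : 'rV[R]_n) (y : R) : rV_cons (x, y) ord0 ord0 = y.
Proof.
rewrite /rV_cons mxE; case: split_ordP => j; last by move/(congr1 val).
by rewrite mxE ord1 ord1 eqxx mulr1n.
Qed.

Lemma rV_cons_lift n (x : 'rV[R]_n) (y : R) (i : 'I_n) :
  rV_cons (x, y) ord0 (lift ord0 i) = x ord0 i.
Proof.
rewrite /rV_cons mxE (_ : lift ord0 i = rshift 1 i); last exact: val_inj.
by case: split_ordP => j /eqP; rewrite eq_shift// => /eqP ->.
Qed.

Lemma ge0_integral_rV_prod n (h : 'I_n -> R -> R) (c : 'I_n -> R) :
  (forall i, measurable_fun setT (h i)) -> (forall i x, (0 <= h i x)%R) ->
  (forall i, \int[lebesgue_measure]_y (h i y)%:E = (c i)%:E) ->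
  \int[leb_rV n]_x (\prod_(i < n) h i (x ord0 i))%:E =
  (\prod_(i < n) c i)%:E.
Proof.
elim: n h c => [|n IH] h c mh h0 hc.
  rewrite /leb_rV big_ord0 /=; under eq_integral do rewrite big_ord0.
  by rewrite integral_cst//= diracE mem_set// mule1.
have c0 i : (0 <= c i)%R.
  by rewrite -lee_fin -hc; apply: integral_ge0 => x _; rewrite lee_fin.
rewrite ge0_integral_rV_cons; first last.
- by move=> x; rewrite lee_fin; apply: prodr_ge0 => i _.
- apply/measurable_EFinP; apply: measurable_prod => i _.
  by apply: measurableT_comp => //; exact: measurable_coord.
under eq_integral => x _.
  under eq_integral => y _.
    rewrite big_ord_recl rV_cons0 EFinM.
    under eq_bigr do rewrite rV_cons_lift.
    rewrite muleC.
    over.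
  rewrite ge0_integralZl//; first last.
  - by rewrite lee_fin; apply: prodr_ge0 => i _.
  - by move=> y _; rewrite lee_fin.
  - by apply/measurable_EFinP; exact: mh.
  rewrite hc.
  over.
rewrite ge0_integralZr//; first last.
- by rewrite lee_fin.
- by move=> x _; rewrite lee_fin; apply: prodr_ge0 => i _.
- apply/measurable_EFinP; apply: measurable_prod => i _.
  by apply: measurableT_comp => //; exact: measurable_coord.
rewrite (IH (fun i => h (lift ord0 i)) (fun i => c (lift ord0 i)))//.
by rewrite big_ord_recl -EFinM mulrC.
Qed.

End rV_integral.

Section rV_borel.
Context {R : realType} {n : nat}.

(** The topology of row vectors is that of the sup norm, whose balls are boxes and so belong to the
    product sigma-algebra. Countably many of them, with rational centre and radius [1 / (k + 1)],
    fill up [U]. *)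
Lemma open_rV_measurable (U : set 'rV[R]_n) : open U -> measurable U.
Proof.
move=> oU.
pose B (p : 'rV[rat]_n * nat) : set 'rV[R]_n :=
  [set x | forall i, `|ratr (p.1 ord0 i) - x ord0 i| < p.2.+1%:R^-1].
have mB p : measurable (B p).
  rewrite (_ : B p = \big[setI/setT]_(i < n) ((fun x : 'rV[R]_n => x ord0 i) @^-1`
      (ball (ratr (p.1 ord0 i) : R) p.2.+1%:R^-1))).
    apply: bigsetI_measurable => i _; rewrite -[X in measurable X]setTI.
    by apply: measurable_coord => //; exact: measurable_ball.
  rewrite -bigcap_seq; apply/seteqP; split => x /= h i; first by move=> _; exact: h.
  by apply: h; rewrite /= mem_index_enum.
have -> : U = \bigcup_(p in [set p | B p `<=` U]) B p.
  apply/seteqP; split; last by move=> x [p /= pU /pU].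
  move=> x Ux; have : nbhs x U by exact: open_nbhs_nbhs.
  move=> /nbhs_ballP[e /= e0 eU].
  (* The radius is spent twice, from [x] to the rational centre and from the centre to a point of
     the box. *)
  have [k ke] : exists k : nat, k.+1%:R^-1 *+ 2 < e.
    have e2 : 0 < e / 2 by rewrite divr_gt0.
    exists (Num.bound (e / 2)^-1).
    rewrite -[ltLHS]mulr_natr -ltr_pdivlMr// -[ltRHS]invrK ltf_pV2 ?posrE ?invr_gt0//.
    by rewrite (lt_trans (archi_boundP _)) ?invr_ge0 ?ltW// ltr_nat.
  have q i : {q : rat | `|ratr q - x ord0 i| < k.+1%:R^-1}.
    apply: cid; have : x ord0 i - k.+1%:R^-1 < x ord0 i + k.+1%:R^-1.
      by rewrite ltrD2l gt0_cp// invr_gt0.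
    by move=> /rat_in_itvoo[q]; rewrite in_itv /= -ltr_distlC => ?; exists q; rewrite distrC.
  exists (\row_i sval (q i), k); last by move=> i /=; rewrite mxE; case: (q i).
  move=> y /= By; apply: eU; rewrite /ball /= /mx_ball; split => // i j.
  rewrite /ball /=.
  rewrite (ord1 i); have := By j; rewrite mxE; case: (q j) => z /= zx zy.
  rewrite (lt_trans _ ke)// mulr2n.
  rewrite (_ : _ - _ = (x ord0 j - ratr z) + (ratr z - y ord0 j)); last by ring.
  by rewrite (le_lt_trans (ler_normD _ _))// ltrD// distrC.
rewrite bigcup_mkcond.
apply: countable_bigcupT_measurable; first exact: countableP.
by move=> p; case: ifPn.
Qed.

Lemma continuous_rV_measurable (f : 'rV[R]_n -> R) :
  continuous f -> measurable_fun [set: 'rV[R]_n] f.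
Proof.
move=> cf; apply: (measurability _ (RGenOpens.measurableE R)) => _ [_ [a [b ->] <-]].
rewrite setTI; apply: open_rV_measurable.
by move/continuousP : cf; apply; exact: interval_open.
Qed.

End rV_borel.

(** * Measurability of parametric integrals, and Fubini for dominated integrands *)

Section integration.
Context {R : realType} d1 d2 (T1 : measurableType d1) (T2 : measurableType d2).
Variables (m1 : {sigma_finite_measure set T1 -> \bar R}).
Variables (m2 : {sigma_finite_measure set T2 -> \bar R}).

Lemma emeasurable_fun_integral (f : T1 * T2 -> \bar R) :
  measurable_fun [set: T1 * T2] f ->
  measurable_fun [set: T1] (fun x => \int[m2]_y f (x, y))%E.
Proof.
move=> mf.
rewrite (_ : (fun x => _) = ((fun x => \int[m2]_y f^\+ (x, y)) \-
    (fun x => \int[m2]_y f^\- (x, y)))%E); last first.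
  apply/funext => x; rewrite [LHS]integralE.
  under eq_integral do rewrite funepos_comp/=.
  by under [X in (_ - X = _)%E]eq_integral do rewrite funeneg_comp/=.
by apply: emeasurable_funB; apply: measurable_fun_fubini_tonelli_F => //;
  [exact: measurable_funepos|exact: measurable_funeneg].
Qed.

Lemma measurable_fun_Rintegral (f : T1 * T2 -> R) :
  measurable_fun [set: T1 * T2] f ->
  measurable_fun [set: T1] (fun x => \int[m2]_y f (x, y)).
Proof.
move=> mf; apply: measurableT_comp; first exact: fine_measurable.
by apply: (emeasurable_fun_integral (f := EFin \o f)); exact/measurable_EFinP.
Qed.

Context (f : T1 * T2 -> R) (A : T1 -> R) (B : T2 -> R).
Hypothesis mf : measurable_fun [set: T1 * T2] f.
Hypothesis iA : m1.-integrable [set: T1] (EFin \o A).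
Hypothesis iB : m2.-integrable [set: T2] (EFin \o B).
Hypothesis fAB : forall x y, `|f (x, y)| <= A x * B y.

Lemma dominated_integrable2 x : m2.-integrable [set: T2] (fun y => (f (x, y))%:E).
Proof.
apply: (le_integrable measurableT _ _ (integrableZl measurableT (A x) iB)) => //=.
  by apply/measurable_EFinP; exact: measurableT_comp.
by move=> y _; rewrite lee_fin (le_trans (fAB x y))// ler_norm.
Qed.

Lemma dominated_integrable1 y : m1.-integrable [set: T1] (fun x => (f (x, y))%:E).
Proof.
apply: (le_integrable measurableT _ _ (integrableZr measurableT (B y) iA)) => //=.
  by apply/measurable_EFinP; exact: measurableT_comp.
by move=> x _; rewrite lee_fin (le_trans (fAB x y))// ler_norm.
Qed.

(** Domination by a tensor product [A x * B y] settles joint integrability and the integrability of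
    every slice at once. All exchanges of integrals of variable sign in the proof go through it; the
    others are Tonelli. *)
Lemma dominated_integrable : (m1 \x m2)%E.-integrable [set: T1 * T2] (EFin \o f).
Proof.
apply/integrable12ltyP; first exact/measurable_EFinP.
pose c := \int[m2]_y `|B y|.
have cE : (\int[m2]_y `|B y|%:E = c%:E)%E.
  by rewrite /c /Rintegral fineK//; apply: integrable_fin_num => //; exact: integrable_norm.
apply: (@le_lt_trans _ _ (\int[m1]_x (`|A x| * c)%:E)%E); last first.
  have := integrableZr measurableT c (integrable_norm iA).
  by move=> /integrable_lty; exact.
apply: ge0_le_integral => //.
- by move=> x _; exact: integral_ge0.
- apply: (measurable_fun_fubini_tonelli_F (fun z => `|(f z)%:E|%E)) => //.
  by apply: measurableT_comp => //; exact/measurable_EFinP.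
- apply/measurable_EFinP; apply: measurable_funM => //.
  by apply: measurableT_comp => //; apply/measurable_EFinP; exact: measurable_int iA.
move=> x _; rewrite EFinM -cE -ge0_integralZl//; last first.
  by apply/measurable_EFinP; apply: measurableT_comp => //; apply/measurable_EFinP; exact: measurable_int iB.
apply: ge0_le_integral => //.
- by apply: measurableT_comp => //; apply/measurable_EFinP; exact: measurableT_comp.
- apply/measurable_EFinP; apply: measurable_funM => //.
  by apply: measurableT_comp => //; apply/measurable_EFinP; exact: measurable_int iB.
move=> y _; rewrite -EFinM lee_fin (le_trans (fAB x y))//.
by rewrite (le_trans (ler_norm _))// normrM.
Qed.

Let inner2E x : (\int[m2]_y (f (x, y))%:E = (\int[m2]_y f (x, y))%:E)%E.
Proof. by rewrite /Rintegral fineK//; apply: integrable_fin_num => //; exact: dominated_integrable2. Qed.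

Let inner1E y : (\int[m1]_x (f (x, y))%:E = (\int[m1]_x f (x, y))%:E)%E.
Proof. by rewrite /Rintegral fineK//; apply: integrable_fin_num => //; exact: dominated_integrable1. Qed.

Lemma dominated_integrable_Rintegral2 :
  m1.-integrable [set: T1] (fun x => (\int[m2]_y f (x, y))%:E).
Proof.
have := integrable_fubini_F dominated_integrable.
by apply: eq_integrable => // x _; rewrite /fubini_F /= inner2E.
Qed.

Lemma dominated_Fubini :
  \int[m1]_x (\int[m2]_y f (x, y)) = \int[m2]_y (\int[m1]_x f (x, y)).
Proof.
rewrite /Rintegral; congr fine.
under eq_integral do rewrite -/(Rintegral _ _ _) -inner2E.
under [RHS]eq_integral do rewrite -/(Rintegral _ _ _) -inner1E.
exact: (Fubini dominated_integrable).
Qed.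

End integration.

(** * The Poisson kernel *)

Section reflection.
Context {R : realType}.
Local Open Scope ereal_scope.
Local Notation mu := (@lebesgue_measure R).

Lemma measurable_subl (a : R) : measurable_fun [set: R] (fun u : R => (a - u)%R).
Proof. by apply: measurable_funB => //; exact: measurable_id. Qed.

(** The pushforward of Lebesgue measure under [u |-> a - u] is identified by its values on half-open
    intervals: the preimage of []x, y]] is [[a - y, a - x[], of the same length. *)
Lemma ge0_integral_reflect (a : R) (f : R -> \bar R) :
  measurable_fun [set: R] f -> (forall x, 0 <= f x) ->
  \int[mu]_u f (a - u)%R = \int[mu]_u f u.
Proof.
move=> mf f0.
transitivity (\int[pushforward mu (fun u : R => (a - u)%R : measurableTypeR R)]_u f u).
  rewrite ge0_integral_pushforward ?preimage_setT//; exact: measurable_subl.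
apply: eq_measure_integral => [|mphi A mA _]; first exact: measurable_subl.
apply/esym.
apply: (@lebesgue_measure_unique R (pushforward mu (fun u : R => (a - u)%R : measurableTypeR R))) => //.
move=> _ [[x y] _ <-].
transitivity (mu `[(a - y)%R, (a - x)%R[%classic).
  rewrite !lebesgue_measure_itv /= !lte_fin ltrD2l ltrN2.
  by case: ifP => // _; rewrite -!EFinD; congr (_%:E); ring.
apply: (congr1 mu); apply/seteqP; split => z /=; rewrite !in_itv /=; lra.
Qed.

(** A translation is a composition of two reflections. *)
Lemma ge0_integral_translate (a : R) (f : R -> \bar R) :
  measurable_fun [set: R] f -> (forall x, 0 <= f x) ->
  \int[mu]_u f (u + a)%R = \int[mu]_u f u.
Proof.
move=> mf f0; rewrite -(ge0_integral_reflect a mf f0).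
rewrite -(@ge0_integral_reflect 0 (fun u => f (a - u)%R))//; last first.
  by apply: measurableT_comp => //; exact: measurable_subl.
by apply: eq_integral => u _; congr f; ring.
Qed.

(** Folding the line onto a half-line prepares the fundamental theorem of calculus on [[0, +oo[]. *)
Lemma ge0_integral_symmetrize (f : R -> \bar R) :
  measurable_fun [set: R] f -> (forall x, 0 <= f x) ->
  \int[mu]_u f u = \int[mu]_(u in `[0%R, +oo[) (f u + f (- u)%R).
Proof.
move=> mf f0.
have mfN : measurable_fun [set: R] (fun u => f (- u)%R).
  by apply: measurableT_comp => //; exact: oppr_measurable.
rewrite ge0_integralD//; [|exact: measurable_funTS..].
rewrite (_ : [set: R] = `]-oo, 0%R] `|` `]0%R, +oo[)%classic; last first.
  by apply/seteqP; split=> // x _ /=; rewrite !in_itv /= andbT; case: (ltP 0%R x); [right|left].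
rewrite ge0_integral_setU//=; first last.
- by rewrite disj_set2E; apply/eqP/seteqP; split => // x /= []; rewrite !in_itv /= andbT; lra.
- exact: measurable_funTS.
rewrite addeC integral_itv_obnd_cbnd; last exact: measurable_funTS.
congr (_ + _); rewrite (@ge0_integration_by_substitution0 _ (fun u => f (- u)%R))//.
by apply: eq_integral => u _; rewrite opprK.
Qed.

End reflection.

Section poisson.
Context {R : realType}.
Local Notation mu := (@lebesgue_measure R).

(** The Fourier transform of [t |-> expR (- (r * |t|))], with the factor [2 pi] in the exponential;
    this is why its total mass is 1. *)
Definition poisson (r v : R) : R := 2 * r / (r ^+ 2 + (2 * pi * v) ^+ 2).

Lemma poisson_den_gt0 (r v : R) : 0 < r -> 0 < r ^+ 2 + (2 * pi * v) ^+ 2.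
Proof. by move=> r0; rewrite ltr_wpDr ?sqr_ge0// exprn_gt0. Qed.

Lemma poisson_gt0 (r v : R) : 0 < r -> 0 < poisson r v.
Proof. by move=> r0; rewrite divr_gt0 ?mulr_gt0// poisson_den_gt0. Qed.

Lemma poissonN (r v : R) : poisson r (- v) = poisson r v.
Proof. by rewrite /poisson mulrN sqrrN. Qed.

Lemma poisson0 (r : R) : 0 < r -> poisson r 0 = 2 / r.
Proof. by move=> r0; rewrite /poisson mulr0 expr0n/= addr0; field; rewrite gt_eqF. Qed.

Lemma continuous_poisson (r : R) : 0 < r -> continuous (poisson r).
Proof.
move=> r0 v; apply: cvgM; first exact: cvg_cst.
apply: cvgV; first by rewrite gt_eqF// poisson_den_gt0.
apply: cvgD; first exact: cvg_cst.
apply: (@cvg_comp _ _ _ (fun v => 2 * pi * v) (fun x => x ^+ 2) _ _ _ _ (@exprn_continuous _ _ _)).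
by apply: cvgM; [exact: cvg_cst|exact: cvg_id].
Qed.

Lemma measurable_poisson (r : R) : 0 < r -> measurable_fun [set: R] (poisson r).
Proof. by move=> r0; apply: continuous_measurable_fun; exact: continuous_poisson. Qed.

Lemma is_derive_atan_poisson (r x : R) : 0 < r ->
  is_derive x (1 : R) (fun x => atan (2 * pi / r * x) / pi) (poisson r x).
Proof.
move=> r0; set k := 2 * pi / r.
rewrite (_ : (fun x => _) = (atan \o (cst k * id)) * cst pi^-1); last exact/funext.
apply: is_derive_eq.
rewrite /= /poisson scaler0 add0r /k.
rewrite (_ : (cst (2 * pi / r) * id) x = 2 * pi / r * x)// /GRing.scale /=.
move: (@pi R) (@pi_gt0 R) => p p0; field.
rewrite (gt_eqF p0) (gt_eqF r0) !andbT gt_eqF//.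
by rewrite ltr_wpDr ?sqr_ge0// exprn_gt0.
Qed.

Lemma integral_poisson (r c : R) : 0 < r ->
  (\int[mu]_x (poisson r (x - c))%:E = 1)%E.
Proof.
move=> r0.
have mp : measurable_fun [set: R] (EFin \o poisson r).
  by apply/measurable_EFinP; exact: measurable_poisson.
rewrite (@ge0_integral_translate _ (- c) (EFin \o poisson r))//; last first.
  by move=> x; rewrite lee_fin ltW// poisson_gt0.
rewrite ge0_integral_symmetrize//; last by move=> x; rewrite lee_fin ltW// poisson_gt0.
under eq_integral do rewrite /= poissonN -EFinD.
pose F (x : R) := atan (2 * pi / r * x) / pi.
have dF x : is_derive x (1 : R) (F \+ F) (poisson r x + poisson r x).
  by apply: is_deriveD; exact: is_derive_atan_poisson.
rewrite (@ge0_continuous_FTC2y _ _ (F \+ F) 0 1).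
- by rewrite /F /= mulr0 atan0 mul0r addr0 sube0.
- by move=> x _; rewrite addr_ge0// ltW// poisson_gt0.
- apply: continuous_subspaceT => x.
  by apply: cvgD; exact: continuous_poisson.
- rewrite (_ : 1 = 2^-1 + 2^-1 :> R); last by lra.
  have cF : F x @[x --> +oo] --> (2^-1 : R).
    rewrite (_ : 2^-1 = pi / 2 * pi^-1 :> R); last first.
      by rewrite mulrAC divff ?mul1r// gt_eqF// pi_gt0.
    apply: cvgM; last exact: cvg_cst.
    apply: (@cvg_comp _ _ _ (fun x => 2 * pi / r * x) atan _ _ _ _ (@cvgy_atan R)).
    apply: gt0_cvgMry; last exact: cvg_id.
    by rewrite divr_gt0// mulr_gt0// pi_gt0.
  exact: cvgD.
- by move=> x _; case: (dF x).
- apply: cvg_at_right_filter; apply: differentiable_continuous.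
  by apply/derivable1_diffP; case: (dF 0).
- by move=> x _; rewrite derive1E; apply: derive_val.
Qed.

Definition laplace_weight (r t : R) : R := expR (- (r * `|t|)).

Lemma laplace_weight_gt0 (r t : R) : 0 < laplace_weight r t.
Proof. exact: expR_gt0. Qed.

Lemma measurable_laplace_weight (r : R) : measurable_fun [set: R] (laplace_weight r).
Proof.
apply: measurableT_comp => //; apply: measurable_funN; exact: measurable_funM.
Qed.

Lemma cvgy_expRM (r : R) : 0 < r -> expR (- (r * x)) @[x --> +oo] --> (0 : R).
Proof.
move=> r0; apply: (@cvg_comp _ _ _ (fun x => r * x) (fun x => expR (- x)) _ _ _ _ (@cvgr_expR R)).
by apply: gt0_cvgMry => //; exact: cvg_id.
Qed.

(** Adding 1 to the cosine keeps the integrand nonnegative, so that folding, the improper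
    fundamental theorem and later Tonelli apply without integrability side conditions. The term
    [poisson r 0] is the mass of the weight, to be subtracted afterwards. *)
Lemma integral_laplace_weight_cos (r th b : R) : 0 < r ->
  (\int[mu]_t (laplace_weight r t * (1 + cos (th + 2 * pi * (t * b))))%:E =
   (poisson r 0 + cos th * poisson r b)%:E)%E.
Proof.
move=> r0; pose be := 2 * pi * b; pose D := r ^+ 2 + be ^+ 2.
have D0 : 0 < D by rewrite ltr_wpDr ?sqr_ge0// exprn_gt0.
have mcos : measurable_fun [set: R] (fun t : R => cos (th + 2 * pi * (t * b))).
  apply: continuous_measurable_fun => t.
  apply: (@cvg_comp _ _ _ (fun t => th + 2 * pi * (t * b)) cos _ _ _ _ (@continuous_cos _ _)).
  apply: cvgD; first exact: cvg_cst.
  by apply: cvgM; [exact: cvg_cst|apply: cvgM; [exact: cvg_id|exact: cvg_cst]].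
have cos_ge0 (x : R) : 0 <= 1 + cos x by rewrite -lerBlDl sub0r cos_geN1.
rewrite ge0_integral_symmetrize; first last.
- by move=> x; rewrite lee_fin mulr_ge0// ltW// laplace_weight_gt0.
- apply/measurable_EFinP; apply: measurable_funM; first exact: measurable_laplace_weight.
  exact: measurable_funD.
(* Folding cancels the odd term in [sin th]. The primitive [F] below rests on [e^(-rt) (be sin (be
   t) - r cos (be t)) / D] being a primitive of [e^(-rt) cos (be t)]. *)
pose g (t : R) := expR (- (r * t)) * (2 * (1 + cos th * cos (be * t))).
pose F (t : R) := 2 * (cos th * (expR (- (r * t)) * (be * sin (be * t) - r * cos (be * t))) / D
   - expR (- (r * t)) / r).
under eq_integral => t.
  rewrite inE /= in_itv /= andbT => t0.
  rewrite -EFinD (_ : laplace_weight r t * _ + _ = g t); last first.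
    rewrite /g /laplace_weight normrN ger0_norm// -mulrDr; congr (_ * _).
    rewrite (_ : 2 * pi * (t * b) = be * t); last by rewrite /be; ring.
    rewrite (_ : 2 * pi * (- t * b) = - (be * t)); last by rewrite /be; ring.
    by rewrite !cosD cosN sinN; ring.
  over.
have dF x : is_derive x (1 : R) F (g x).
  pose E := expR \o (cst (- r) * id); pose S := sin \o (cst be * id).
  pose K := cos \o (cst be * id).
  rewrite (_ : F = cst 2 * (cst (cos th / D) * (E * (cst be * S - cst r * K)) - E * cst r^-1)); last first.
    apply/funext => t; rewrite /F /=.
    rewrite [RHS](_ : _ = 2 * (cos th / D * (expR (- r * t) * (be * sin (be * t) - r * cos (be * t))) - expR (- r * t) * r^-1))//.
    by rewrite mulNr; ring.
  apply: is_derive_eq.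
  rewrite /GRing.scale /= !mulr0 !addr0.
  rewrite (_ : (cst be * S - cst r * K) x = be * sin (be * x) - r * cos (be * x))//.
  rewrite (_ : (cst be * id) x = be * x)// (_ : (cst (- r) * id) x = - r * x)//.
  rewrite (_ : E x = expR (- r * x))// /g mulNr.
  have D1 : r ^+ 2 + be ^+ 2 != 0 by rewrite gt_eqF.
  rewrite /D; clear E S K F g mcos D D0.
  clearbody be; field.
  by rewrite D1 gt_eqF.
rewrite (@ge0_continuous_FTC2y _ _ F 0 0).
- rewrite /F mulr0 oppr0 expR0 mulr0 sin0 cos0 -EFinB; congr (_%:E).
  rewrite poisson0// /poisson -/be -/D.
  clear dF F g mcos; clearbody D be; field.
  by rewrite !gt_eqF.
- move=> x _; rewrite mulr_ge0 ?expR_ge0// mulr_ge0//.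
- apply: continuous_subspaceT => x.
  apply: cvgM.
    apply: (@cvg_comp _ _ _ (fun x => - (r * x)) expR _ _ _ _ (@continuous_expR _ _)).
    by apply: cvgN; apply: cvgM; [exact: cvg_cst|exact: cvg_id].
  apply: cvgM; first exact: cvg_cst.
  apply: cvgD; first exact: cvg_cst.
  apply: cvgM; first exact: cvg_cst.
  apply: (@cvg_comp _ _ _ (fun x => be * x) cos _ _ _ _ (@continuous_cos _ _)).
  by apply: cvgM; [exact: cvg_cst|exact: cvg_id].
- pose M := 2 * ((`|be| + r) / D + r^-1).
  have cM c : c * expR (- (r * x)) @[x --> +oo] --> (0 : R).
    rewrite -(mulr0 c); apply: cvgM; first exact: cvg_cst.
    exact: cvgy_expRM.
  suff key : \forall x \near +oo, - M * expR (- (r * x)) <= F x <= M * expR (- (r * x)).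
    exact: (squeeze_cvgr key (cM _) (cM _)).
  apply: nearW => x; rewrite mulNr -ler_norml /F.
  have := expR_gt0 (- (r * x)); set E := expR _ => E0.
  have -> : M * E = 2 * ((`|be| + r) * E / D + E / r) by rewrite /M; ring.
  rewrite normrM [X in X * _]ger0_norm// ler_pM2l// (le_trans (ler_normB _ _))// lerD//; last first.
    by rewrite ger0_norm// divr_ge0// ltW.
  rewrite normrM [X in _ * X]ger0_norm ?invr_ge0 ?(ltW D0)// ler_pM2r ?invr_gt0//.
  rewrite normrM -[leRHS]mul1r ler_pM//; first by rewrite ler_norml cos_geN1 cos_le1.
  rewrite normrM ger0_norm ?(ltW E0)// mulrC ler_pM2r//.
  rewrite (le_trans (ler_normB _ _))// lerD// normrM.
    by rewrite ler_piMr// ler_norml sin_geN1 sin_le1.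
  by rewrite (ger0_norm (ltW r0)) ler_piMr// ?(ltW r0)// ler_norml cos_geN1 cos_le1.
- by move=> x _; case: (dF x).
- apply: cvg_at_right_filter; apply: differentiable_continuous.
  by apply/derivable1_diffP; case: (dF 0).
- by move=> x _; rewrite derive1E; apply: derive_val.
Qed.

End poisson.

(** * Product Poisson kernels in several variables *)

Section poisson_rV.
Context {R : realType}.
Implicit Types (n : nat) (r s th : R).

Definition poisson_rV n r (v : 'rV[R]_n) : R := \prod_(i < n) poisson r (v ord0 i).

Definition laplace_rV n r (v : 'rV[R]_n) : R := \prod_(i < n) laplace_weight r (v ord0 i).

Lemma poisson_rV_gt0 n r (v : 'rV[R]_n) : 0 < r -> 0 < poisson_rV r v.
Proof. by move=> r0; apply: prodr_gt0 => i _; exact: poisson_gt0. Qed.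

Lemma poisson_rV_ge0 n r (v : 'rV[R]_n) : 0 < r -> 0 <= poisson_rV r v.
Proof. by move=> r0; rewrite ltW// poisson_rV_gt0. Qed.

Lemma poisson_rVN n r (v : 'rV[R]_n) : poisson_rV r (- v) = poisson_rV r v.
Proof. by apply: eq_bigr => i _; rewrite mxE poissonN. Qed.

Lemma laplace_rV_gt0 n r (v : 'rV[R]_n) : 0 < laplace_rV r v.
Proof. by apply: prodr_gt0 => i _; exact: laplace_weight_gt0. Qed.

Lemma laplace_rV_ge0 n r (v : 'rV[R]_n) : 0 <= laplace_rV r v.
Proof. by rewrite ltW// laplace_rV_gt0. Qed.

Lemma laplace_rVE n r (v : 'rV[R]_n) :
  laplace_rV r v = expR (- (r * \sum_(i < n) `|v ord0 i|)).
Proof. by rewrite mulr_sumr -sumrN expR_sum. Qed.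

Lemma measurable_coord_comp d (T : measurableType d) n (f : T -> 'rV[R]_n) i :
  measurable_fun [set: T] f -> measurable_fun [set: T] (fun x => f x ord0 i).
Proof. by move=> mf; apply: (measurableT_comp (measurable_coord i) mf). Qed.

Lemma measurable_poisson_rV d (T : measurableType d) n r (f : T -> 'rV[R]_n) : 0 < r ->
  measurable_fun [set: T] f -> measurable_fun [set: T] (fun t => poisson_rV r (f t)).
Proof.
move=> r0 mf; apply: measurable_prod => i _.
apply: (measurableT_comp (measurable_poisson r0)); exact: measurable_coord_comp.
Qed.

Lemma measurable_laplace_rV d (T : measurableType d) n r (f : T -> 'rV[R]_n) :
  measurable_fun [set: T] f -> measurable_fun [set: T] (fun t => laplace_rV r (f t)).
Proof.
move=> mf; apply: measurable_prod => i _.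
apply: (measurableT_comp (measurable_laplace_weight r)); exact: measurable_coord_comp.
Qed.

Lemma measurable_rVD d (T : measurableType d) n (f g : T -> 'rV[R]_n) :
  measurable_fun [set: T] f -> measurable_fun [set: T] g ->
  measurable_fun [set: T] (fun x => f x + g x).
Proof.
move=> mf mg; apply: measurable_fun_rV => i.
under eq_fun do rewrite mxE.
by apply: measurable_funD; exact: measurable_coord_comp.
Qed.

Lemma measurable_rVN d (T : measurableType d) n (f : T -> 'rV[R]_n) :
  measurable_fun [set: T] f -> measurable_fun [set: T] (fun x => - f x).
Proof.
move=> mf; apply: measurable_fun_rV => i.
under eq_fun do rewrite mxE.
by apply: measurable_funN; exact: measurable_coord_comp.
Qed.

Lemma measurable_dotp d (T : measurableType d) n (f g : T -> 'rV[R]_n) :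
  measurable_fun [set: T] f -> measurable_fun [set: T] g ->
  measurable_fun [set: T] (fun x => dotp (f x) (g x)).
Proof.
move=> mf mg; apply: measurable_sum => i.
by apply: measurable_funM; exact: measurable_coord_comp.
Qed.

Lemma measurable_cos : measurable_fun [set: R] (@cos R).
Proof. by apply: continuous_measurable_fun; exact: continuous_cos. Qed.

Lemma measurable_cos_dotp d (T : measurableType d) n th (f g : T -> 'rV[R]_n) :
  measurable_fun [set: T] f -> measurable_fun [set: T] g ->
  measurable_fun [set: T] (fun x => cos (th + 2 * pi * dotp (f x) (g x))).
Proof.
move=> mf mg; apply: (measurableT_comp measurable_cos).
by apply: measurable_funD => //; apply: measurable_funM => //; exact: measurable_dotp.
Qed.

Lemma dotpC n (x y : 'rV[R]_n) : dotp x y = dotp y x.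
Proof. by apply: eq_bigr => i _; rewrite mulrC. Qed.

Lemma dotpDl n (x y z : 'rV[R]_n) : dotp (x + y) z = dotp x z + dotp y z.
Proof. by rewrite /dotp -big_split; apply: eq_bigr => i _; rewrite mxE mulrDl. Qed.

Lemma dotpNl n (x z : 'rV[R]_n) : dotp (- x) z = - dotp x z.
Proof. by rewrite /dotp -sumrN; apply: eq_bigr => i _; rewrite mxE mulNr. Qed.

Lemma dotp_cons n (x : 'rV[R]_n) (y : R) (w : 'rV[R]_n.+1) :
  dotp (rV_cons (x, y)) w = y * w ord0 ord0 + dotp x (\row_i w ord0 (lift ord0 i)).
Proof.
rewrite /dotp big_ord_recl rV_cons0; congr (_ + _).
by apply: eq_bigr => i _; rewrite rV_cons_lift mxE.
Qed.

Lemma ge0_integral_laplace_rV_cos n r th (w : 'rV[R]_n) : 0 < r ->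
  (\int[leb_rV n]_x (laplace_rV r x * (1 + cos (th + 2 * pi * dotp x w)))%:E =
   (poisson_rV r (0 : 'rV[R]_n) + cos th * poisson_rV r w)%:E)%E.
Proof.
move=> r0.
have cos_ge0 (x : R) : 0 <= 1 + cos x by rewrite -lerBlDl sub0r cos_geN1.
have mf m (u : 'rV[R]_m) t : measurable_fun [set: 'rV[R]_m]
    (fun x => (laplace_rV r x * (1 + cos (t + 2 * pi * dotp x u)))%:E).
  apply/measurable_EFinP; apply: measurable_funM; first exact: measurable_laplace_rV.
  apply: measurable_funD => //; exact: measurable_cos_dotp.
elim: n th w => [|n IH] th w.
  under eq_integral do rewrite /laplace_rV /dotp !big_ord0 mulr0 addr0 mul1r.
  rewrite integral_cst//= /leb_rV /= diracE mem_set// mule1.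
  by rewrite /poisson_rV !big_ord0 mulr1.
rewrite ge0_integral_rV_cons//; last first.
  by move=> x; rewrite lee_fin mulr_ge0// laplace_rV_ge0.
pose w' : 'rV[R]_n := \row_i w ord0 (lift ord0 i).
pose p0 := poisson r 0; pose pw := poisson r (w ord0 ord0).
have pw0 : pw <= p0.
  rewrite /pw /p0 poisson0// /poisson ler_pdivrMr ?poisson_den_gt0//.
  rewrite mulrDr expr2 mulrA divfK ?gt_eqF// lerDl mulr_ge0// ?sqr_ge0//.
  by rewrite divr_ge0// ltW.
have h0 m (u : 'rV[R]_m) x t : 0 <= laplace_rV r x * (1 + cos (t + 2 * pi * dotp x u)).
  by rewrite mulr_ge0// laplace_rV_ge0.
(* Integrating out one coordinate leaves [p0 + pw cos], which is no longer of the form [1 + cos]. It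
   is split as [(p0 - pw) * 1 + pw * (1 + cos)], with nonnegative coefficients, and the 1 is written
   as [1 + cos (pi / 2)] at frequency 0, so that the induction hypothesis covers both terms. *)
transitivity (\int[leb_rV n]_x
  ((p0 - pw)%:E * (laplace_rV r x * (1 + cos (pi / 2 + 2 * pi * dotp x (0 : 'rV[R]_n))))%:E +
   pw%:E * (laplace_rV r x * (1 + cos (th + 2 * pi * dotp x w')))%:E))%E.
  apply: eq_integral => x _.
  under eq_integral => y _.
    rewrite dotp_cons -/w' (_ : laplace_rV r _ = laplace_rV r x * laplace_weight r y); last first.
      rewrite /laplace_rV big_ord_recl rV_cons0 mulrC; congr (_ * _).
      by apply: eq_bigr => i _; rewrite rV_cons_lift.
    rewrite (_ : th + _ = (th + 2 * pi * dotp x w') + 2 * pi * (y * w ord0 ord0)); last by ring.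
    rewrite -mulrA EFinM.
    over.
  rewrite ge0_integralZl//; first last.
  - by rewrite lee_fin laplace_rV_ge0.
  - by move=> y _; rewrite lee_fin mulr_ge0// ltW// laplace_weight_gt0.
  - apply/measurable_EFinP; apply: measurable_funM; first exact: measurable_laplace_weight.
    apply: measurable_funD => //; apply: (measurableT_comp measurable_cos).
    apply: measurable_funD => //; apply: measurable_funM => //.
    by apply: measurable_funM => //; exact: measurable_id.
  rewrite integral_laplace_weight_cos// -!EFinM -EFinD; congr (_%:E).
  rewrite (_ : dotp x 0 = 0); last by rewrite /dotp big1// => i _; rewrite mxE mulr0.
  rewrite [2 * pi * 0]mulr0 addr0 cos_pihalf -/p0 -/pw; ring.
rewrite ge0_integralD//; first last.
- by apply: measurable_funeM; exact: mf.
- by move=> x _; rewrite mule_ge0// lee_fin ?h0// ltW// poisson_gt0.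
- by apply: measurable_funeM; exact: mf.
- by move=> x _; rewrite mule_ge0// lee_fin ?h0// subr_ge0.
rewrite !ge0_integralZl//; first last.
- by rewrite lee_fin subr_ge0.
- by move=> x _; rewrite lee_fin h0.
- exact: mf.
- by rewrite lee_fin ltW// poisson_gt0.
- by move=> x _; rewrite lee_fin h0.
- exact: mf.
rewrite !IH cos_pihalf mul0r addr0 -!EFinM -EFinD; congr (_%:E).
rewrite /poisson_rV !big_ord_recl mxE -/p0 -/pw.
rewrite (_ : \prod_(i < n) poisson r ((0 : 'rV[R]_n.+1) ord0 (lift ord0 i)) =
  \prod_(i < n) poisson r ((0 : 'rV[R]_n) ord0 i)); last by apply: eq_bigr => i _; rewrite !mxE.
rewrite (_ : \prod_(i < n) poisson r (w' ord0 i) =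
  \prod_(i < n) poisson r (w ord0 (lift ord0 i))); last by apply: eq_bigr => i _; rewrite mxE.
ring.
Qed.

Lemma integral_laplace_rV n r : 0 < r ->
  (\int[leb_rV n]_x (laplace_rV r x)%:E = (poisson_rV r (0 : 'rV[R]_n))%:E)%E.
Proof.
move=> r0; have := ge0_integral_laplace_rV_cos (pi / 2) (0 : 'rV[R]_n) r0.
rewrite cos_pihalf mul0r addr0 => <-; apply: eq_integral => x _.
rewrite (_ : dotp x 0 = 0); last by rewrite /dotp big1// => i _; rewrite mxE mulr0.
by rewrite mulr0 addr0 cos_pihalf addr0 mulr1.
Qed.

Lemma integrable_laplace_rV n r : 0 < r ->
  (leb_rV n).-integrable [set: 'rV[R]_n] (EFin \o laplace_rV r).
Proof.
move=> r0; apply/integrableP; split; first by apply/measurable_EFinP; exact: measurable_laplace_rV.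
under eq_integral do rewrite /= ger0_norm ?laplace_rV_ge0//.
by rewrite integral_laplace_rV// ltry.
Qed.

Lemma integral_laplace_rV_cos n r th (w : 'rV[R]_n) : 0 < r ->
  \int[leb_rV n]_x (laplace_rV r x * cos (th + 2 * pi * dotp x w)) =
  cos th * poisson_rV r w.
Proof.
move=> r0.
have mc : measurable_fun [set: 'rV[R]_n] (fun x => cos (th + 2 * pi * dotp x w)).
  exact: measurable_cos_dotp.
have i2 : (leb_rV n).-integrable [set: 'rV[R]_n]
    (fun x => (laplace_rV r x * (1 + cos (th + 2 * pi * dotp x w)))%:E).
  apply: (le_integrable measurableT _ _ (integrableZl measurableT 2 (integrable_laplace_rV n r0))).
    apply/measurable_EFinP; apply: measurable_funM; first exact: measurable_laplace_rV.
    exact: measurable_funD.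
  move=> x _; rewrite lee_fin !normrM mulrC ler_pM// ger0_norm ?ler_norm//.
    by rewrite [leRHS]ger0_norm// [leRHS](_ : 2 = 1 + 1)// lerD2l cos_le1.
transitivity (\int[leb_rV n]_x (laplace_rV r x * (1 + cos (th + 2 * pi * dotp x w)) - laplace_rV r x)).
  by apply: eq_Rintegral => x _; ring.
rewrite RintegralB//; last exact: integrable_laplace_rV.
by rewrite /Rintegral ge0_integral_laplace_rV_cos// integral_laplace_rV//= addrC addKr.
Qed.

Lemma integral_poisson_rV n r (y : 'rV[R]_n) : 0 < r ->
  (\int[leb_rV n]_x (poisson_rV r (x - y))%:E = 1)%E.
Proof.
move=> r0.
under eq_integral => x _.
  rewrite /poisson_rV; under eq_bigr do rewrite mxE [(- y) _ _]mxE.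
  over.
rewrite (@ge0_integral_rV_prod _ _ (fun i t => poisson r (t - y ord0 i)) (fun=> 1)).
- by rewrite big1.
- move=> i; apply: (measurableT_comp (measurable_poisson r0)).
  by apply: measurable_funB => //; exact: measurable_id.
- by move=> i x; rewrite ltW// poisson_gt0.
- by move=> i; rewrite integral_poisson.
Qed.

(* After clearing denominators this is (a + b)^2 <= 2 a^2 + 2 b^2, using s <= r. *)
Lemma poisson_mul_le r s (a b : R) : 0 < s -> s <= r ->
  poisson r a * poisson s b <= 2 * poisson r (a + b) * (poisson s b + poisson r a).
Proof.
move=> s0 sr; have r0 : 0 < r by exact: lt_le_trans sr.
have := poisson_den_gt0 a r0; have := poisson_den_gt0 b s0.
have := poisson_den_gt0 (a + b) r0; rewrite /poisson mulrDr.
move: (2 * pi * a) (2 * pi * b) => {}a {}b D1 D2 D3.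
rewrite -subr_ge0 (_ : _ - _ = 4 * r * (s * r ^+ 2 + 2 * r * s ^+ 2 + 2 * (r - s) * b ^+ 2 +
  s * (a - b) ^+ 2) / ((r ^+ 2 + (a + b) ^+ 2) * (s ^+ 2 + b ^+ 2) * (r ^+ 2 + a ^+ 2))).
  rewrite divr_ge0//; last by rewrite ltW// !mulr_gt0.
  rewrite mulr_ge0//; first by rewrite mulr_ge0// ltW.
  have p1 : 0 <= s * r ^+ 2 := mulr_ge0 (ltW s0) (sqr_ge0 r).
  have p2 : 0 <= r * s ^+ 2 := mulr_ge0 (ltW r0) (sqr_ge0 s).
  have p3 : 0 <= (r - s) * b ^+ 2 by rewrite mulr_ge0 ?sqr_ge0// subr_ge0.
  have p4 : 0 <= s * (a - b) ^+ 2 := mulr_ge0 (ltW s0) (sqr_ge0 (a - b)).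
  by lra.
by field; rewrite !gt_eqF.
Qed.

Lemma poisson_doubling r s (a : R) : 0 < r -> r <= s -> s <= 2 * r ->
  poisson r a <= 2 * poisson s a.
Proof.
move=> r0 rs s2r; have s0 : 0 < s by exact: lt_le_trans rs.
have := poisson_den_gt0 a r0; have := poisson_den_gt0 a s0.
rewrite /poisson; move: (2 * pi * a) => {}a D1 D2.
rewrite mulrA ler_pdivrMr// mulrAC ler_pdivlMr//.
have h1 : r * s * s <= r * s * (2 * r) by rewrite ler_pM2l// mulr_gt0.
have h2 : r * a ^+ 2 <= s * a ^+ 2 by rewrite ler_wpM2r// sqr_ge0.
have h3 : 0 <= s * a ^+ 2 by rewrite mulr_ge0 ?sqr_ge0// ltW.
lra.
Qed.

Lemma poisson_rV_doubling n r s (a : 'rV[R]_n) : 0 < r -> r <= s -> s <= 2 * r ->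
  poisson_rV r a <= 2 ^+ n * poisson_rV s a.
Proof.
move=> r0 rs s2r; have -> : 2 ^+ n = \prod_(i < n) (2 : R) by rewrite prodr_const card_ord.
rewrite -big_split.
apply: ler_prod => i _; rewrite ltW ?poisson_gt0//=.
exact: poisson_doubling.
Qed.

(** In [poisson_mul_le] the factor [poisson r (a - b)] is independent of [z], and the two remaining
    kernels have mass 1, whence [4 = 2 * (1 + 1)]. The exact convolution is [poisson (r + s)]; this
    cruder bound needs only algebra. *)
Lemma integral_poisson_mul_le r s (a b : R) : 0 < s -> s <= r ->
  (\int[lebesgue_measure]_z (poisson r (a - z) * poisson s (z - b))%:E
    <= (4 * poisson r (a - b))%:E)%E.
Proof.
move=> s0 sr; have r0 : 0 < r by exact: lt_le_trans sr.
have m1 : measurable_fun [set: R] (fun z => poisson r (a - z)).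
  by apply: (measurableT_comp (measurable_poisson r0)); apply: measurable_funB => //; exact: measurable_id.
have m2 : measurable_fun [set: R] (fun z => poisson s (z - b)).
  by apply: (measurableT_comp (measurable_poisson s0)); apply: measurable_funB => //; exact: measurable_id.
apply: (@le_trans _ _ (\int[lebesgue_measure]_z ((2 * poisson r (a - b))%:E *
    ((poisson s (z - b))%:E + (poisson r (z - a))%:E)))%E).
  apply: ge0_le_integral => //.
  - by move=> z _; rewrite lee_fin mulr_ge0// ltW// poisson_gt0.
  - by apply/measurable_EFinP; exact: measurable_funM.
  - apply: measurable_funeM; apply: emeasurable_funD; apply/measurable_EFinP => //.
    by under eq_fun do rewrite -poissonN opprB.
  - move=> z _; rewrite -EFinD -EFinM lee_fin -(poissonN r (z - a)) opprB.
    by rewrite [in leRHS](_ : a - b = (a - z) + (z - b)); [exact: poisson_mul_le|ring].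
rewrite ge0_integralZl//; first last.
- by rewrite lee_fin mulr_ge0// ltW// poisson_gt0.
- by move=> z _; rewrite -EFinD lee_fin addr_ge0// ltW// poisson_gt0.
- apply: emeasurable_funD; apply/measurable_EFinP => //.
  by under eq_fun do rewrite -poissonN opprB.
rewrite ge0_integralD//; first last.
- apply/measurable_EFinP.
  by under eq_fun do rewrite -poissonN opprB.
- by move=> z _; rewrite lee_fin ltW// poisson_gt0.
- exact/measurable_EFinP.
- by move=> z _; rewrite lee_fin ltW// poisson_gt0.
rewrite !integral_poisson// -EFinD -EFinM lee_fin; lra.
Qed.

Lemma integral_poisson_rV_mul_le n r s (a b : 'rV[R]_n) : 0 < s -> s <= r ->
  (\int[leb_rV n]_z (poisson_rV r (a - z) * poisson_rV s (z - b))%:E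
    <= (4 ^+ n * poisson_rV r (a - b))%:E)%E.
Proof.
move=> s0 sr; have r0 : 0 < r by exact: lt_le_trans sr.
pose h i (t : R) := poisson r (a ord0 i - t) * poisson s (t - b ord0 i).
pose c i := fine (\int[lebesgue_measure]_z (h i z)%:E)%E.
have hc i : (\int[lebesgue_measure]_z (h i z)%:E = (c i)%:E)%E.
  rewrite /c fineK// ge0_fin_numE; last first.
    by apply: integral_ge0 => z _; rewrite lee_fin mulr_ge0// ltW// poisson_gt0.
  by rewrite (le_lt_trans (integral_poisson_mul_le (a ord0 i) (b ord0 i) s0 sr))// ltry.
rewrite (_ : (\int[_]_z _ = (\prod_(i < n) c i)%:E)%E); last first.
  rewrite -(ge0_integral_rV_prod _ _ hc).
  - apply: eq_integral => z _; rewrite /poisson_rV -big_split; congr (_%:E).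
    by apply: eq_bigr => i _; rewrite /h !mxE.
  - move=> i; apply: measurable_funM.
      by apply: (measurableT_comp (measurable_poisson r0)); apply: measurable_funB => //; exact: measurable_id.
    by apply: (measurableT_comp (measurable_poisson s0)); apply: measurable_funB => //; exact: measurable_id.
  - by move=> i z; rewrite mulr_ge0// ltW// poisson_gt0.
have -> : 4 ^+ n = \prod_(i < n) (4 : R) by rewrite prodr_const card_ord.
rewrite /poisson_rV -big_split lee_fin; apply: ler_prod => i _; apply/andP; split.
  by rewrite -lee_fin -hc; apply: integral_ge0 => z _; rewrite lee_fin mulr_ge0// ltW// poisson_gt0.
by rewrite -lee_fin -hc !mxE; exact: integral_poisson_mul_le.
Qed.

(** Products of cosines produce the kernel at [x - y] and at [x + y], with coefficients depending on
    the phases. This half-sum dominates all of them and is still symmetric and of mass 1. *)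
Definition poisson_kernel n r (x y : 'rV[R]_n) : R :=
  (poisson_rV r (x - y) + poisson_rV r (x + y)) / 2.

Lemma poisson_kernel_ge0 n r (x y : 'rV[R]_n) : 0 < r -> 0 <= poisson_kernel r x y.
Proof. by move=> r0; rewrite divr_ge0// addr_ge0// poisson_rV_ge0. Qed.

Lemma poisson_kernelC n r (x y : 'rV[R]_n) : poisson_kernel r x y = poisson_kernel r y x.
Proof. by rewrite /poisson_kernel -poisson_rVN opprB [y + x]addrC. Qed.

Lemma measurable_poisson_kernel d (T : measurableType d) n r (f g : T -> 'rV[R]_n) :
  0 < r -> measurable_fun [set: T] f -> measurable_fun [set: T] g ->
  measurable_fun [set: T] (fun t => poisson_kernel r (f t) (g t)).
Proof.
move=> r0 mf mg; apply: measurable_funM => //; apply: measurable_funD;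
  apply: measurable_poisson_rV => //.
  by apply: measurable_rVD => //; exact: measurable_rVN.
exact: measurable_rVD.
Qed.

Lemma integral_poisson_kernel n r (x : 'rV[R]_n) : 0 < r ->
  (\int[leb_rV n]_y (poisson_kernel r x y)%:E = 1)%E.
Proof.
move=> r0.
have mP (c : 'rV[R]_n) : measurable_fun [set: 'rV[R]_n] (fun y => (poisson_rV r (y - c))%:E).
  apply/measurable_EFinP; apply: measurable_poisson_rV => //.
  by apply: measurable_rVD; [exact: measurable_id|exact: measurable_cst].
transitivity (\int[leb_rV n]_y (2^-1%:E * ((poisson_rV r (y - x))%:E + (poisson_rV r (y - - x))%:E)))%E.
  apply: eq_integral => y _; rewrite -EFinD -EFinM poisson_kernelC /poisson_kernel.
  by rewrite opprK mulrC.
rewrite ge0_integralZl//; first last.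
- by move=> y _; rewrite -EFinD lee_fin addr_ge0// poisson_rV_ge0.
- exact: emeasurable_funD.
rewrite ge0_integralD//.
- by rewrite !integral_poisson_rV// -EFinD -EFinM; congr (_%:E); field.
- by move=> y _; rewrite lee_fin poisson_rV_ge0.
- by move=> y _; rewrite lee_fin poisson_rV_ge0.
Qed.

Lemma integral_poisson_kernel_mul_le n r s (x y : 'rV[R]_n) : 0 < s -> s <= r ->
  (\int[leb_rV n]_z (poisson_kernel r x z * poisson_kernel s z y)%:E
    <= (4 ^+ n * poisson_kernel r x y)%:E)%E.
Proof.
move=> s0 sr; have r0 : 0 < r by exact: lt_le_trans sr.
pose G (a b : 'rV[R]_n) z := (poisson_rV r (a - z) * poisson_rV s (z - b))%:E.
have mG a b : measurable_fun [set: 'rV[R]_n] (G a b).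
  apply/measurable_EFinP; apply: measurable_funM.
    apply: measurable_poisson_rV => //.
    by apply: measurable_rVD; [exact: measurable_cst|apply: measurable_rVN; exact: measurable_id].
  apply: measurable_poisson_rV => //.
  by apply: measurable_rVD; [exact: measurable_id|exact: measurable_cst].
have G0 a b z : (0 <= G a b z)%E by rewrite lee_fin mulr_ge0// poisson_rV_ge0.
(* By evenness [x + z] may be replaced by [- x - z], so the four terms are compositions from [x] or
   [- x] to [y] or [- y]. At the end they pair off again, by evenness, into
   [poisson_kernel r x y]. *)
have GE z : (poisson_kernel r x z * poisson_kernel s z y)%:E =
    (4^-1%:E * ((G x y z + G x (- y)%R z) + (G (- x)%R y z + G (- x)%R (- y)%R z)))%E.
  rewrite /G -!EFinD -EFinM; congr (_%:E); rewrite /poisson_kernel opprK.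
  rewrite -(poisson_rVN r (x + z)) opprD.
  by field.
under eq_integral do rewrite GE.
have mGG a b a' b' : measurable_fun [set: 'rV[R]_n] (fun z => G a b z + G a' b' z)%E.
  exact: emeasurable_funD.
rewrite ge0_integralZl//; first last.
- by move=> z _; rewrite !adde_ge0.
- exact: emeasurable_funD.
rewrite ge0_integralD//; first last.
- by move=> z _; rewrite !adde_ge0.
- by move=> z _; rewrite !adde_ge0.
rewrite !ge0_integralD//.
rewrite lee_pdivrMl//.
rewrite (le_trans (leeD (leeD (integral_poisson_rV_mul_le _ _ s0 sr) (integral_poisson_rV_mul_le _ _ s0 sr))
  (leeD (integral_poisson_rV_mul_le _ _ s0 sr) (integral_poisson_rV_mul_le _ _ s0 sr))))//.
rewrite -!EFinD -EFinM lee_fin /poisson_kernel opprK.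
rewrite -(poisson_rVN r (- x - y)) -(poisson_rVN r (- x + y)) !opprD !opprK.
by rewrite le_eqVlt; apply/orP; left; apply/eqP; field.
Qed.

End poisson_rV.

(** * Maximal functions of symmetric Markov kernels *)

Section integral_tools.
Context {R : realType} d (T : measurableType d) (mu : {measure set T -> \bar R}).

Lemma le_EFin_Rintegral (g : T -> R) : measurable_fun [set: T] g ->
  (`|\int[mu]_x g x|%:E <= \int[mu]_x `|g x|%:E)%E.
Proof.
move=> mg; rewrite /Rintegral; apply: (@le_trans _ _ (`|\int[mu]_x (g x)%:E|)%E).
  by case: integral => [i| |]; rewrite ?leey.
by apply: le_abse_integral => //; exact/measurable_EFinP.
Qed.

Lemma EFin_Rintegral (g : T -> R) (c : R) :
  (forall x, 0 <= g x) -> (\int[mu]_x (g x)%:E <= c%:E)%E ->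
  ((\int[mu]_x g x)%:E = \int[mu]_x (g x)%:E)%E.
Proof.
move=> g0 gc; rewrite /Rintegral fineK// ge0_fin_numE ?(le_lt_trans gc) ?ltry//.
by apply: integral_ge0 => x _; rewrite lee_fin.
Qed.

(** A square is the supremum of its tangents [2 c a - c^2], attained at [c = a]. Tangents are linear
    in [a], so the hypothesis can be obtained by integrating a pointwise inequality, even when [S]
    is infinite. *)
Lemma sqr_le_of_tangents (a : R) (S : \bar R) : 0 <= a -> (0 <= S)%E ->
  (forall c : R, 0 <= c -> ((2 * c * a)%:E <= S + (c ^+ 2)%:E)%E) -> ((a ^+ 2)%:E <= S)%E.
Proof.
move=> a0 + /(_ a a0); case: S => [s| |] //= _; last by move=> _; rewrite leey.
by rewrite -EFinD !lee_fin; nra.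
Qed.

(** Young's inequality. The weight [c] is kept free: it is tuned below to absorb a term, and in the
    end it becomes the parameter that balances [f] against [g]. *)
Lemma integral_mul_le (u v : T -> R) (c : R) : 0 < c ->
  measurable_fun [set: T] u -> measurable_fun [set: T] v ->
  (forall x, 0 <= u x) -> (forall x, 0 <= v x) ->
  (\int[mu]_x (u x * v x)%:E <=
    (c / 2)%:E * \int[mu]_x (u x ^+ 2)%:E + (2 * c)^-1%:E * \int[mu]_x (v x ^+ 2)%:E)%E.
Proof.
move=> c0 mu_ mv u0 v0.
have c2 : 0 <= c / 2 by rewrite divr_ge0// ltW.
have c2' : 0 <= (2 * c)^-1 by rewrite invr_ge0 mulr_ge0// ltW.
have mu2 : measurable_fun [set: T] (fun z => (u z ^+ 2)%:E).
  by apply/measurable_EFinP; exact: measurable_funX.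
have mv2 : measurable_fun [set: T] (fun z => (v z ^+ 2)%:E).
  by apply/measurable_EFinP; exact: measurable_funX.
have u20 z : (0 <= (u z ^+ 2)%:E)%E by rewrite lee_fin sqr_ge0.
have v20 z : (0 <= (v z ^+ 2)%:E)%E by rewrite lee_fin sqr_ge0.
rewrite -!ge0_integralZl//.
rewrite -ge0_integralD//; first last.
- exact: measurable_funeM.
- by move=> z _; rewrite mule_ge0.
- exact: measurable_funeM.
- by move=> z _; rewrite mule_ge0.
apply: ge0_le_integral => //.
- by move=> z _; rewrite lee_fin mulr_ge0.
- by apply/measurable_EFinP; exact: measurable_funM.
- by apply: emeasurable_funD; exact: measurable_funeM.
move=> z _; rewrite -!EFinM -EFinD lee_fin.
rewrite -subr_ge0 (_ : _ - _ = (2 * c)^-1 * (c * u z - v z) ^+ 2).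
  by rewrite mulr_ge0 ?sqr_ge0.
by field; rewrite gt_eqF.
Qed.

End integral_tools.

Section markov_kernel.
Context {R : realType} d (T : measurableType d) (mu : {sigma_finite_measure set T -> \bar R}).
Local Notation int f := (\int[mu]_x (f x)%:E)%E.

Context (k : T -> T -> R).
Hypothesis mk : measurable_fun [set: T * T] (fun z => k z.1 z.2).
Hypothesis k0 : forall x y, 0 <= k x y.
Hypothesis kC : forall x y, k x y = k y x.
Hypothesis k1 : forall x, (\int[mu]_y (k x y)%:E = 1)%E.

Let mkx x : measurable_fun [set: T] (k x).
Proof. exact: (measurableT_comp mk (measurable_pair1 x)). Qed.

(** The tangent inequality [2 c h <= h^2 + c^2] is integrated against the probability density
    [k x]. *)
Lemma markov_Jensen (h : T -> R) x : measurable_fun [set: T] h -> (forall y, 0 <= h y) ->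
  (((\int[mu]_y (h y * k x y)) ^+ 2)%:E <= \int[mu]_y (h y ^+ 2 * k x y)%:E)%E.
Proof.
move=> mh h0; apply: sqr_le_of_tangents.
- by apply: Rintegral_ge0 => y _; rewrite mulr_ge0.
- by apply: integral_ge0 => y _; rewrite lee_fin mulr_ge0// sqr_ge0.
move=> c c0.
have ihk : measurable_fun [set: T] (fun y => h y * k x y) by exact: measurable_funM.
have ihk2 : measurable_fun [set: T] (fun y => h y ^+ 2 * k x y).
  by apply: measurable_funM => //; exact: measurable_funX.
apply: (@le_trans _ _ ((2 * c)%:E * \int[mu]_y (h y * k x y)%:E)%E).
  rewrite EFinM lee_wpmul2l ?lee_fin ?mulr_ge0// /Rintegral.
  have : (0 <= \int[mu]_y (h y * k x y)%:E)%E by apply: integral_ge0 => y _; rewrite lee_fin mulr_ge0.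
  by case: integral => [i| |] //; rewrite leey.
rewrite -ge0_integralZl//; first last.
- by rewrite lee_fin mulr_ge0.
- by move=> y _; rewrite lee_fin mulr_ge0.
- exact/measurable_EFinP.
have -> : (c ^+ 2)%:E = (\int[mu]_y ((c ^+ 2)%:E * (k x y)%:E))%E.
  rewrite ge0_integralZl//; first by rewrite k1 mule1.
  - exact/measurable_EFinP.
  - by move=> y _; rewrite lee_fin.
  - by rewrite lee_fin sqr_ge0.
rewrite -ge0_integralD//; first last.
- by apply: measurable_funeM; exact/measurable_EFinP.
- by move=> y _; rewrite -EFinM lee_fin mulr_ge0// sqr_ge0.
- exact/measurable_EFinP.
- by move=> y _; rewrite lee_fin mulr_ge0// sqr_ge0.
apply: ge0_le_integral => //.
- by move=> y _; rewrite -EFinM lee_fin !mulr_ge0.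
- by apply: measurable_funeM; exact/measurable_EFinP.
- by apply: emeasurable_funD; [exact/measurable_EFinP|apply: measurable_funeM; exact/measurable_EFinP].
- move=> y _; rewrite -!EFinM -EFinD lee_fin mulrA -mulrDl ler_wpM2r//.
  by have := sqr_ge0 (c - h y); nra.
Qed.

Lemma markov_integral (u : T -> R) : measurable_fun [set: T] u -> (forall y, 0 <= u y) ->
  (\int[mu]_x \int[mu]_y (u y * k x y)%:E = int u)%E.
Proof.
move=> mu0 u0.
rewrite (fubini_tonelli (fun z : T * T => (u z.2 * k z.1 z.2)%:E))/=; first last.
- by move=> z; rewrite lee_fin mulr_ge0.
- by apply/measurable_EFinP; apply: measurable_funM => //; exact: measurableT_comp.
apply: eq_integral => y _; under eq_integral do rewrite EFinM kC.
rewrite ge0_integralZl//; first by rewrite k1 mule1.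
- exact/measurable_EFinP.
- by move=> x _; rewrite lee_fin.
- by rewrite lee_fin.
Qed.

Lemma markov_contraction (h : T -> R) : measurable_fun [set: T] h -> (forall y, 0 <= h y) ->
  (\int[mu]_x ((\int[mu]_y (h y * k x y)) ^+ 2)%:E <= \int[mu]_x (h x ^+ 2)%:E)%E.
Proof.
move=> mh h0; rewrite -(markov_integral (u := fun y => h y ^+ 2)); first last.
- by move=> y; exact: sqr_ge0.
- exact: measurable_funX.
apply: ge0_le_integral => //.
- by move=> x _; rewrite lee_fin sqr_ge0.
- apply/measurable_EFinP; apply: measurable_funX.
  apply: (@measurable_fun_Rintegral _ _ _ _ _ mu (fun z : T * T => h z.2 * k z.1 z.2)).
  by apply: measurable_funM => //; exact: measurableT_comp.
- apply: (@emeasurable_fun_integral _ _ _ _ _ mu (fun z : T * T => (h z.2 ^+ 2 * k z.1 z.2)%:E)).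
  apply/measurable_EFinP; apply: measurable_funM => //; apply: measurable_funX.
  exact: measurableT_comp.
- by move=> x _; exact: markov_Jensen.
Qed.

(** From [2 u(x) u(y) <= u(x)^2 + u(y)^2], integrating the kernel in the variable that is free in
    each term. Plancherel's inequality will be an instance with a Poisson kernel. *)
Lemma markov_quadratic_form_le (u : T -> R) :
  measurable_fun [set: T] u -> (forall y, 0 <= u y) ->
  (\int[mu]_x \int[mu]_y (u x * (u y * k x y))%:E <= \int[mu]_x (u x ^+ 2)%:E)%E.
Proof.
move=> mu0 u0.
have mu1 : measurable_fun [set: T * T] (fun z => u z.1) by exact: measurableT_comp.
have mu2 : measurable_fun [set: T * T] (fun z => u z.2) by exact: measurableT_comp.
have m1 : measurable_fun [set: T * T] (fun z => (u z.1 ^+ 2 * k z.1 z.2)%:E).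
  by apply/measurable_EFinP; apply: measurable_funM => //; exact: measurable_funX.
have m2 : measurable_fun [set: T * T] (fun z => (u z.2 ^+ 2 * k z.1 z.2)%:E).
  by apply/measurable_EFinP; apply: measurable_funM => //; exact: measurable_funX.
have p1 z : (0 <= (u z.1 ^+ 2 * k z.1 z.2)%:E)%E by rewrite lee_fin mulr_ge0// sqr_ge0.
have p2 z : (0 <= (u z.2 ^+ 2 * k z.1 z.2)%:E)%E by rewrite lee_fin mulr_ge0// sqr_ge0.
rewrite -(fubini_tonelli1 (fun z : T * T => (u z.1 * (u z.2 * k z.1 z.2))%:E)); first last.
- by move=> z; rewrite lee_fin !mulr_ge0.
- by apply/measurable_EFinP; apply: measurable_funM => //; exact: measurable_funM.
apply: (@le_trans _ _ (\int[mu \x mu]_z (2^-1%:E *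
    ((u z.1 ^+ 2 * k z.1 z.2)%:E + (u z.2 ^+ 2 * k z.1 z.2)%:E)))%E).
  apply: ge0_le_integral => //.
  - by move=> z _; rewrite lee_fin !mulr_ge0.
  - by apply/measurable_EFinP; apply: measurable_funM => //; exact: measurable_funM.
  - by apply: measurable_funeM; exact: emeasurable_funD.
  - move=> z _; rewrite -EFinD -EFinM lee_fin -mulrDl !mulrA ler_wpM2r//.
    by have := sqr_ge0 (u z.1 - u z.2); nra.
rewrite ge0_integralZl//; [|exact: emeasurable_funD|by move=> z _; rewrite adde_ge0].
rewrite ge0_integralD// !fubini_tonelli1//=.
have -> : (\int[mu]_x fubini_F mu (fun z => (u z.1 ^+ 2 * k z.1 z.2)%:E) x = \int[mu]_x (u x ^+ 2)%:E)%E.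
  apply: eq_integral => x _; rewrite /fubini_F /=.
  under eq_integral do rewrite EFinM.
  rewrite ge0_integralZl//; first by rewrite k1 mule1.
  - exact/measurable_EFinP.
  - by move=> y _; rewrite lee_fin.
  - by rewrite lee_fin sqr_ge0.
rewrite /fubini_F /= markov_integral//; last by move=> y; exact: sqr_ge0.
  set I := integral _ _ _.
  have : (0 <= I)%E by apply: integral_ge0 => x _; rewrite lee_fin sqr_ge0.
  case: I => [i| |] //= i0; last by rewrite leey.
  by rewrite -EFinD -EFinM lee_fin; lra.
exact: measurable_funX.
Qed.

End markov_kernel.

(** * The maximal inequality for a sequence of symmetric Markov kernels *)

Fixpoint running_max {R : realType} (a : nat -> R) N : R :=
  if N is N'.+1 then Num.max (running_max a N') (a N) else a 0.

Lemma nondecreasing_running_max {R : realType} (a : nat -> R) :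
  {homo running_max a : m n / (m <= n)%N >-> m <= n}.
Proof. by apply: homo_leq => [//|? ? ?|n /=]; [exact: le_trans|rewrite le_max lexx]. Qed.

Lemma le_running_max {R : realType} (a : nat -> R) i N : (i <= N)%N -> a i <= running_max a N.
Proof.
move=> /(nondecreasing_running_max a); apply: le_trans.
by case: i => [//|i] /=; rewrite le_max lexx orbT.
Qed.

Section maximal.
Context {R : realType} d (T : measurableType d) (mu : {sigma_finite_measure set T -> \bar R}).

Context (k : nat -> T -> T -> R) (C : R).
Hypothesis mk : forall i, measurable_fun [set: T * T] (fun z => k i z.1 z.2).
Hypothesis k0 : forall i x y, 0 <= k i x y.
Hypothesis kC : forall i x y, k i x y = k i y x.
Hypothesis k1 : forall i x, (\int[mu]_y (k i x y)%:E = 1)%E.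
Hypothesis C0 : 0 < C.
(** The bound [P_r P_s <= C P_r] for [s <= r], weakened to a sum of both kernels so that no order on
    the indices is involved. *)
Hypothesis kk : forall i j x y,
  (\int[mu]_z (k i x z * k j z y)%:E <= (C * (k i x y + k j x y))%:E)%E.

Let mkx i x : measurable_fun [set: T] (k i x).
Proof. exact: (measurableT_comp (mk i) (measurable_pair1 x)). Qed.

(* The weights [e i x] select the kernel used at [x], which linearises a maximum over [i <= N]. *)
Section linearized.
Context (N : nat) (e : nat -> T -> R).
Hypothesis me : forall i, measurable_fun [set: T] (e i).
Hypothesis e0 : forall i x, 0 <= e i x.
Hypothesis e1 : forall x, \sum_(i < N.+1) e i x = 1.

Let K x y := \sum_(i < N.+1) e i x * k i x y.

Let K0 x y : 0 <= K x y.
Proof. by apply: sumr_ge0 => i _; rewrite mulr_ge0. Qed.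

Let mK : measurable_fun [set: T * T] (fun z => K z.1 z.2).
Proof.
by apply: measurable_sum => i; apply: measurable_funM => //; exact: measurableT_comp.
Qed.

Let mKx x : measurable_fun [set: T] (K x).
Proof. exact: (measurableT_comp mK (measurable_pair1 x)). Qed.

Let mKy y : measurable_fun [set: T] (K^~ y).
Proof. exact: (measurableT_comp mK (measurable_pair2 y)). Qed.

Let e_le1 (i : 'I_N.+1) x : e i x <= 1.
Proof. by rewrite -(e1 x) (bigD1 i)//= lerDl sumr_ge0. Qed.

(* T times its adjoint is at most C times their sum, which bounds T on L^2. *)
Let KK x x' : (\int[mu]_z (K x z * K x' z)%:E <= (C * (K x x' + K x' x))%:E)%E.
Proof.
pose F (i j : 'I_N.+1) z := ((e i x * e j x')%:E * (k i x z * k j z x')%:E)%E.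
have mkk i j : measurable_fun [set: T] (fun z => (k i x z * k j z x')%:E).
  by apply/measurable_EFinP; apply: measurable_funM => //; under eq_fun do rewrite kC; exact: mkx.
have F0 i j z : (0 <= F i j z)%E by rewrite /F -EFinM lee_fin !mulr_ge0.
have mF i j : measurable_fun [set: T] (F i j) by exact: measurable_funeM.
have FE z : (K x z * K x' z)%:E = (\sum_(i < N.+1) \sum_(j < N.+1) F i j z)%E.
  rewrite /K big_distrl /= -sumEFin; apply: eq_bigr => i _.
  rewrite big_distrr /= -sumEFin; apply: eq_bigr => j _.
  by rewrite /F -EFinM (kC j z); congr (_%:E); ring.
under eq_integral do rewrite FE.
rewrite ge0_integral_sum//; first last.
- by move=> i z _; apply: sume_ge0.
- by move=> i; exact: emeasurable_sum.
apply: (@le_trans _ _ (\sum_(i < N.+1) \sum_(j < N.+1) (e i x * e j x' * (C * (k i x x' + k j x x')))%:E)%E).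
  apply: lee_sum => i _; rewrite ge0_integral_sum//.
  apply: lee_sum => j _; rewrite /F ge0_integralZl//.
  - by rewrite [leRHS]EFinM lee_wpmul2l// lee_fin mulr_ge0.
  - by move=> z _; rewrite lee_fin mulr_ge0.
  - by rewrite lee_fin mulr_ge0.
under eq_bigr do rewrite sumEFin.
rewrite sumEFin lee_fin le_eqVlt; apply/orP; left; apply/eqP.
transitivity (\sum_(i < N.+1) C * (e i x * k i x x' + e i x * K x' x)).
  apply: eq_bigr => i _.
  rewrite [X in _ + e i x * X](_ : _ = \sum_(j < N.+1) e j x' * k j x x'); last first.
    by apply: eq_bigr => j _; rewrite kC.
  rewrite -[X in X + _]mulr1 -(e1 x') !mulr_sumr -big_split mulr_sumr.
  by apply: eq_bigr => j _ /=; ring.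
by rewrite -mulr_sumr big_split /= -mulr_suml e1 mul1r.
Qed.

(** The mean of the kernels is again a symmetric Markov kernel, and [K] is at most [N + 1] times it.
    The resulting bounds grow with [N]; they serve to know that the integrals are finite and the
    images bounded before terms are absorbed. *)
Let kbar x y := N.+1%:R^-1 * \sum_(i < N.+1) k i x y.

Let mS : measurable_fun [set: T * T] (fun z => \sum_(i < N.+1) k i z.1 z.2).
Proof. exact: measurable_sum. Qed.

Let mkbar : measurable_fun [set: T * T] (fun z => kbar z.1 z.2).
Proof. exact: measurable_funM. Qed.

Let kbar0 x y : 0 <= kbar x y.
Proof. by rewrite mulr_ge0// sumr_ge0. Qed.

Let kbarC x y : kbar x y = kbar y x.
Proof. by congr (_ * _); apply: eq_bigr => i _; rewrite kC. Qed.

Let kbar1 x : (\int[mu]_y (kbar x y)%:E = 1)%E.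
Proof.
under eq_integral do rewrite /kbar EFinM -sumEFin.
rewrite ge0_integralZl//; first last.
- by move=> y _; apply: sume_ge0 => i _; rewrite lee_fin.
- by apply: emeasurable_sum => i; exact/measurable_EFinP.
rewrite ge0_integral_sum//; first last.
- by move=> i y _; rewrite lee_fin.
- by move=> i; exact/measurable_EFinP.
under eq_bigr do rewrite k1.
by rewrite sumEFin -EFinM sumr_const card_ord mulVf.
Qed.

Let K_le x y : K x y <= N.+1%:R * kbar x y.
Proof.
rewrite /kbar mulrA divff// mul1r; apply: ler_sum => i _.
by rewrite ler_piMl.
Qed.

Section bounded.
Context (u : T -> R) (B : R).
Hypothesis mu_ : measurable_fun [set: T] u.
Hypothesis u0 : forall x, 0 <= u x.
Hypothesis uB : forall x, u x <= B.

Let muy : measurable_fun [set: T * T] (fun z => u z.2 * K z.1 z.2).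
Proof. by apply: measurable_funM => //; exact: measurableT_comp. Qed.

Let mukbar z : measurable_fun [set: T] (fun x => u x * kbar z x).
Proof. by apply: measurable_funM => //; exact: (measurableT_comp mkbar (measurable_pair1 z)). Qed.

Let ukbarB z : (\int[mu]_x (u x * kbar z x)%:E <= B%:E)%E.
Proof.
have Bz : 0 <= B by exact: le_trans (u0 z) (uB z).
apply: (@le_trans _ _ (\int[mu]_x (B%:E * (kbar z x)%:E))%E).
  apply: ge0_le_integral => //.
  - by move=> x _; rewrite lee_fin mulr_ge0.
  - exact/measurable_EFinP.
  - by apply: measurable_funeM; apply/measurable_EFinP; exact: (measurableT_comp mkbar (measurable_pair1 z)).
  - by move=> x _; rewrite -EFinM lee_fin ler_wpM2r.
rewrite ge0_integralZl//; first by rewrite kbar1 mule1.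
- by apply/measurable_EFinP; exact: (measurableT_comp mkbar (measurable_pair1 z)).
- by move=> x _; rewrite lee_fin.
Qed.

Let ukbarE z : ((\int[mu]_x (u x * kbar z x))%:E = \int[mu]_x (u x * kbar z x)%:E)%E.
Proof. by apply: (EFin_Rintegral _ (ukbarB z)) => x; rewrite mulr_ge0. Qed.

Let mt_le z : (\int[mu]_x (u x * K x z)%:E <= (N.+1%:R * \int[mu]_x (u x * kbar z x))%:E)%E.
Proof.
rewrite EFinM ukbarE -ge0_integralZl//; first last.
- by move=> x _; rewrite lee_fin mulr_ge0.
- exact/measurable_EFinP.
apply: ge0_le_integral => //.
- by move=> x _; rewrite lee_fin mulr_ge0.
- by apply/measurable_EFinP; exact: measurable_funM.
- by apply: measurable_funeM; exact/measurable_EFinP.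
- by move=> x _; rewrite -EFinM lee_fin mulrCA ler_wpM2l// kbarC.
Qed.

Let mh_le z : (\int[mu]_x (u x * K z x)%:E <= (N.+1%:R * \int[mu]_x (u x * kbar z x))%:E)%E.
Proof.
rewrite EFinM ukbarE -ge0_integralZl//; first last.
- by move=> x _; rewrite lee_fin mulr_ge0.
- exact/measurable_EFinP.
apply: ge0_le_integral => //.
- by move=> x _; rewrite lee_fin mulr_ge0.
- by apply/measurable_EFinP; exact: measurable_funM.
- by apply: measurable_funeM; exact/measurable_EFinP.
- by move=> x _; rewrite -EFinM lee_fin mulrCA ler_wpM2l.
Qed.

Let adjE z : ((\int[mu]_x (u x * K x z))%:E = \int[mu]_x (u x * K x z)%:E)%E.
Proof. by apply: (EFin_Rintegral _ (mt_le z)) => x; rewrite mulr_ge0. Qed.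

Let opE z : ((\int[mu]_x (u x * K z x))%:E = \int[mu]_x (u x * K z x)%:E)%E.
Proof. by apply: (EFin_Rintegral _ (mh_le z)) => x; rewrite mulr_ge0. Qed.

Lemma linearized_opE z : ((\int[mu]_x (u x * K z x))%:E = \int[mu]_x (u x * K z x)%:E)%E.
Proof. exact: opE. Qed.

Lemma linearized_adjE z : ((\int[mu]_x (u x * K x z))%:E = \int[mu]_x (u x * K x z)%:E)%E.
Proof. exact: adjE. Qed.

Lemma linearized_op_ge0 z : 0 <= \int[mu]_x (u x * K z x).
Proof. by apply: Rintegral_ge0 => x _; rewrite mulr_ge0. Qed.

Lemma linearized_adj_ge0 z : 0 <= \int[mu]_x (u x * K x z).
Proof. by apply: Rintegral_ge0 => x _; rewrite mulr_ge0. Qed.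

Lemma linearized_op_bounded z : \int[mu]_x (u x * K z x) <= N.+1%:R * B.
Proof.
rewrite -lee_fin opE (le_trans (mh_le z))// lee_fin ler_wpM2l//.
by rewrite -lee_fin ukbarE ukbarB.
Qed.

Lemma measurable_linearized_op : measurable_fun [set: T] (fun z => \int[mu]_x (u x * K z x)).
Proof. exact: (@measurable_fun_Rintegral _ _ _ _ _ mu (fun z : T * T => u z.2 * K z.1 z.2)). Qed.

Lemma measurable_linearized_adj : measurable_fun [set: T] (fun z => \int[mu]_x (u x * K x z)).
Proof.
apply: (@measurable_fun_Rintegral _ _ _ _ _ mu (fun z : T * T => u z.2 * K z.2 z.1)).
apply: measurable_funM; first exact: measurableT_comp.
apply: measurable_sum => i; apply: measurable_funM; first exact: measurableT_comp.
by under eq_fun do rewrite kC; exact: mk.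
Qed.

Let sq_le (G : T -> R) : measurable_fun [set: T] G -> (forall z, 0 <= G z) ->
  (forall z, G z <= N.+1%:R * \int[mu]_x (u x * kbar z x)) ->
  (\int[mu]_z (G z ^+ 2)%:E <= (N.+1%:R ^+ 2)%:E * \int[mu]_x (u x ^+ 2)%:E)%E.
Proof.
move=> mG G0 Gle.
have mP : measurable_fun [set: T] (fun z => (\int[mu]_x (u x * kbar z x)) ^+ 2).
  apply: measurable_funX.
  apply: (@measurable_fun_Rintegral _ _ _ _ _ mu (fun z : T * T => u z.2 * kbar z.1 z.2)).
  by apply: measurable_funM => //; exact: measurableT_comp.
have := markov_contraction mkbar kbar0 kbarC kbar1 mu_ u0.
move=> /(lee_wpmul2l (x := (N.+1%:R ^+ 2)%:E)) le1.
rewrite (le_trans _ (le1 _))//.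
rewrite -ge0_integralZl//; first last.
- by move=> z _; rewrite lee_fin sqr_ge0.
- exact/measurable_EFinP.
apply: ge0_le_integral => //.
- by move=> z _; rewrite lee_fin sqr_ge0.
- by apply/measurable_EFinP; exact: measurable_funX.
- by apply: measurable_funeM; exact/measurable_EFinP.
- move=> z _; rewrite -EFinM lee_fin -exprMn ler_sqr ?nnegrE ?mulr_ge0//.
  by apply: Rintegral_ge0 => x _; rewrite mulr_ge0.
Qed.

Lemma linearized_op_finite : (\int[mu]_x (u x ^+ 2)%:E < +oo)%E ->
  (\int[mu]_z ((\int[mu]_x (u x * K z x)) ^+ 2)%:E < +oo)%E.
Proof.
move=> u2; rewrite (le_lt_trans (sq_le measurable_linearized_op linearized_op_ge0 _))//.
  by move=> z; rewrite -lee_fin opE.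
by rewrite lte_mul_pinfty// lee_fin sqr_ge0.
Qed.

Lemma linearized_adj_finite : (\int[mu]_x (u x ^+ 2)%:E < +oo)%E ->
  (\int[mu]_z ((\int[mu]_x (u x * K x z)) ^+ 2)%:E < +oo)%E.
Proof.
move=> u2; rewrite (le_lt_trans (sq_le measurable_linearized_adj linearized_adj_ge0 _))//.
  by move=> z; rewrite -lee_fin adjE.
by rewrite lte_mul_pinfty// lee_fin sqr_ge0.
Qed.

End bounded.

Let mKswap : measurable_fun [set: T * T] (fun z => K z.2 z.1).
Proof.
apply: measurable_sum => i; apply: measurable_funM; first exact: measurableT_comp.
by under eq_fun do rewrite kC; exact: mk.
Qed.

(** Write T for the operator of kernel [K] and S for its adjoint. The left side is [<u, T S u>], and
    [T S <= C (T + S)] bounds it by [2 C <u, S u>], since T and S have the same quadratic form. *)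
Let quadratic_form (u : T -> R) B : measurable_fun [set: T] u ->
  (forall x, 0 <= u x) -> (forall x, u x <= B) ->
  (\int[mu]_z ((\int[mu]_x (u x * K x z)) ^+ 2)%:E <=
    (2 * C)%:E * \int[mu]_z (u z * \int[mu]_x (u x * K x z))%:E)%E.
Proof.
move=> mu_ u0 uB; set M := fun z => \int[mu]_x (u x * K x z).
have mM : measurable_fun [set: T] M by exact: measurable_linearized_adj.
have M0 z : 0 <= M z by exact: linearized_adj_ge0.
have ME z : ((M z)%:E = \int[mu]_x (u x * K x z)%:E)%E.
  exact: (linearized_adjE mu_ u0 uB).
have mu1 : measurable_fun [set: T * T] (fun z => u z.1) by exact: measurableT_comp.
have mu2 : measurable_fun [set: T * T] (fun z => u z.2) by exact: measurableT_comp.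
pose P := (\int[mu]_z (u z * M z)%:E)%E.
have PE : (P = \int[mu]_x \int[mu]_y (u x * (u y * K y x))%:E)%E.
  apply: eq_integral => z _; under [RHS]eq_integral do rewrite EFinM.
  rewrite ge0_integralZl//.
  - by rewrite -ME -EFinM.
  - by apply/measurable_EFinP; exact: measurable_funM.
  - by move=> x _; rewrite lee_fin mulr_ge0.
  - by rewrite lee_fin.
have PE' : (P = \int[mu]_x \int[mu]_y (u x * (u y * K x y))%:E)%E.
  rewrite PE (fubini_tonelli (fun z : T * T => (u z.1 * (u z.2 * K z.2 z.1))%:E))/=.
  - by apply: eq_integral => x _; apply: eq_integral => y _; congr (_%:E); ring.
  - by apply/measurable_EFinP; apply: measurable_funM => //; exact: measurable_funM.
  - by move=> z; rewrite lee_fin !mulr_ge0.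
have E1 : (\int[mu]_z (M z ^+ 2)%:E = \int[mu]_z \int[mu]_x (u x * K x z * M z)%:E)%E.
  apply: eq_integral => z _; under [RHS]eq_integral do rewrite EFinM.
  rewrite ge0_integralZr//; first by rewrite -ME -EFinM expr2.
  - by apply/measurable_EFinP; exact: measurable_funM.
  - by move=> x _; rewrite lee_fin mulr_ge0.
  - by rewrite lee_fin.
rewrite E1 (fubini_tonelli (fun z : T * T => (u z.2 * K z.2 z.1 * M z.1)%:E))/=; first last.
- by move=> z; rewrite lee_fin !mulr_ge0.
- apply/measurable_EFinP; apply: measurable_funM; first exact: measurable_funM.
  exact: measurableT_comp.
pose A x := (\int[mu]_y (u x * (u y * K y x))%:E)%E.
pose A' x := (\int[mu]_y (u x * (u y * K x y))%:E)%E.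
have mA : measurable_fun [set: T * T] (fun z : T * T => (u z.1 * (u z.2 * K z.2 z.1))%:E).
  by apply/measurable_EFinP; apply: measurable_funM => //; exact: measurable_funM.
have mA' : measurable_fun [set: T * T] (fun z : T * T => (u z.1 * (u z.2 * K z.1 z.2))%:E).
  by apply/measurable_EFinP; apply: measurable_funM => //; exact: measurable_funM.
have A0 x : (0 <= A x)%E by apply: integral_ge0 => y _; rewrite lee_fin !mulr_ge0.
have A'0 x : (0 <= A' x)%E by apply: integral_ge0 => y _; rewrite lee_fin !mulr_ge0.
have inner x : (\int[mu]_z (u x * K x z * M z)%:E <= C%:E * (A x + A' x))%E.
  have -> : (\int[mu]_z (u x * K x z * M z)%:E =
      \int[mu]_z \int[mu]_y ((u x * u y) * (K x z * K y z))%:E)%E.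
    apply: eq_integral => z _.
    have -> : (u x * K x z * M z)%:E = ((u x * K x z)%:E * \int[mu]_y (u y * K y z)%:E)%E.
      by rewrite -ME EFinM.
    rewrite -ge0_integralZl//.
    - by apply: eq_integral => y _; rewrite -EFinM; congr (_%:E); ring.
    - by apply/measurable_EFinP; exact: measurable_funM.
    - by move=> y _; rewrite lee_fin mulr_ge0.
    - by rewrite lee_fin mulr_ge0.
  have mKxz : measurable_fun [set: T * T] (fun w => K x w.1).
    exact: (measurableT_comp (mKx x)).
  have mF : measurable_fun [set: T * T] (fun w => ((u x * u w.2) * (K x w.1 * K w.2 w.1))%:E).
    apply/measurable_EFinP; apply: measurable_funM; first exact: measurable_funM.
    exact: measurable_funM.
  rewrite (fubini_tonelli (fun w : T * T => ((u x * u w.2) * (K x w.1 * K w.2 w.1))%:E))//=; last first.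
    by move=> w; rewrite lee_fin !mulr_ge0.
  rewrite -ge0_integralD//; first last.
  - by apply/measurable_EFinP; apply: measurable_funM => //; exact: measurable_funM.
  - by move=> y _; rewrite lee_fin !mulr_ge0.
  - by apply/measurable_EFinP; apply: measurable_funM => //; exact: measurable_funM.
  - by move=> y _; rewrite lee_fin !mulr_ge0.
  rewrite -ge0_integralZl//; first last.
  - by rewrite lee_fin ltW.
  - by move=> y _; rewrite -EFinD lee_fin addr_ge0// !mulr_ge0.
  - by apply: emeasurable_funD; apply/measurable_EFinP;
      (apply: measurable_funM => //; exact: measurable_funM).
  apply: ge0_le_integral => //.
  - by move=> y _; apply: integral_ge0 => z _; rewrite lee_fin !mulr_ge0.
  - apply: (measurable_fun_fubini_tonelli_G _ mF) => w.
    by rewrite lee_fin !mulr_ge0.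
  - apply: measurable_funeM; apply: emeasurable_funD; apply/measurable_EFinP;
      by apply: measurable_funM => //; exact: measurable_funM.
  - move=> y _; under eq_integral do rewrite EFinM.
    rewrite ge0_integralZl//; first last.
    + by rewrite lee_fin mulr_ge0.
    + by move=> z _; rewrite lee_fin mulr_ge0.
    + by apply/measurable_EFinP; exact: measurable_funM.
    apply: (@le_trans _ _ ((u x * u y)%:E * (C * (K x y + K y x))%:E)%E).
      by rewrite lee_wpmul2l// lee_fin mulr_ge0.
    rewrite -EFinD -!EFinM lee_fin.
    by rewrite le_eqVlt; apply/orP; left; apply/eqP; ring.
have mAx : measurable_fun [set: T] A.
  by apply: (measurable_fun_fubini_tonelli_F _ mA) => w; rewrite lee_fin !mulr_ge0.
have mAx' : measurable_fun [set: T] A'.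
  by apply: (measurable_fun_fubini_tonelli_F _ mA') => w; rewrite lee_fin !mulr_ge0.
apply: (@le_trans _ _ (\int[mu]_x (C%:E * (A x + A' x)))%E).
  apply: ge0_le_integral => //.
  - by move=> x _; apply: integral_ge0 => z _; rewrite lee_fin !mulr_ge0.
  - apply: (measurable_fun_fubini_tonelli_F (fun z : T * T => (u z.1 * K z.1 z.2 * M z.2)%:E)).
      apply/measurable_EFinP; apply: measurable_funM; first exact: measurable_funM.
      exact: measurableT_comp.
    by move=> w; rewrite lee_fin !mulr_ge0.
  - by apply: measurable_funeM; exact: emeasurable_funD.
rewrite ge0_integralZl//; first last.
- by rewrite lee_fin ltW.
- by move=> x _; rewrite adde_ge0.
- exact: emeasurable_funD.
rewrite ge0_integralD// -PE -PE'.
have P0 : (0 <= P)%E by apply: integral_ge0 => x _; rewrite lee_fin mulr_ge0.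
rewrite -/P; clearbody P; clear PE PE'; case: P P0 => [p| |] //= p0.
  by rewrite -EFinD -!EFinM lee_fin; lra.
by rewrite [leRHS]gt0_muley ?leey// lte_fin mulr_gt0.
Qed.

(** Young's inequality with weight [2 C] bounds the quadratic form [<u, S u>] by
    [C |u|^2 + |S u|^2 / (4 C)]. After multiplication by [2 C] the last term is half of the left
    side and can be absorbed, the left side being finite. The constant no longer depends on [N]. *)
Lemma linearized_adj_L2 (u : T -> R) B : measurable_fun [set: T] u ->
  (forall x, 0 <= u x) -> (forall x, u x <= B) ->
  (\int[mu]_z ((\int[mu]_x (u x * K x z)) ^+ 2)%:E <=
    (4 * C ^+ 2)%:E * \int[mu]_z (u z ^+ 2)%:E)%E.
Proof.
move=> mu_ u0 uB.
have [u2|] := ltP (\int[mu]_z (u z ^+ 2)%:E)%E +oo%E; last first.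
  by rewrite leye_eq => /eqP ->; rewrite gt0_muley ?leey// lte_fin mulr_gt0// exprn_gt0.
have mfin := linearized_adj_finite mu_ u0 uB u2.
have mle := quadratic_form mu_ u0 uB.
have C2 : 0 < 2 * C by rewrite mulr_gt0.
have ule := integral_mul_le mu C2 mu_ (measurable_linearized_adj mu_) u0 (linearized_adj_ge0 u0).
move: mfin mle ule; set m := (\int[mu]_z ((\int[mu]_x (u x * K x z)) ^+ 2)%:E)%E.
set P := (\int[mu]_z (u z * \int[mu]_x (u x * K x z))%:E)%E.
set U := (\int[mu]_z (u z ^+ 2)%:E)%E in u2 *.
have m0 : (0 <= m)%E by apply: integral_ge0 => z _; rewrite lee_fin sqr_ge0.
have U0 : (0 <= U)%E by apply: integral_ge0 => z _; rewrite lee_fin sqr_ge0.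
have P0 : (0 <= P)%E.
  by apply: integral_ge0 => z _; rewrite lee_fin mulr_ge0// linearized_adj_ge0.
clearbody m P U.
move: U u2 U0 => [U| |] // _ _; move: m m0 => [m| |] // _ _; move: P P0 => [P| |] // _.
  rewrite -!EFinM -EFinD !lee_fin.
  rewrite (_ : 2 * C / 2 = C); last by field.
  rewrite (_ : (2 * (2 * C))^-1 * m = m / (4 * C)); last by field; rewrite gt_eqF.
  move=> h1 h2.
  have : 2 * C * P <= 2 * C * (C * U + m / (4 * C)) by rewrite ler_wpM2l// ltW.
  rewrite (_ : 2 * C * (_ + _) = 2 * C ^+ 2 * U + m / 2); last by field; rewrite gt_eqF.
  by lra.
Qed.

(** Duality: with [G = T u] one has [|G|^2 = <u, S G>], and the adjoint bound applies to [G], which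
    is bounded by [(N + 1) B]. Young's inequality with weight [4 C^2] leaves half of the finite
    quantity [|G|^2] on the right. *)
Lemma linearized_op_L2 (u : T -> R) B : measurable_fun [set: T] u ->
  (forall x, 0 <= u x) -> (forall x, u x <= B) ->
  (\int[mu]_z ((\int[mu]_x (u x * K z x)) ^+ 2)%:E <=
    (4 * C ^+ 2)%:E * \int[mu]_z (u z ^+ 2)%:E)%E.
Proof.
move=> mu_ u0 uB.
have [u2|] := ltP (\int[mu]_z (u z ^+ 2)%:E)%E +oo%E; last first.
  by rewrite leye_eq => /eqP ->; rewrite gt0_muley ?leey// lte_fin mulr_gt0// exprn_gt0.
have mfin := linearized_op_finite mu_ u0 uB u2.
have [G [G0 GB mG GE Gop]] : exists G : T -> R, [/\ forall z, 0 <= G z,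
    forall z, G z <= N.+1%:R * B, measurable_fun [set: T] G,
    forall z, ((G z)%:E = \int[mu]_x (u x * K z x)%:E)%E &
    forall z, \int[mu]_x (u x * K z x) = G z].
  exists (fun z => \int[mu]_x (u x * K z x)); split => //.
  - exact: linearized_op_ge0.
  - exact: linearized_op_bounded.
  - exact: measurable_linearized_op.
  - exact: linearized_opE.
have [M [M0 mM ME Madj]] : exists M : T -> R, [/\ forall z, 0 <= M z,
    measurable_fun [set: T] M,
    forall z, ((M z)%:E = \int[mu]_x (G x * K x z)%:E)%E &
    forall z, \int[mu]_x (G x * K x z) = M z].
  exists (fun z => \int[mu]_x (G x * K x z)); split => //.
  - exact: linearized_adj_ge0.
  - exact: measurable_linearized_adj.
  - exact: linearized_adjE GB.
have := linearized_adj_L2 mG G0 GB; move: mfin.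
under eq_integral do rewrite Gop.
under [X in _ -> (X <= _)%E -> _]eq_integral do rewrite Madj.
move=> mfin ale.
have mu2 : measurable_fun [set: T * T] (fun z => u z.2) by exact: measurableT_comp.
have mG1 : measurable_fun [set: T * T] (fun z => G z.1) by exact: measurableT_comp.
have E1 : (\int[mu]_z (G z ^+ 2)%:E = \int[mu]_y (u y * M y)%:E)%E.
  transitivity (\int[mu]_x \int[mu]_y (u y * (G x * K x y))%:E)%E.
    apply: eq_integral => x _.
    under [RHS]eq_integral do rewrite mulrCA EFinM.
    rewrite ge0_integralZl//; first by rewrite -GE -EFinM expr2.
    - by apply/measurable_EFinP; exact: measurable_funM.
    - by move=> y _; rewrite lee_fin mulr_ge0.
    - by rewrite lee_fin.
  rewrite (fubini_tonelli (fun z : T * T => (u z.2 * (G z.1 * K z.1 z.2))%:E))/=; first last.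
  - by move=> z; rewrite lee_fin !mulr_ge0.
  - by apply/measurable_EFinP; apply: measurable_funM => //; exact: measurable_funM.
  apply: eq_integral => y _; under eq_integral do rewrite EFinM.
  rewrite ge0_integralZl//; first by rewrite -ME -EFinM.
  - by apply/measurable_EFinP; exact: measurable_funM.
  - by move=> x _; rewrite lee_fin mulr_ge0.
  - by rewrite lee_fin.
have C20 : 0 < 4 * C ^+ 2 by rewrite mulr_gt0// exprn_gt0.
have := integral_mul_le mu C20 mu_ mM u0 M0; rewrite -E1.
move: mfin ale; set m := (\int[mu]_z (G z ^+ 2)%:E)%E.
set U := (\int[mu]_z (u z ^+ 2)%:E)%E in u2 *; set a := (\int[mu]_z (M z ^+ 2)%:E)%E.
have m0 : (0 <= m)%E by apply: integral_ge0 => z _; rewrite lee_fin sqr_ge0.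
have U0 : (0 <= U)%E by apply: integral_ge0 => z _; rewrite lee_fin sqr_ge0.
have a0 : (0 <= a)%E by apply: integral_ge0 => z _; rewrite lee_fin sqr_ge0.
clearbody m U a.
move: U u2 U0 => [U| |] // _ _; move: m m0 => [m| |] // _ _; move: a a0 => [a| |] // _.
rewrite -!EFinM -EFinD !lee_fin => h1.
have : (2 * (4 * C ^+ 2))^-1 * a <= 2^-1 * m.
  rewrite ler_pdivrMl ?mulr_gt0// (le_trans h1)// le_eqVlt; apply/orP; left; apply/eqP.
  by field.
by lra.
Qed.

End linearized.

Section supremum.
Context (u : T -> R) (B : R).
Hypothesis mu_ : measurable_fun [set: T] u.
Hypothesis u0 : forall x, 0 <= u x.
Hypothesis uB : forall x, u x <= B.

Let A i x := \int[mu]_y (u y * k i x y).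

Let AE i x : ((A i x)%:E = \int[mu]_y (u y * k i x y)%:E)%E.
Proof.
have Bx : 0 <= B by exact: le_trans (u0 x) (uB x).
apply: (@EFin_Rintegral _ _ _ _ _ B) => [y|]; first by rewrite mulr_ge0.
rewrite -[B%:E]mule1 -(k1 i x) -ge0_integralZl//; first last.
- by move=> y _; rewrite lee_fin.
- exact/measurable_EFinP.
apply: ge0_le_integral => //.
- by move=> y _; rewrite lee_fin mulr_ge0.
- by apply/measurable_EFinP; exact: measurable_funM.
- by apply: measurable_funeM; exact/measurable_EFinP.
- by move=> y _; rewrite -EFinM lee_fin ler_wpM2r.
Qed.

Let A0 i x : 0 <= A i x.
Proof. by apply: Rintegral_ge0 => y _; rewrite mulr_ge0. Qed.

Let mA i : measurable_fun [set: T] (A i).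
Proof.
apply: (@measurable_fun_Rintegral _ _ _ _ _ mu (fun z : T * T => u z.2 * k i z.1 z.2)).
by apply: measurable_funM => //; exact: measurableT_comp.
Qed.

Let rmax N x := running_max (A^~ x) N.

Let mrmax N : measurable_fun [set: T] (rmax N).
Proof. by elim: N => [|N IH]; [exact: (mA 0)|exact: (measurable_maxr IH (mA N.+1))]. Qed.

Let rmax0 N x : 0 <= rmax N x.
Proof. by rewrite (le_trans (A0 0 x))// (le_running_max (A^~ x)). Qed.

(** A measurable choice of an index attaining the running maximum, by induction: on the set [S]
    where the new kernel wins, all the weight moves to the index [N + 1]; off [S] the earlier
    weights are kept. *)
Let select N : exists e : nat -> T -> R, [/\ forall i, measurable_fun [set: T] (e i),
  forall i x, 0 <= e i x, forall x, \sum_(i < N.+1) e i x = 1 &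
  forall x, \sum_(i < N.+1) e i x * A i x = rmax N x].
Proof.
elim: N => [|N [e [me e0 e1 eA]]].
  exists (fun _ _ => 1); split => //.
  - by move=> x; rewrite big_ord1.
  - by move=> x; rewrite big_ord1 mul1r.
pose S := [set x | rmax N x < A N.+1 x].
have mS : measurable S.
  have := measurable_fun_ltr (mrmax N) (mA N.+1).
  by move=> /(_ measurableT [set true] I); rewrite setTI (_ : _ @^-1` _ = S).
pose c : T -> R := \1_S.
have mc : measurable_fun [set: T] c by exact: measurable_indic.
have c0 x : 0 <= c x by [].
have c1 x : 0 <= 1 - c x by rewrite /c indicE; case: (_ \in _); rewrite ?subrr ?subr0.
exists (fun i x => if (i <= N)%N then e i x * (1 - c x) else c x); split.
- move=> i; case: (i <= N)%N => //; apply: measurable_funM => //.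
  exact: measurable_funB.
- by move=> i x; case: ifP => // _; rewrite mulr_ge0.
- move=> x; rewrite big_ord_recr /= ltnn.
  rewrite (eq_bigr (fun i : 'I_N.+1 => e i x * (1 - c x))); last by move=> i _; rewrite -ltnS ltn_ord.
  by rewrite -mulr_suml e1 mul1r subrK.
- move=> x; rewrite big_ord_recr /= ltnn.
  rewrite (eq_bigr (fun i : 'I_N.+1 => (1 - c x) * (e i x * A i x))); last first.
    by move=> i _; rewrite -ltnS ltn_ord; ring.
  rewrite -mulr_sumr eA /rmax /= /c indicE -/(rmax N x).
  have [xS|xS] := boolP (x \in S).
    by rewrite subrr mul0r add0r mul1r max_r// ltW//; move: xS; rewrite inE.
  rewrite subr0 mul1r mul0r addr0 max_l// leNgt.
  by apply/negP => h; move/negP: xS; apply; rewrite inE.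
Qed.

Let integral_rmax N : (\int[mu]_x (rmax N x ^+ 2)%:E <=
    (4 * C ^+ 2)%:E * \int[mu]_z (u z ^+ 2)%:E)%E.
Proof.
have [e [me e0 e1 eA]] := select N.
have /(_ u B mu_ u0 uB) := linearized_op_L2 me e0 e1.
rewrite (_ : integral _ _ _ = \int[mu]_x (rmax N x ^+ 2)%:E)%E//.
apply: eq_integral => x _; congr ((_ ^+ 2)%:E); rewrite -eA.
apply: EFin_inj.
rewrite (linearized_opE me e0 e1 mu_ u0 uB).
under eq_integral do rewrite big_distrr /= -sumEFin.
rewrite ge0_integral_sum//; first last.
- by move=> i y _; rewrite lee_fin !mulr_ge0.
- by move=> i; apply/measurable_EFinP; apply: measurable_funM => //; exact: measurable_funM.
rewrite -sumEFin; apply: eq_bigr => i _.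
rewrite EFinM AE -ge0_integralZl//; first last.
- by rewrite lee_fin.
- by move=> y _; rewrite lee_fin mulr_ge0.
- by apply/measurable_EFinP; exact: measurable_funM.
by apply: eq_integral => y _; rewrite -EFinM mulrCA.
Qed.

(** The running maxima increase with [N] and their bound is uniform in [N], so monotone convergence
    passes to the limit. [Y] is extended-valued because the limit may be infinite at some points. *)
Lemma maximal_L2 : exists Y : T -> \bar R, [/\ measurable_fun [set: T] Y,
  forall x, (0 <= Y x)%E,
  forall i x, (((\int[mu]_y (u y * k i x y)) ^+ 2)%:E <= Y x)%E &
  (\int[mu]_x Y x <= (4 * C ^+ 2)%:E * \int[mu]_x (u x ^+ 2)%:E)%E].
Proof.
pose g N x := (rmax N x ^+ 2)%:E.
have g0 N x : (0 <= g N x)%E by rewrite lee_fin sqr_ge0.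
have mg N : measurable_fun [set: T] (g N) by apply/measurable_EFinP; exact: measurable_funX.
have ndg x : nondecreasing_seq (g^~ x).
  move=> m n mn; rewrite lee_fin ler_sqr ?nnegrE ?rmax0//.
  exact: nondecreasing_running_max.
have cg x : cvgn (g^~ x) by exact: ereal_nondecreasing_is_cvgn.
have gl N x : (g N x <= limn (g^~ x))%E 
  by rewrite (cvg_lim _ (ereal_nondecreasing_cvgn (ndg x)))//; apply: ereal_sup_ubound; exists N.
exists (fun x => limn (g^~ x)); split.
- apply: (emeasurable_fun_cvg g) => // x _; exact: cg.
- by move=> x; rewrite (le_trans (g0 0 x)).
- move=> i x; rewrite (le_trans _ (gl i x))// lee_fin ler_sqr ?nnegrE//.
    exact: (le_running_max (A^~ x)).
  exact: (A0 i x).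
- rewrite monotone_convergence//.
  apply: lime_le; last by apply: nearW => N; exact: integral_rmax.
  apply: ereal_nondecreasing_is_cvgn => m n mn; apply: ge0_le_integral => // x _.
  exact: ndg.
Qed.

End supremum.
End maximal.

(** * Fourier transforms and Plancherel's inequality *)

Section cos_transform.
Context {R : realType} {n : nat}.
Implicit Types (r s th : R) (h : 'rV[R]_n -> R).
Local Notation V := 'rV[R]_n.
Local Notation mu := (leb_rV n).

(** The phases [0] and [pi / 2], up to sign, give the cosine and sine transforms; carrying a general
    [th] treats all components of a Fourier transform together. *)
Definition cos_transform th h (xi : V) : R :=
  \int[mu]_y (h y * cos (th + 2 * pi * dotp y xi)).

Lemma measurable_cos_transform th h : measurable_fun [set: V] h ->
  measurable_fun [set: V] (cos_transform th h).
Proof.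
move=> mh; apply: (@measurable_fun_Rintegral _ _ _ _ _ mu
  (fun z : V * V => h z.2 * cos (th + 2 * pi * dotp z.2 z.1))).
apply: measurable_funM; first exact: measurableT_comp.
by apply: measurable_cos_dotp.
Qed.

Lemma integrable_mul_cos th h (xi : V) :
  mu.-integrable [set: V] (EFin \o h) ->
  mu.-integrable [set: V] (fun y => (h y * cos (th + 2 * pi * dotp y xi))%:E).
Proof.
move=> ih; have mh : measurable_fun [set: V] h by apply/measurable_EFinP; exact: measurable_int ih.
apply: (le_integrable measurableT _ _ ih).
  apply/measurable_EFinP; apply: measurable_funM => //.
  by apply: measurable_cos_dotp.
by move=> y _; rewrite lee_fin normrM ler_piMr// ler_norml cos_geN1 cos_le1.
Qed.

Lemma norm_cos_transform_le th h (xi : V) : mu.-integrable [set: V] (EFin \o h) ->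
  `|cos_transform th h xi| <= \int[mu]_y `|h y|.
Proof.
move=> ih; rewrite (le_trans (le_normr_Rintegral measurableT (integrable_mul_cos th xi ih)))//.
apply: le_Rintegral => //.
- exact: (integrable_norm (integrable_mul_cos th xi ih)).
- exact: integrable_norm.
- by move=> y _; rewrite normrM ler_piMr// ler_norml cos_geN1 cos_le1.
Qed.

(* The product of the two cosines splits into cosines of the difference and of
   the sum of the frequencies, whence the kernel P(x - y) + P(x + y). *)
Lemma integral_laplace_cos_transform r th th' h (x : V) : 0 < r ->
  mu.-integrable [set: V] (EFin \o h) ->
  \int[mu]_xi (laplace_rV r xi * (cos_transform th h xi * cos (th' + 2 * pi * dotp x xi))) =
  \int[mu]_y (h y * ((cos (th - th') * poisson_rV r (y - x) +
                      cos (th + th') * poisson_rV r (y + x)) / 2)).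
Proof.
move=> r0 ih; have mh : measurable_fun [set: V] h by apply/measurable_EFinP; exact: measurable_int ih.
pose f (z : V * V) := laplace_rV r z.1 * cos (th' + 2 * pi * dotp x z.1) *
  (h z.2 * cos (th + 2 * pi * dotp z.2 z.1)).
transitivity (\int[mu]_xi \int[mu]_y f (xi, y)).
  apply: eq_Rintegral => xi _; rewrite /f /=.
  by rewrite RintegralZl//; [rewrite /cos_transform; ring|exact: integrable_mul_cos].
rewrite (dominated_Fubini (A := laplace_rV r) (B := fun y => `|h y|)); first last.
- move=> xi y; rewrite /f /= normrM ler_pM// normrM.
    by rewrite ger0_norm ?laplace_rV_ge0// ler_piMr ?laplace_rV_ge0// ler_norml cos_geN1 cos_le1.
  by rewrite ler_piMr// ler_norml cos_geN1 cos_le1.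
- exact: integrable_norm.
- exact: integrable_laplace_rV.
- apply: measurable_funM; apply: measurable_funM.
  + exact: measurable_laplace_rV.
  + by apply: measurable_cos_dotp.
  + exact: measurableT_comp.
  + by apply: measurable_cos_dotp.
apply: eq_Rintegral => y _.
have ic t (w : V) : mu.-integrable [set: V] (fun xi => (laplace_rV r xi * cos (t + 2 * pi * dotp xi w))%:E).
  by apply: integrable_mul_cos; exact: integrable_laplace_rV.
transitivity (\int[mu]_xi (h y / 2 * (laplace_rV r xi * cos ((th - th') + 2 * pi * dotp xi (y - x)) +
   laplace_rV r xi * cos ((th + th') + 2 * pi * dotp xi (y + x))))).
  apply: eq_Rintegral => xi _; rewrite /f /= !(dotpC xi) !dotpDl dotpNl.
  rewrite (_ : th - th' + 2 * pi * (dotp y xi - dotp x xi) =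
    (th + 2 * pi * dotp y xi) - (th' + 2 * pi * dotp x xi)); last by ring.
  rewrite (_ : th + th' + 2 * pi * (dotp y xi + dotp x xi) =
    (th + 2 * pi * dotp y xi) + (th' + 2 * pi * dotp x xi)); last by ring.
  move: (th + _) (th' + _) => a b.
  by rewrite !cosD cosN sinN; field.
rewrite RintegralZl//; last exact: (integrableD measurableT (ic _ _) (ic _ _)).
rewrite (RintegralD measurableT (ic _ _) (ic _ _)) !integral_laplace_rV_cos//.
by field.
Qed.

(** The phases enter only through two cosines, which are at most 1 in absolute value. A Laplace
    multiplier is thus dominated by a Poisson average of [|h|], whatever the phases. *)
Lemma integral_laplace_cos_transform_le r th th' h (x : V) : 0 < r ->
  mu.-integrable [set: V] (EFin \o h) ->
  (`|\int[mu]_xi (laplace_rV r xi * (cos_transform th h xi * cos (th' + 2 * pi * dotp x xi)))|%:E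
  <= \int[mu]_y (`|h y| * poisson_kernel r x y)%:E)%E.
Proof.
move=> r0 ih; have mh : measurable_fun [set: V] h by apply/measurable_EFinP; exact: measurable_int ih.
rewrite integral_laplace_cos_transform//.
set g := fun y : V => h y * _.
have mg : measurable_fun [set: V] g.
  apply: measurable_funM => //; apply: measurable_funM => //; apply: measurable_funD;
    apply: measurable_funM => //; apply: measurable_poisson_rV => //; apply: measurable_rVD;
    by [exact: measurable_id|exact: measurable_cst].
rewrite (le_trans (le_EFin_Rintegral mu mg))//.
apply: ge0_le_integral => //.
- by apply/measurable_EFinP; exact: measurableT_comp.
- apply/measurable_EFinP; apply: measurable_funM; first exact: measurableT_comp.
  exact: measurable_poisson_kernel.
move=> y _; rewrite lee_fin normrM ler_wpM2l// normrM [X in _ * X]ger0_norm//.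
rewrite poisson_kernelC ler_wpM2r// (le_trans (ler_normD _ _))// lerD// normrM.
  by rewrite [X in _ * X]ger0_norm ?poisson_rV_ge0// ler_piMl ?poisson_rV_ge0// ler_norml cos_geN1 cos_le1.
by rewrite [X in _ * X]ger0_norm ?poisson_rV_ge0// ler_piMl ?poisson_rV_ge0// ler_norml cos_geN1 cos_le1.
Qed.

(** Expanding one factor [cos_transform] and exchanging the integrals turns the left side into the
    pairing of [h] with [Q], and [|Q|] is at most the Poisson average of [|h|]. The quadratic form
    of a symmetric Markov kernel is at most the squared norm, hence the constant 1. The weight makes
    the exchange legitimate. *)
Lemma plancherel_laplace r th h : 0 < r ->
  mu.-integrable [set: V] (EFin \o h) ->
  (\int[mu]_xi (laplace_rV r xi * cos_transform th h xi ^+ 2)%:E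
   <= \int[mu]_x (h x ^+ 2)%:E)%E.
Proof.
move=> r0 ih; have mh : measurable_fun [set: V] h by apply/measurable_EFinP; exact: measurable_int ih.
pose Q x := \int[mu]_xi (laplace_rV r xi * (cos_transform th h xi * cos (th + 2 * pi * dotp x xi))).
pose M := \int[mu]_y `|h y|.
have M0 : 0 <= M by apply: Rintegral_ge0 => y _.
pose f (z : V * V) := laplace_rV r z.1 * cos_transform th h z.1 *
  (h z.2 * cos (th + 2 * pi * dotp z.2 z.1)).
have mf : measurable_fun [set: V * V] f.
  apply: measurable_funM; apply: measurable_funM.
  - exact: measurable_laplace_rV.
  - by apply: (measurableT_comp (measurable_cos_transform th mh)).
  - exact: measurableT_comp.
  - by apply: measurable_cos_dotp.
have iA : mu.-integrable [set: V] (EFin \o (fun xi => laplace_rV r xi * M)).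
  exact: (integrableZr measurableT M (integrable_laplace_rV n r0)).
have iB : mu.-integrable [set: V] (EFin \o (fun y => `|h y|)) by exact: integrable_norm.
have fAB xi y : `|f (xi, y)| <= laplace_rV r xi * M * `|h y|.
  rewrite /f /= normrM ler_pM// normrM.
    by rewrite ger0_norm ?laplace_rV_ge0// ler_wpM2l ?laplace_rV_ge0// norm_cos_transform_le.
  by rewrite ler_piMr// ler_norml cos_geN1 cos_le1.
have iL : mu.-integrable [set: V] (fun xi => (laplace_rV r xi * cos_transform th h xi ^+ 2)%:E).
  have := dominated_integrable_Rintegral2 mf iA iB fAB.
  apply: eq_integrable => // xi _ /=; congr (_%:E).
  rewrite /f /= RintegralZl//; last exact: integrable_mul_cos.
  by rewrite expr2 mulrA.
have E1 : \int[mu]_xi (laplace_rV r xi * cos_transform th h xi ^+ 2) = \int[mu]_x (h x * Q x).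
  transitivity (\int[mu]_xi \int[mu]_y f (xi, y)).
    apply: eq_Rintegral => xi _; rewrite /f /= RintegralZl//; last exact: integrable_mul_cos.
    by rewrite expr2 mulrA.
  rewrite (dominated_Fubini mf iA iB fAB); apply: eq_Rintegral => y _.
  rewrite /Q -RintegralZl//.
    by apply: eq_Rintegral => xi _; rewrite /f /=; ring.
  apply: (le_integrable measurableT _ _ iA).
    apply/measurable_EFinP; apply: measurable_funM; first exact: measurable_laplace_rV.
    apply: measurable_funM; first exact: measurable_cos_transform.
    by apply: measurable_cos_dotp.
  move=> xi _; rewrite lee_fin !normrM ger0_norm ?laplace_rV_ge0// ler_wpM2l ?laplace_rV_ge0//.
  rewrite (ger0_norm M0) -[leRHS]mulr1 ler_pM//; first exact: norm_cos_transform_le.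
  by rewrite ler_norml cos_geN1 cos_le1.
have mk : measurable_fun [set: V * V] (fun z : V * V => poisson_kernel r z.1 z.2).
  by apply: measurable_poisson_kernel.
have mnh : measurable_fun [set: V] (fun y => `|h y|) by exact: measurableT_comp.
have mQ : measurable_fun [set: V] Q.
  apply: (@measurable_fun_Rintegral _ _ _ _ _ mu (fun z : V * V =>
    laplace_rV r z.2 * (cos_transform th h z.2 * cos (th + 2 * pi * dotp z.1 z.2)))).
  apply: measurable_funM; first exact: measurable_laplace_rV.
  apply: measurable_funM; first by apply: (measurableT_comp (measurable_cos_transform th mh)).
  by apply: measurable_cos_dotp.
have -> : (\int[mu]_xi (laplace_rV r xi * cos_transform th h xi ^+ 2)%:E =
    (\int[mu]_x (h x * Q x))%:E)%E.
  by rewrite -E1 /Rintegral fineK//; exact: integrable_fin_num.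
apply: (@le_trans _ _ (`|\int[mu]_x (h x * Q x)|%:E)%E); first by rewrite lee_fin ler_norm.
rewrite (le_trans (le_EFin_Rintegral mu _))//; first exact: measurable_funM.
have k1 (x : V) := integral_poisson_kernel x r0.
have kC := @poisson_kernelC R n r.
have k0 (x y : V) := poisson_kernel_ge0 x y r0.
have := markov_quadratic_form_le mk k0 kC k1 mnh (fun y => normr_ge0 _).
under [X in (_ <= X)%E -> _]eq_integral do rewrite real_normK ?num_real//.
apply: le_trans; apply: ge0_le_integral => //.
- by apply/measurable_EFinP; apply: measurableT_comp => //; exact: measurable_funM.
- apply: (@emeasurable_fun_integral _ _ _ _ _ mu (fun z : V * V =>
    (`|h z.1| * (`|h z.2| * poisson_kernel r z.1 z.2))%:E)).
  apply/measurable_EFinP; apply: measurable_funM; first exact: (measurableT_comp mnh).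
  by apply: measurable_funM => //; exact: (measurableT_comp mnh).
- move=> x _; rewrite normrM EFinM.
  under eq_integral do rewrite EFinM.
  rewrite ge0_integralZl//; first last.
  + by move=> y _; rewrite lee_fin mulr_ge0.
  + apply/measurable_EFinP; apply: measurable_funM => //.
    exact: measurable_poisson_kernel.
  by rewrite lee_wpmul2l ?lee_fin// integral_laplace_cos_transform_le.
Qed.

Lemma laplace_rV_cvg1 (xi : V) : laplace_rV k.+1%:R^-1 xi @[k --> \oo] --> (1 : R).
Proof.
under eq_cvg do rewrite laplace_rVE.
suff : expR (- (k.+1%:R^-1 * \sum_(i < n) `|xi ord0 i|)) @[k --> \oo] -->
    expR (- (0 * \sum_(i < n) `|xi ord0 i|)) by rewrite mul0r oppr0 expR0.
apply: (@cvg_comp _ _ _ _ (@expR R) _ _ _ _ (@continuous_expR R _)).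
apply: cvgN; apply: cvgM; last exact: cvg_cst.
exact: cvg_harmonic.
Qed.

Lemma laplace_rV_nd (xi : V) : nondecreasing_seq (fun k => laplace_rV k.+1%:R^-1 xi).
Proof.
move=> k l kl; rewrite !laplace_rVE ler_expR lerN2 ler_wpM2r ?sumr_ge0//.
by rewrite lef_pV2 ?posrE// ler_nat.
Qed.

(** The weights of parameter [1 / (k + 1)] increase to 1, so monotone convergence removes them. *)
Lemma plancherel_cos_transform th h : mu.-integrable [set: V] (EFin \o h) ->
  (\int[mu]_xi (cos_transform th h xi ^+ 2)%:E <= \int[mu]_x (h x ^+ 2)%:E)%E.
Proof.
move=> ih; have mh : measurable_fun [set: V] h by apply/measurable_EFinP; exact: measurable_int ih.
pose g k xi := (laplace_rV k.+1%:R^-1 xi * cos_transform th h xi ^+ 2)%:E.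
have gE xi : limn (g^~ xi) = (cos_transform th h xi ^+ 2)%:E.
  apply/cvg_lim => //; apply/cvg_EFin; first exact: nearW.
  rewrite -[X in _ --> X]mul1r; apply: cvgM; last exact: cvg_cst.
  exact: laplace_rV_cvg1.
under eq_integral do rewrite -gE.
have g0 k xi : (0 <= g k xi)%E by rewrite lee_fin mulr_ge0 ?sqr_ge0// laplace_rV_ge0.
have ndg xi : nondecreasing_seq (g^~ xi).
  by move=> k l kl; rewrite lee_fin ler_wpM2r ?sqr_ge0// laplace_rV_nd.
have mg k : measurable_fun [set: V] (g k).
  apply/measurable_EFinP; apply: measurable_funM; first exact: measurable_laplace_rV.
  by apply: measurable_funX; exact: measurable_cos_transform.
rewrite monotone_convergence//.
apply: lime_le; last by apply: nearW => k; exact: plancherel_laplace.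
apply: ereal_nondecreasing_is_cvgn => k l kl; apply: ge0_le_integral => // xi _.
exact: ndg.
Qed.

End cos_transform.

(** * The maximal function of Poisson averages *)

Section poisson_maximal.
Context {R : realType} {n : nat}.
Local Notation V := 'rV[R]_n.
Local Notation mu := (leb_rV n).

(* An enumeration of the positive rationals. By the doubling property of the Poisson kernel, these
   countably many radii control all the others. *)
Definition pos_rat (i : nat) : R :=
  if unpickle i is Some q then if 0 < (ratr q : R) then ratr q else 1 else 1.

Lemma pos_rat_gt0 i : 0 < pos_rat i.
Proof. by rewrite /pos_rat; case: unpickle => // q; case: ifPn. Qed.

Lemma pos_rat_dense (r : R) : 0 < r -> exists i, r <= pos_rat i /\ pos_rat i <= 2 * r.
Proof.
move=> r0; have : r < 2 * r by lra.
move=> /rat_in_itvoo[q]; rewrite in_itv /= => /andP[rq qr].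
exists (pickle q); rewrite /pos_rat pickleK (lt_trans r0 rq).
by rewrite !ltW.
Qed.

Lemma poisson_kernel_doubling (r s : R) (x y : V) : 0 < r -> r <= s -> s <= 2 * r ->
  poisson_kernel r x y <= 2 ^+ n * poisson_kernel s x y.
Proof.
move=> r0 rs s2r; rewrite mulrA ler_pM2r ?invr_gt0// mulrDr lerD//.
  exact: poisson_rV_doubling.
exact: poisson_rV_doubling.
Qed.

Lemma integrable_mul_poisson_kernel (u : V -> R) (B r : R) (x : V) : 0 < r ->
  measurable_fun [set: V] u -> (forall x, 0 <= u x) -> (forall x, u x <= B) ->
  mu.-integrable [set: V] (fun y => (u y * poisson_kernel r x y)%:E).
Proof.
move=> r0 mu_ u0 uB.
have mk : measurable_fun [set: V] (fun y => poisson_kernel r x y) by exact: measurable_poisson_kernel.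
have ik : mu.-integrable [set: V] (fun y => (poisson_kernel r x y)%:E).
  apply/integrableP; split; first exact/measurable_EFinP.
  under eq_integral do rewrite /= ger0_norm ?poisson_kernel_ge0//.
  by rewrite integral_poisson_kernel// ltry.
apply: (le_integrable measurableT _ _ (integrableZl measurableT B ik)).
  by apply/measurable_EFinP; exact: measurable_funM.
move=> y _; rewrite lee_fin !normrM ler_wpM2r//.
by rewrite !ger0_norm// (le_trans (u0 y)).
Qed.

(** Passing to rational radii by doubling costs [2^n], that is [4^n] after squaring. The abstract
    maximal inequality with [C = 4^n] costs [4 C^2 = 4 * 16^n], for a total of [4 * 64^n]. *)
Lemma poisson_maximal (u : V -> R) (B : R) : measurable_fun [set: V] u ->
  (forall x, 0 <= u x) -> (forall x, u x <= B) ->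
  exists Y : V -> \bar R, [/\ measurable_fun [set: V] Y, forall x, (0 <= Y x)%E,
    forall r x, 0 < r -> (((\int[mu]_y (u y * poisson_kernel r x y)) ^+ 2)%:E <= Y x)%E &
    (\int[mu]_x Y x <= (4 * 64 ^+ n)%:E * \int[mu]_x (u x ^+ 2)%:E)%E].
Proof.
move=> mu_ u0 uB.
pose k i (x y : V) := poisson_kernel (pos_rat i) x y.
have k0 i x y : 0 <= k i x y by exact: poisson_kernel_ge0 (pos_rat_gt0 i).
have kC i x y : k i x y = k i y x by exact: poisson_kernelC.
have k1 i x : (\int[mu]_y (k i x y)%:E = 1)%E by exact: integral_poisson_kernel (pos_rat_gt0 i).
have mk i : measurable_fun [set: V * V] (fun z => k i z.1 z.2).
  by apply: measurable_poisson_kernel => //; exact: pos_rat_gt0.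
have C0 : 0 < (4 ^+ n : R) by rewrite exprn_gt0.
have kk i j x y : (\int[mu]_z (k i x z * k j z y)%:E <= (4 ^+ n * (k i x y + k j x y))%:E)%E.
  (* The composition bound wants the smaller radius on the right; in the other case symmetry of the
     kernels exchanges the two factors. *)
  have [ij|/ltW ij] := leP (pos_rat j) (pos_rat i).
    rewrite (le_trans (integral_poisson_kernel_mul_le _ _ (pos_rat_gt0 j) ij))//.
    by rewrite lee_fin ler_pM2l// lerDl.
  under eq_integral do rewrite mulrC kC (kC i).
  rewrite (le_trans (integral_poisson_kernel_mul_le _ _ (pos_rat_gt0 i) ij))//.
  by rewrite lee_fin ler_pM2l// poisson_kernelC lerDr.
have [Y [mY Y0 kY intY]] := maximal_L2 mk k0 kC k1 C0 kk mu_ u0 uB.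
exists (fun x => (4 ^+ n)%:E * Y x)%E; split.
- exact: measurable_funeM.
- by move=> x; rewrite mule_ge0// lee_fin ltW.
- move=> r x r0; have [i [ri ir]] := pos_rat_dense r0.
  apply: (@le_trans _ _ (4 ^+ n * (\int[mu]_y (u y * k i x y)) ^+ 2)%:E); last first.
    by rewrite EFinM lee_wpmul2l// lee_fin ltW.
  have c0 : 0 <= (2 ^+ n : R) by rewrite exprn_ge0.
  have le1 : \int[mu]_y (u y * poisson_kernel r x y) <= 2 ^+ n * \int[mu]_y (u y * k i x y).
    rewrite -RintegralZl//; last exact: integrable_mul_poisson_kernel (pos_rat_gt0 i) mu_ u0 uB.
    apply: le_Rintegral => //.
    - exact: integrable_mul_poisson_kernel r0 mu_ u0 uB.
    - exact: (integrableZl measurableT _ (integrable_mul_poisson_kernel x (pos_rat_gt0 i) mu_ u0 uB)).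
    - by move=> y _; rewrite [leRHS]mulrCA ler_wpM2l// poisson_kernel_doubling.
  rewrite lee_fin (_ : 4 ^+ n = (2 ^+ n) ^+ 2 :> R); last first.
    by rewrite -exprM mulnC exprM; congr (_ ^+ _); ring.
  rewrite -exprMn ler_sqr ?nnegrE//; last rewrite mulr_ge0//.
    by apply: Rintegral_ge0 => y _; rewrite mulr_ge0// poisson_kernel_ge0.
  by apply: Rintegral_ge0 => y _; rewrite mulr_ge0.
- rewrite ge0_integralZl//.
  apply: (le_trans (lee_wpmul2l _ intY)); first by rewrite lee_fin ltW.
  rewrite muleA -EFinM (_ : 4 ^+ n * (4 * (4 ^+ n) ^+ 2) = 4 * 64 ^+ n)//.
  rewrite (_ : 64 = 4 * (4 * 4) :> R); last by ring.
  by rewrite !exprMn; move: (4 ^+ n : R) => z; ring.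
Qed.

End poisson_maximal.

(** * Averages of radial multiplier operators *)

Section positive_powers.
Context {R : realType}.

(* [pos_inv u] and [pos_rsqrt u] are 1/u and 1/sqrt u for u > 0, and 0 for u <= 0. *)
Definition pos_inv (u : R) : R := Num.max u 0 `^ (-1).
Definition pos_rsqrt (u : R) : R := Num.max u 0 `^ (- 2^-1).

Lemma pos_invE u : 0 < u -> pos_inv u = u^-1.
Proof. by move=> u0; rewrite /pos_inv max_l ?ltW// powR_inv1// ltW. Qed.

Lemma pos_inv_le0 u : u <= 0 -> pos_inv u = 0.
Proof. by move=> u0; rewrite /pos_inv max_r// powR0// oppr_eq0 oner_eq0. Qed.

Lemma pos_inv_ge0 u : 0 <= pos_inv u.
Proof. exact: powR_ge0. Qed.

Lemma pos_rsqrt_gt0 u : 0 < u -> 0 < pos_rsqrt u.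
Proof. by move=> u0; rewrite /pos_rsqrt max_l ?ltW// powR_gt0. Qed.

Lemma sqr_pos_rsqrt u : 0 < u -> pos_rsqrt u ^+ 2 = u^-1.
Proof.
move=> u0; rewrite /pos_rsqrt max_l ?ltW// -powR_mulrn ?powR_ge0// -powRrM.
by rewrite mulNr mulVf// powR_inv1// ltW.
Qed.

Lemma measurable_maxr0 p : measurable_fun [set: R] (fun u : R => Num.max u 0 `^ p).
Proof.
apply: (measurableT_comp (@measurable_powR R p)).
by apply: (measurable_maxr (f := fun u : R => u) (g := cst 0)) => //; exact: measurable_id.
Qed.

Lemma measurable_pos_inv : measurable_fun [set: R] pos_inv.
Proof. exact: measurable_maxr0. Qed.

Lemma measurable_pos_rsqrt : measurable_fun [set: R] pos_rsqrt.
Proof. exact: measurable_maxr0. Qed.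

End positive_powers.

(** * Comparison of a radial multiplier with the Laplace weight *)

Section square_function.
Context {R : realType} {n : nat}.
Local Notation V := 'rV[R]_n.
Local Notation mu := (leb_rV n).
Local Notation leb := (@lebesgue_measure R).
Implicit Types (x xi : V) (u : R).

Lemma dotp_ge0 xi : 0 <= dotp xi xi.
Proof. by apply: sumr_ge0 => i _; rewrite -expr2 sqr_ge0. Qed.

Lemma coord_le_dotp xi i : xi ord0 i ^+ 2 <= dotp xi xi.
Proof.
rewrite /dotp (bigD1 i)//= expr2 lerDl; apply: sumr_ge0 => j _.
by rewrite -expr2 sqr_ge0.
Qed.

Lemma dotp_le_sum_norm xi : dotp xi xi <= (\sum_(i < n) `|xi ord0 i|) ^+ 2.
Proof.
rewrite expr2 mulr_suml; apply: ler_sum => i _.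
rewrite -expr2 -real_normK ?num_real// expr2 ler_wpM2l//.
by rewrite (bigD1 i)//= lerDl sumr_ge0.
Qed.

Lemma sum_norm_le_dotp xi : (\sum_(i < n) `|xi ord0 i|) ^+ 2 <= n%:R ^+ 2 * dotp xi xi.
Proof.
rewrite -(sqr_sqrtr (dotp_ge0 xi)) -exprMn ler_sqr ?nnegrE ?sumr_ge0 ?mulr_ge0 ?sqrtr_ge0//.
rewrite -[X in _ <= X%:R * _]card_ord -sumr_const mulr_suml; apply: ler_sum => i _.
rewrite mul1r -sqrtr_sqr ler_sqrt ?dotp_ge0//.
exact: coord_le_dotp.
Qed.

Context (om : R -> R) (N : R).
Hypothesis mom : measurable_fun [set: R] om.
Hypothesis om_le1 : forall s, 0 <= s -> `|om s| <= 1.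
Hypothesis om_supp : forall s, 1 <= s -> om s = 0.
Hypothesis om_near0 : forall s, 0 <= s -> s <= 1 -> `|1 - om s| <= N * s.

Definition profile_mult u xi : R := om (dotp xi xi * pos_inv u).

Definition profile_diff u xi : R := profile_mult u xi - laplace_rV (pos_rsqrt u) xi.

Lemma measurable_profile_mult d (T : measurableType d) (f : T -> R) (g : T -> V) :
  measurable_fun [set: T] f -> measurable_fun [set: T] g ->
  measurable_fun [set: T] (fun t => profile_mult (f t) (g t)).
Proof.
move=> mf mg; apply: (measurableT_comp mom); apply: measurable_funM.
  exact: measurable_dotp.
exact: (measurableT_comp measurable_pos_inv).
Qed.

Lemma measurable_laplace_rV_radius d (T : measurableType d) (f : T -> R) (g : T -> V) :
  measurable_fun [set: T] f -> measurable_fun [set: T] g ->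
  measurable_fun [set: T] (fun t => laplace_rV (pos_rsqrt (f t)) (g t)).
Proof.
move=> mf mg; under eq_fun do rewrite laplace_rVE.
apply: (measurableT_comp (@measurable_expR R)); apply: measurable_funN.
apply: measurable_funM; first exact: (measurableT_comp measurable_pos_rsqrt).
by apply: measurable_sum => i; apply: measurableT_comp => //; exact: measurable_coord_comp.
Qed.

Lemma measurable_profile_diff d (T : measurableType d) (f : T -> R) (g : T -> V) :
  measurable_fun [set: T] f -> measurable_fun [set: T] g ->
  measurable_fun [set: T] (fun t => profile_diff (f t) (g t)).
Proof.
move=> mf mg; apply: measurable_funB; first exact: measurable_profile_mult.
exact: measurable_laplace_rV_radius.
Qed.

(** Where the multiplier is nonzero, [|xi|^2 < u]; there the l^1 norm is at most [n sqrt u], so the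
    Laplace weight is at least [expR (- n)]. *)
Lemma norm_profile_mult_le u xi : 0 < u ->
  `|profile_mult u xi| <= expR n%:R * laplace_rV (pos_rsqrt u) xi.
Proof.
move=> u0; rewrite /profile_mult pos_invE//.
have [s1|s1] := leP 1 (dotp xi xi / u).
  by rewrite om_supp// normr0 mulr_ge0 ?expR_ge0// laplace_rV_ge0.
rewrite (le_trans (om_le1 _))//; first by rewrite divr_ge0 ?dotp_ge0// ltW.
rewrite laplace_rVE -expRD -[leLHS](@expR0 R) ler_expR subr_ge0.
have S0 : 0 <= \sum_(i < n) `|xi ord0 i| by exact: sumr_ge0.
have r0 := pos_rsqrt_gt0 u0.
rewrite -(@ler_pXn2r _ 2)// ?nnegrE ?mulr_ge0// ?(ltW r0)//.
rewrite exprMn sqr_pos_rsqrt// mulrC ler_pdivrMr//.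
rewrite (le_trans (sum_norm_le_dotp xi))// ler_wpM2l ?sqr_ge0//.
by move: s1; rewrite ltr_pdivrMr// mul1r => /ltW.
Qed.

(** The right side is comparable to the smaller of [q / u] and [u / q]. If [u <= q] the profile
    vanishes and [expR (- y) <= 1 / y] with [y^2 >= q / u]. If [q < u] both multipliers are close to
    1: the profile by [om_near0], the weight by [1 - expR (- y) <= y] with [y^2 <= n^2 q / u].
    Nothing is asked of [om] near 1 beyond boundedness, which leaves room for the jump of the ball
    profile. *)
Lemma profile_diff_sq_le u xi : 0 < u ->
  profile_diff u xi ^+ 2 <=
  (4 * (N ^+ 2 + n%:R ^+ 2) + 2) * (u * dotp xi xi / (u ^+ 2 + dotp xi xi ^+ 2)).
Proof.
move=> u0; set q := dotp xi xi; have q0 : 0 <= q := dotp_ge0 xi.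
have D0 : 0 < u ^+ 2 + q ^+ 2 by rewrite ltr_wpDr ?sqr_ge0// exprn_gt0.
pose S := \sum_(i < n) `|xi ord0 i|; have S0 : 0 <= S by exact: sumr_ge0.
have Sq := dotp_le_sum_norm xi; have qS := sum_norm_le_dotp xi.
rewrite -/q -/S in Sq qS.
pose y := pos_rsqrt u * S; have r0 := pos_rsqrt_gt0 u0.
have y0 : 0 <= y by rewrite mulr_ge0// ltW.
have y2 : y ^+ 2 = S ^+ 2 / u by rewrite exprMn sqr_pos_rsqrt// mulrC.
rewrite /profile_diff laplace_rVE -/S -/y /profile_mult pos_invE//.
have base0 : 0 <= u * q / (u ^+ 2 + q ^+ 2) by rewrite divr_ge0 ?mulr_ge0// ltW.
have N20 := sqr_ge0 N; have n20 := sqr_ge0 (n%:R : R).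
have [uq|qu] := leP u q.
  rewrite om_supp ?ler_pdivlMr ?mul1r// sub0r sqrrN.
  apply: (@le_trans _ _ (2 * (u * q / (u ^+ 2 + q ^+ 2)))); last by rewrite ler_wpM2r//; lra.
  have q1 : 0 < q by exact: lt_le_trans uq.
  have S1 : 0 < S.
    by rewrite lt_neqAle S0 andbT eq_sym; apply: contraTneq Sq => ->; rewrite expr0n/= -ltNge.
  have y1 : 0 < y by rewrite mulr_gt0.
  have ey : expR (- y) <= y^-1.
    by rewrite expRN lef_pV2 ?posrE ?expR_gt0// (le_trans _ (expR_ge1Dx y))// lerDr.
  apply: (@le_trans _ _ (u / q)).
    rewrite (le_trans (_ : _ <= y^-1 ^+ 2))//.
      by rewrite ler_sqr ?nnegrE ?expR_ge0// invr_ge0.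
    rewrite exprVn y2 invf_div ler_wpM2l ?(ltW u0)// lef_pV2 ?posrE// exprn_gt0//.
  rewrite mulrA ler_pdivrMr// mulrAC ler_pdivlMr//.
  have : u * (u ^+ 2) <= u * q ^+ 2 by rewrite ler_pM2l// ler_sqr ?nnegrE// ltW.
  by nra.
have s1 : q / u <= 1 by rewrite ler_pdivrMr// mul1r ltW.
have s0 : 0 <= q / u by rewrite divr_ge0// ltW.
have a1 := om_near0 s0 s1; set w := om (q / u) in a1 *.
have e1 : 1 - expR (- y) <= y by have := expR_ge1Dx (- y); lra.
have e0 : 0 <= 1 - expR (- y) by rewrite subr_ge0 -(@expR0 R) ler_expR oppr_le0.
have d1 : (w - expR (- y)) ^+ 2 <= 2 * (N * (q / u)) ^+ 2 + 2 * y ^+ 2.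
  have : (1 - w) ^+ 2 <= (N * (q / u)) ^+ 2.
    by rewrite -real_normK ?num_real// ler_sqr ?nnegrE// (le_trans _ a1).
  have : (1 - expR (- y)) ^+ 2 <= y ^+ 2 by rewrite ler_sqr ?nnegrE.
  have := sqr_ge0 ((1 - w) + (1 - expR (- y))).
  by nra.
rewrite (le_trans d1)// y2.
have d2 : (q / u) ^+ 2 <= q / u by rewrite expr2 ler_piMl.
have d3 : S ^+ 2 / u <= n%:R ^+ 2 * (q / u) by rewrite mulrA ler_wpM2r// invr_ge0 ltW.
apply: (@le_trans _ _ (2 * (N ^+ 2 + n%:R ^+ 2) * (q / u))).
  rewrite exprMn.
  have : N ^+ 2 * (q / u) ^+ 2 <= N ^+ 2 * (q / u) by rewrite ler_wpM2l.
  by lra.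
have d4 : q / u <= 2 * (u * q / (u ^+ 2 + q ^+ 2)).
  rewrite mulrA ler_pdivlMr// mulrAC ler_pdivrMr//.
  have : q * q ^+ 2 <= q * u ^+ 2 by rewrite ler_wpM2l// ler_sqr ?nnegrE// ltW.
  by nra.
have c0 : 0 <= 2 * (N ^+ 2 + n%:R ^+ 2) by rewrite mulr_ge0// addr_ge0.
have := ler_wpM2l c0 d4.
by nra.
Qed.

(** For [q > 0] the integrand is [pi] times the Poisson kernel of parameter [2 pi q], of mass 1; for
    [q = 0] it vanishes. *)
Lemma integral_cauchy_le (q : R) : 0 <= q ->
  (\int[leb]_u (q / (u ^+ 2 + q ^+ 2))%:E <= pi%:E)%E.
Proof.
rewrite le_eqVlt => /predU1P[<-|q0].
  under eq_integral do rewrite mul0r.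
  by rewrite integral0 lee_fin pi_ge0.
have r0 : 0 < 2 * pi * q by rewrite !mulr_gt0// pi_gt0.
have -> : (\int[leb]_u (q / (u ^+ 2 + q ^+ 2))%:E =
    \int[leb]_u (pi%:E * (poisson (2 * pi * q) (u - 0))%:E))%E.
  apply: eq_integral => u _; rewrite -EFinM /poisson subr0; congr (_%:E).
  move: (@pi R) (@pi_gt0 R) => p p0.
  have D1 : 0 < u ^+ 2 + q ^+ 2 by rewrite ltr_wpDl ?sqr_ge0// exprn_gt0.
  have D2 : 0 < (2 * p * q) ^+ 2 + (2 * p * u) ^+ 2.
    by rewrite ltr_wpDr ?sqr_ge0// exprn_gt0// !mulr_gt0.
  by field; rewrite !gt_eqF.
rewrite ge0_integralZl//.
- by rewrite integral_poisson// mule1.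
- apply/measurable_EFinP; apply: (measurableT_comp (measurable_poisson r0)).
  exact: measurable_funB.
- by move=> u _; rewrite lee_fin ltW// poisson_gt0.
- by rewrite lee_fin pi_ge0.
Qed.

Let C1 : R := 4 * (N ^+ 2 + n%:R ^+ 2) + 2.

Let C10 : 0 <= C1.
Proof. by rewrite addr_ge0// mulr_ge0// addr_ge0// sqr_ge0. Qed.

Lemma integral_profile_diff_le xi :
  (\int[leb]_u (pos_inv u * profile_diff u xi ^+ 2)%:E <= (C1 * pi)%:E)%E.
Proof.
have mq : measurable_fun [set: R] (fun u : R => dotp xi xi / (u ^+ 2 + dotp xi xi ^+ 2)).
  have [->|q0] := eqVneq (dotp xi xi) 0.
    by rewrite (_ : (fun _ => _) = cst 0)//; apply/funext => u; rewrite mul0r.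
  apply: continuous_measurable_fun => u; apply: cvgM; first exact: cvg_cst.
  apply: cvgV.
    by rewrite gt_eqF// ltr_wpDl ?sqr_ge0// exprn_even_gt0.
  by apply: cvgD; [exact: exprn_continuous|exact: cvg_cst].
apply: (@le_trans _ _ (\int[leb]_u (C1%:E * (dotp xi xi / (u ^+ 2 + dotp xi xi ^+ 2))%:E))%E).
  apply: ge0_le_integral => //.
  - by move=> u _; rewrite lee_fin mulr_ge0 ?sqr_ge0// pos_inv_ge0.
  - apply/measurable_EFinP; apply: measurable_funM; first exact: measurable_pos_inv.
    apply: measurable_funX; apply: measurable_profile_diff; first exact: measurable_id.
    exact: measurable_cst.
  - by apply: measurable_funeM; exact/measurable_EFinP.
  move=> u _; rewrite -EFinM lee_fin.
  have [u0|u0] := leP u 0.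
    by rewrite pos_inv_le0// mul0r mulr_ge0// divr_ge0 ?dotp_ge0// addr_ge0// sqr_ge0.
  rewrite pos_invE// mulrC ler_pdivrMr//.
  rewrite (le_trans (profile_diff_sq_le xi u0))// -/C1 le_eqVlt; apply/orP; left; apply/eqP.
  by move: (_ ^-1) => D; ring.
rewrite ge0_integralZl//; first last.
- by move=> u _; rewrite lee_fin divr_ge0 ?dotp_ge0// addr_ge0// sqr_ge0.
- exact/measurable_EFinP.
by rewrite EFinM lee_wpmul2l ?lee_fin// integral_cauchy_le// dotp_ge0.
Qed.

Section transform.
Context (th th' : R) (h : V -> R).
Hypothesis ih : mu.-integrable [set: V] (EFin \o h).

Let mh : measurable_fun [set: V] h.
Proof. by apply/measurable_EFinP; exact: measurable_int ih. Qed.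

Let E := cos_transform th h.

Let mE : measurable_fun [set: V] E.
Proof. exact: measurable_cos_transform. Qed.

(** The phases [th] of the transform and [th'] of the evaluation cover all products of sines and
    cosines in a modulated Fourier transform. In the splitting below, [diff_op] is handled by the
    square function and [low_op] by the Poisson maximal function. *)
Definition profile_op u x : R :=
  \int[mu]_xi (profile_mult u xi * (E xi * cos (th' + 2 * pi * dotp x xi))).

Definition diff_op u x : R :=
  \int[mu]_xi (profile_diff u xi * (E xi * cos (th' + 2 * pi * dotp x xi))).

Definition low_op u x : R :=
  \int[mu]_xi (laplace_rV (pos_rsqrt u) xi * (E xi * cos (th' + 2 * pi * dotp x xi))).

Let integrable_mult (m : V -> R) (c r : R) x : 0 < r -> measurable_fun [set: V] m ->
  (forall xi, `|m xi| <= c * laplace_rV r xi) ->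
  mu.-integrable [set: V] (fun xi => (m xi * (E xi * cos (th' + 2 * pi * dotp x xi)))%:E).
Proof.
move=> r0 mm mc; pose M := \int[mu]_y `|h y|.
have M0 : 0 <= M by apply: Rintegral_ge0.
apply: (le_integrable measurableT _ _ (integrableZl measurableT (c * M) (integrable_laplace_rV n r0))).
  apply/measurable_EFinP; apply: measurable_funM => //; apply: measurable_funM => //.
  by apply: measurable_cos_dotp.
move=> xi _; rewrite lee_fin !normrM [leRHS]mulrAC ler_pM//.
- by rewrite (le_trans (mc xi))// -normrM ler_norm.
- rewrite (ger0_norm M0) -[leRHS]mulr1 ler_pM//; first exact: norm_cos_transform_le.
  by rewrite ler_norml cos_geN1 cos_le1.
Qed.

Let mdiff u : measurable_fun [set: V] (profile_diff u).
Proof. by apply: measurable_profile_diff; [exact: measurable_cst|exact: measurable_id]. Qed.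

Let norm_diff u xi : 0 < u ->
  `|profile_diff u xi| <= (expR n%:R + 1) * laplace_rV (pos_rsqrt u) xi.
Proof.
move=> u0; rewrite (le_trans (ler_normB _ _))// mulrDl lerD// ?norm_profile_mult_le//.
by rewrite mul1r ger0_norm// laplace_rV_ge0.
Qed.

Lemma profile_opE u x : 0 < u -> profile_op u x = diff_op u x + low_op u x.
Proof.
move=> u0; have r0 := pos_rsqrt_gt0 u0.
rewrite /diff_op /low_op -RintegralD//.
- by apply: eq_Rintegral => xi _; rewrite -mulrDl subrK.
- by apply: (integrable_mult x r0) => // xi; exact: norm_diff.
- apply: (@integrable_mult _ 1 _ x r0); first exact: measurable_laplace_rV.
  by move=> xi; rewrite mul1r ger0_norm// laplace_rV_ge0.
Qed.

Lemma measurable_profile_op : measurable_fun [set: V * R] (fun z => profile_op z.2 z.1).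
Proof.
apply: (@measurable_fun_Rintegral _ _ _ _ _ mu (fun z : (V * R) * V =>
  profile_mult z.1.2 z.2 * (E z.2 * cos (th' + 2 * pi * dotp z.1.1 z.2)))).
apply: measurable_funM; first by apply: measurable_profile_mult => //; exact: measurableT_comp.
apply: measurable_funM; first exact: (measurableT_comp mE).
by apply: measurable_cos_dotp => //; exact: measurableT_comp.
Qed.

Lemma measurable_diff_op : measurable_fun [set: V * R] (fun z => diff_op z.2 z.1).
Proof.
apply: (@measurable_fun_Rintegral _ _ _ _ _ mu (fun z : (V * R) * V =>
  profile_diff z.1.2 z.2 * (E z.2 * cos (th' + 2 * pi * dotp z.1.1 z.2)))).
apply: measurable_funM; first by apply: measurable_profile_diff => //; exact: measurableT_comp.
apply: measurable_funM; first exact: (measurableT_comp mE).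
by apply: measurable_cos_dotp => //; exact: measurableT_comp.
Qed.

(** At fixed [u], [diff_op u] is itself a cosine transform, of phase [th'], of the integrable
    function [profile_diff u * E]. *)
Lemma diff_op_L2 u : 0 < u ->
  (\int[mu]_x (diff_op u x ^+ 2)%:E <= \int[mu]_xi (profile_diff u xi ^+ 2 * E xi ^+ 2)%:E)%E.
Proof.
move=> u0; have r0 := pos_rsqrt_gt0 u0.
have iF : mu.-integrable [set: V] (EFin \o (fun xi => profile_diff u xi * E xi)).
  pose M := \int[mu]_y `|h y|.
  have M0 : 0 <= M by apply: Rintegral_ge0.
  apply: (le_integrable measurableT _ _
    (integrableZl measurableT ((expR n%:R + 1) * M) (integrable_laplace_rV n r0))).
    by apply/measurable_EFinP; exact: measurable_funM.
  move=> xi _; rewrite lee_fin !normrM mulrAC ler_pM//.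
    by rewrite (le_trans (norm_diff _ u0))// -normrM ler_norm.
  by rewrite (ger0_norm M0) norm_cos_transform_le.
have := plancherel_cos_transform th' iF.
under [X in (_ <= X)%E -> _]eq_integral do rewrite exprMn.
apply: le_trans; rewrite le_eqVlt; apply/orP; left; apply/eqP.
apply: eq_integral => x _; congr ((_ ^+ 2)%:E); apply: eq_Rintegral => xi _.
by rewrite mulrA dotpC.
Qed.

(** Plancherel acts twice: in [x] at fixed [u], before the integral in [u] is carried out at fixed
    [xi], and once more to return from [E] to [h]. *)
Lemma square_function_L2 :
  (\int[mu]_x \int[leb]_u (pos_inv u * diff_op u x ^+ 2)%:E <=
   (C1 * pi)%:E * \int[mu]_x (h x ^+ 2)%:E)%E.
Proof.
have mD2 : measurable_fun [set: V * R] (fun z => (pos_inv z.2 * diff_op z.2 z.1 ^+ 2)%:E).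
  apply/measurable_EFinP; apply: measurable_funM; first exact: (measurableT_comp measurable_pos_inv).
  by apply: measurable_funX; exact: measurable_diff_op.
have mdE : measurable_fun [set: R * V] (fun z => (E z.2 ^+ 2 * (pos_inv z.1 * profile_diff z.1 z.2 ^+ 2))%:E).
  apply/measurable_EFinP; apply: measurable_funM.
    by apply: measurable_funX; exact: (measurableT_comp mE).
  apply: measurable_funM; first exact: (measurableT_comp measurable_pos_inv).
  by apply: measurable_funX; exact: measurable_profile_diff.
rewrite (@fubini_tonelli _ _ _ _ _ mu leb (fun z : V * R => (pos_inv z.2 * diff_op z.2 z.1 ^+ 2)%:E))//=; last first.
  by move=> z; rewrite lee_fin mulr_ge0 ?sqr_ge0// pos_inv_ge0.
apply: (@le_trans _ _ (\int[leb]_u \int[mu]_xi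
    (E xi ^+ 2 * (pos_inv u * profile_diff u xi ^+ 2))%:E)%E).
  apply: ge0_le_integral => //.
  - by move=> u _; apply: integral_ge0 => x _; rewrite lee_fin mulr_ge0 ?sqr_ge0// pos_inv_ge0.
  - apply: (measurable_fun_fubini_tonelli_G _ mD2) => z.
    by rewrite lee_fin mulr_ge0 ?sqr_ge0// pos_inv_ge0.
  - apply: (measurable_fun_fubini_tonelli_F _ mdE) => z.
    by rewrite lee_fin mulr_ge0 ?sqr_ge0// mulr_ge0 ?sqr_ge0// pos_inv_ge0.
  move=> u _; have [u0|u0] := leP u 0.
    rewrite pos_inv_le0//; under eq_integral do rewrite mul0r.
    by rewrite integral0; apply: integral_ge0 => xi _; rewrite mul0r mulr0.
  have i0 : (0 <= (pos_inv u)%:E)%E by rewrite lee_fin pos_inv_ge0.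
  under eq_integral do rewrite EFinM.
  under [leRHS]eq_integral do rewrite mulrCA EFinM.
  rewrite !ge0_integralZl//.
  - rewrite lee_wpmul2l// (le_trans (diff_op_L2 u0))// le_eqVlt; apply/orP; left; apply/eqP.
    by apply: eq_integral => xi _; rewrite mulrC.
  - by apply/measurable_EFinP; apply: measurable_funM; exact: measurable_funX.
  - by move=> xi _; rewrite lee_fin mulr_ge0// sqr_ge0.
  - apply/measurable_EFinP; apply: measurable_funX.
    exact: (measurableT_comp measurable_diff_op (measurable_pair2 u)).
  - by move=> x _; rewrite lee_fin sqr_ge0.
rewrite (@fubini_tonelli _ _ _ _ _ leb mu (fun z : R * V => (E z.2 ^+ 2 * (pos_inv z.1 * profile_diff z.1 z.2 ^+ 2))%:E))//=; last first.
  by move=> z; rewrite lee_fin mulr_ge0 ?sqr_ge0// mulr_ge0 ?sqr_ge0// pos_inv_ge0.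
apply: (@le_trans _ _ (\int[mu]_xi ((C1 * pi)%:E * (E xi ^+ 2)%:E))%E); last first.
  rewrite ge0_integralZl//; first last.
  - by rewrite lee_fin mulr_ge0// pi_ge0.
  - by move=> xi _; rewrite lee_fin sqr_ge0.
  - by apply/measurable_EFinP; exact: measurable_funX.
  by rewrite lee_wpmul2l ?lee_fin ?mulr_ge0 ?pi_ge0// plancherel_cos_transform.
apply: ge0_le_integral => //.
- move=> xi _; apply: integral_ge0 => u _.
  by rewrite lee_fin mulr_ge0 ?sqr_ge0// mulr_ge0 ?sqr_ge0// pos_inv_ge0.
- apply: (@emeasurable_fun_integral _ _ _ _ _ leb (fun z : V * R =>
    (E z.1 ^+ 2 * (pos_inv z.2 * profile_diff z.2 z.1 ^+ 2))%:E)).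
  apply/measurable_EFinP; apply: measurable_funM.
    by apply: measurable_funX; exact: (measurableT_comp mE).
  apply: measurable_funM; first exact: (measurableT_comp measurable_pos_inv).
  by apply: measurable_funX; exact: measurable_profile_diff.
- by apply: measurable_funeM; apply/measurable_EFinP; exact: measurable_funX.
move=> xi _; under eq_integral do rewrite EFinM.
rewrite ge0_integralZl//.
- by rewrite muleC lee_wpmul2r ?lee_fin ?sqr_ge0// integral_profile_diff_le.
- apply/measurable_EFinP; apply: measurable_funM; first exact: measurable_pos_inv.
  apply: measurable_funX; apply: measurable_profile_diff; first exact: measurable_id.
  exact: measurable_cst.
- by move=> u _; rewrite lee_fin mulr_ge0 ?sqr_ge0// pos_inv_ge0.
- by rewrite lee_fin sqr_ge0.
Qed.

(** From [(a + b)^2 <= 2 a^2 + 2 b^2] with [a] the difference and [b] the Poisson part; this doubles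
    the constants [C1 * pi] and [4 * 64^n] of the two bounds. *)
Lemma averaged_profile_op (B : R) : (forall x, `|h x| <= B) ->
  exists Z : V -> \bar R, [/\ measurable_fun [set: V] Z, forall x, (0 <= Z x)%E,
    forall x (tau : R), 0 < tau ->
      (\int[leb]_(u in `]0%R, tau[) (profile_op u x ^+ 2)%:E <= tau%:E * Z x)%E &
    (\int[mu]_x Z x <= (2 * (C1 * pi) + 8 * 64 ^+ n)%:E * \int[mu]_x (h x ^+ 2)%:E)%E].
Proof.
move=> hB.
have mnh : measurable_fun [set: V] (fun y => `|h y|) by exact: measurableT_comp.
have [Y [mY Y0 kY intY]] := poisson_maximal mnh (fun y => normr_ge0 _) hB.
pose Sq x := (\int[leb]_u (pos_inv u * diff_op u x ^+ 2)%:E)%E.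
have mD2 : measurable_fun [set: V * R] (fun z => (pos_inv z.2 * diff_op z.2 z.1 ^+ 2)%:E).
  apply/measurable_EFinP; apply: measurable_funM; first exact: (measurableT_comp measurable_pos_inv).
  by apply: measurable_funX; exact: measurable_diff_op.
have mSq : measurable_fun [set: V] Sq.
  exact: (@emeasurable_fun_integral _ _ _ _ _ leb
    (fun z : V * R => (pos_inv z.2 * diff_op z.2 z.1 ^+ 2)%:E) mD2).
have Sq0 x : (0 <= Sq x)%E.
  by apply: integral_ge0 => u _; rewrite lee_fin mulr_ge0 ?sqr_ge0// pos_inv_ge0.
have low u x : 0 < u -> ((low_op u x ^+ 2)%:E <= Y x)%E.
  move=> u0; have r0 := pos_rsqrt_gt0 u0; rewrite (le_trans _ (kY _ x r0))// lee_fin.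
  rewrite -(real_normK (num_real (low_op u x))) ler_sqr ?nnegrE//; last first.
    by apply: Rintegral_ge0 => y _; rewrite mulr_ge0// poisson_kernel_ge0.
  have := integral_laplace_cos_transform_le th th' x r0 ih.
  have := integrable_mul_poisson_kernel x r0 mnh (fun y => normr_ge0 _) hB.
  move=> /(integrable_fin_num measurableT) /fineK <-.
  by rewrite lee_fin.
exists (fun x => 2%:E * (Sq x + Y x))%E; split.
- by apply: measurable_funeM; exact: emeasurable_funD.
- by move=> x; rewrite mule_ge0// adde_ge0.
- move=> x tau tau0.
  have mDx : measurable_fun [set: R] (fun u => (pos_inv u * diff_op u x ^+ 2)%:E).
    exact: (measurableT_comp mD2 (measurable_pair1 x)).
  have D0 u : (0 <= (pos_inv u * diff_op u x ^+ 2)%:E)%E.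
    by rewrite lee_fin mulr_ge0 ?sqr_ge0// pos_inv_ge0.
  apply: (@le_trans _ _ (\int[leb]_(u in `]0%R, tau[)
      ((2 * tau)%:E * (pos_inv u * diff_op u x ^+ 2)%:E + 2%:E * Y x))%E).
    apply: ge0_le_integral => //.
    + by move=> u _; rewrite lee_fin sqr_ge0.
    + apply/measurable_funTS/measurable_EFinP; apply: measurable_funX.
      exact: (measurableT_comp measurable_profile_op (measurable_pair1 x)).
    + apply: emeasurable_funD => //; apply: measurable_funTS.
      exact: measurable_funeM.
    move=> u /=; rewrite in_itv /= => /andP[u0 ut].
    apply: (@le_trans _ _ ((2 * diff_op u x ^+ 2)%:E + 2%:E * (low_op u x ^+ 2)%:E)%E).
      rewrite -EFinM -EFinD lee_fin profile_opE//.
      by have := sqr_ge0 (diff_op u x - low_op u x); nra.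
    apply: leeD; last by rewrite lee_wpmul2l// low.
    (* Since [u < tau], the factor [tau / u] is at least 1: the average over []0, tau[] is dominated
       by the integral against [du / u], which does not depend on [tau]. *)
    rewrite -EFinM lee_fin -mulrA ler_pM2l// mulrA ler_peMl ?sqr_ge0//.
    by rewrite pos_invE// ler_pdivlMr// mul1r ltW.
  rewrite ge0_integralD//; first last.
  + by move=> u _; rewrite mule_ge0.
  + by apply: measurable_funTS; exact: measurable_funeM.
  + by move=> u _; rewrite mule_ge0// lee_fin mulr_ge0// ltW.
  rewrite ge0_integralZl//; first last.
  + by rewrite lee_fin mulr_ge0// ltW.
  + exact: measurable_funTS.
  have -> : (\int[leb]_(_ in `]0%R, tau[) (2%:E * Y x) = 2%:E * Y x * tau%:E)%E.
    rewrite [LHS](integral_cst leb (measurable_itv _)).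
    congr (_ * _)%E; rewrite [LHS](@lebesgue_measure_itv R `]0, tau[).
    by rewrite /= lte_fin tau0 -EFinB subr0.
  have -> : (tau%:E * (2%:E * (Sq x + Y x)) = (2 * tau)%:E * Sq x + 2%:E * Y x * tau%:E)%E.
    by rewrite muleA -EFinM (mulrC tau) ge0_muleDr//; congr (_ + _)%E; rewrite EFinM muleAC.
  apply: leeD; last by [].
  rewrite lee_wpmul2l//; first by rewrite lee_fin mulr_ge0// ltW.
  exact: ge0_subset_integral.
- rewrite ge0_integralZl//; first last.
  + by move=> x _; rewrite adde_ge0.
  + exact: emeasurable_funD.
  rewrite ge0_integralD//.
  apply: (@le_trans _ _ (2%:E * ((C1 * pi)%:E * \int[mu]_x (h x ^+ 2)%:E +
     (4 * 64 ^+ n)%:E * \int[mu]_x (h x ^+ 2)%:E))%E).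
    rewrite lee_wpmul2l// leeD// ?square_function_L2// (le_trans intY)//.
    by under eq_integral do rewrite real_normK ?num_real//.
  have : (0 <= \int[mu]_x (h x ^+ 2)%:E)%E by apply: integral_ge0 => x _; rewrite lee_fin sqr_ge0.
  move: (integral _ _ _) => I I0.
  rewrite -ge0_muleDl ?lee_fin ?mulr_ge0 ?exprn_ge0// ?pi_ge0//.
  have -> : 2 * (C1 * pi) + 8 * 64 ^+ n = 2 * (C1 * pi + 4 * 64 ^+ n) :> R.
    by move: (C1 * pi) (64 ^+ n : R) => a b; ring.
  by rewrite EFinM EFinD muleA.
Qed.

End transform.

End square_function.

(** * Subordination of the bilinear form *)

Section subordination.
Context {R : realType}.
Local Notation leb := (@lebesgue_measure R).

Lemma powR_LRcontinuous (p c : R) : 0 < p -> 0 < c ->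
  derivable_oo_LRcontinuous (fun v : R => v `^ p) 0 c.
Proof.
move=> p0 c0.
have dp v : 0 < v -> derivable (fun v : R => v `^ p) v 1.
  by move=> v0; have [] := is_derive1_powR p v0.
split.
- by move=> v; rewrite in_itv/= => /andP[v0 _]; exact: dp.
- by rewrite powR0 ?gt_eqF//; exact: powR_cvg0.
- have /derivable1_diffP/differentiable_continuous cc := dp _ c0.
  exact: cvg_at_left_filter cc.
Qed.

Lemma integral_powR (lam c : R) : 1 < lam -> 0 < c ->
  (\int[leb]_(v in `[0%R, c]) (v `^ (lam - 1))%:E = (c `^ lam / lam)%:E)%E.
Proof.
move=> lam1 c0; have lam0 : 0 < lam by lra.
have dF (v : R) : 0 < v -> is_derive v 1 (fun v => v `^ lam / lam) (v `^ (lam - 1)).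
  move=> v0; have d := is_derive1_powR lam v0.
  have -> : (fun v => v `^ lam / lam) = (fun v : R => v `^ lam) * cst lam^-1 by [].
  apply: is_derive_eq.
  by rewrite scaler0 add0r /cst/= /GRing.scale/=; field; rewrite gt_eqF.
have [_ L0 Lc] := powR_LRcontinuous lam0 c0.
rewrite (@continuous_FTC2 _ _ (fun v => v `^ lam / lam))//.
- by rewrite powR0 ?gt_eqF// mul0r sube0.
- apply: derivable_oo_LRcontinuous_within; apply: powR_LRcontinuous => //; lra.
- split.
  + move=> v; rewrite in_itv/= => /andP[v0 _].
    by have := dF _ v0; case.
  + exact: cvgMl.
  + exact: cvgMl.
- move=> v; rewrite in_itv/= => /andP[v0 _]; rewrite derive1E.
  by have := dF _ v0 => -[_ ->].
Qed.

Lemma measurable_lt_indic d (T : measurableType d) (f g : T -> R) :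
  measurable_fun [set: T] f -> measurable_fun [set: T] g ->
  measurable_fun [set: T] (fun t => (f t < g t)%R%:R : R).
Proof.
move=> mf mg; have mb := measurable_fun_ltr mf mg.
rewrite (_ : (fun t => _) = (fun t => if f t < g t then 1 else 0 : R)).
  by apply: measurable_fun_ifT.
by apply/funext => t; case: (f t < g t).
Qed.

(** Translation by [a] leaves the integral of [v^(lam - 1)] from 0 to [w - a]; for [w <= a] both
    sides vanish because 0 to a positive power is 0. It is applied with [a = |xi|^2] and
    [w = tau - |eta|^2]. *)
Lemma integral_powR_subordination (lam a w : R) : 1 < lam ->
  (\int[leb]_u (Num.max (u - a) 0 `^ (lam - 1) * (u < w)%R%:R)%:E =
   (Num.max (w - a) 0 `^ lam / lam)%:E)%E.
Proof.
move=> lam1; have lam0 : 0 < lam by lra.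
pose g (v : R) := Num.max v 0 `^ (lam - 1) * (v < w - a)%R%:R.
have mg : measurable_fun [set: R] g.
  by apply: measurable_funM; [exact: measurable_maxr0|exact: measurable_lt_indic].
have g0 v : 0 <= g v by rewrite mulr_ge0 ?powR_ge0.
transitivity (\int[leb]_u (g (u - a))%:E)%E.
  by apply: eq_integral => u _; rewrite /g ltrD2r.
rewrite (@ge0_integral_translate _ (- a) (EFin \o g)); last 2 first.
- exact/measurable_EFinP.
- by move=> v; rewrite lee_fin.
have [wa|aw] := leP (w - a) 0.
  rewrite powR0 ?gt_eqF// mul0r integral0_eq// => v _ /=.
  rewrite /g; case: ltP => [vwa|_]; last by rewrite mulr0.
  by rewrite max_r ?powR0 ?mul0r//; lra.
rewrite -integral_powR//.
rewrite integral_itv_bndoo; last first.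
  by apply/measurable_EFinP; exact: measurable_funTS (measurable_powR _).
rewrite [RHS]integral_mkcond; apply: eq_integral => v _ /=; rewrite patchE /g.
case: ifPn => [|/negP h].
  by rewrite inE/= in_itv/= => /andP[v0 ->]; rewrite max_l ?ltW// mulr1.
have [v0|v0] := leP v 0; first by rewrite powR0 ?mul0r// gt_eqF//; lra.
case: ltP => [va|_]; last by rewrite mulr0.
by case: h; rewrite inE/= in_itv/= v0.
Qed.

Lemma integral_itv0E (f : R -> R) (tau : R) :
  (\int[leb]_(u in `]0%R, tau[) (f u)%:E = \int[leb]_u (f u * (0 < u < tau)%R%:R)%:E)%E.
Proof.
rewrite integral_mkcond; apply: eq_integral => u _; rewrite patchE.
by rewrite mem_setE in_itv/=; case: ifP => _; rewrite ?mulr1 ?mulr0.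
Qed.

End subordination.

(** * The two profiles: ball and bump *)

Section profiles.
Context {R : realType}.

(* For u > 0, 1_(|xi|^2 < u) is [ball_profile (|xi|^2 / u)], and (u - |xi|^2)_+^(lam - 1) is
   u^(lam - 1) [bump_profile lam (|xi|^2 / u)]. *)
Definition ball_profile (s : R) : R := (s < 1)%R%:R.
Definition bump_profile (lam s : R) : R := Num.max (1 - s) 0 `^ (lam - 1).

Lemma measurable_ball_profile : measurable_fun [set: R] ball_profile.
Proof. by apply: measurable_lt_indic => //; exact: measurable_id. Qed.

Lemma ball_profile_le1 (s : R) : 0 <= s -> `|ball_profile s| <= 1.
Proof. by move=> _; rewrite /ball_profile; case: (s < 1); rewrite ?normr1 ?normr0. Qed.

Lemma ball_profile_supp (s : R) : 1 <= s -> ball_profile s = 0.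
Proof. by move=> s1; rewrite /ball_profile ltNge s1. Qed.

Lemma ball_profile_near0 (s : R) : 0 <= s -> s <= 1 -> `|1 - ball_profile s| <= 1 * s.
Proof.
rewrite /ball_profile mul1r => s0 s1; case: ltP => [_|s1'].
  by rewrite subrr normr0.
by rewrite subr0 normr1.
Qed.

Section bump_profile.
Variable lam : R.
Hypothesis lam1 : 1 < lam.

Let lam10 : 0 < lam - 1. Proof. by rewrite subr_gt0. Qed.

Lemma measurable_bump_profile : measurable_fun [set: R] (bump_profile lam).
Proof.
apply: (measurableT_comp (@measurable_maxr0 R _) (g := fun s : R => 1 - s)).
exact: measurable_funB.
Qed.

Lemma bump_profile_ge0 (s : R) : 0 <= bump_profile lam s.
Proof. exact: powR_ge0. Qed.

Lemma bump_profile_le1 (s : R) : 0 <= s -> `|bump_profile lam s| <= 1.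
Proof.
move=> s0; rewrite ger0_norm ?bump_profile_ge0// /bump_profile.
have l0 := ltW lam10.
rewrite [leRHS](_ : 1 = 1 `^ (lam - 1)); last by rewrite powR1.
apply: ge0_ler_powR => //; rewrite ?nnegrE ?ler01//.
  by rewrite le_max lexx orbT.
by rewrite ge_max ler01 andbT gerBl.
Qed.

Lemma bump_profile_supp (s : R) : 1 <= s -> bump_profile lam s = 0.
Proof. by move=> s1; rewrite /bump_profile max_r ?subr_le0// powR0// gt_eqF. Qed.

(** Bernoulli's inequality, after the exponent [lam - 1] has been raised to an integer [K]: [(1 -
    s)^(lam - 1) >= (1 - s)^K >= 1 - K s]. *)
Lemma bump_profile_near0 (s : R) : 0 <= s -> s <= 1 ->
  `|1 - bump_profile lam s| <= (Num.trunc lam).+1%:R * s.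
Proof.
move=> s0 s1; have l1 := bump_profile_le1 s0.
rewrite ger0_norm ?subr_ge0; last exact: le_trans (ler_norm _) l1.
rewrite lerBlDr -lerBlDl /bump_profile max_l ?subr_ge0//.
set K := (Num.trunc lam).+1.
have lK : lam - 1 <= K%:R.
  have /ltW : lam < K%:R by exact: truncnS_gt.
  lra.
apply: (@le_trans _ _ ((1 - s) ^+ K)); last first.
  rewrite -powR_mulrn ?subr_ge0//.
  (* At [s = 1] both powers are powers of 0; for a base in []0, 1]] a power decreases with its
     exponent. *)
  have [->|sn1] := eqVneq s 1.
    by rewrite subrr !powR0// ?gt_eqF ?ltr0n.
  by apply: ger_powR => //; rewrite subr_gt0 lt_neqAle sn1 s1/=; lra.
elim: K {lK} => [|k ih]; first by rewrite mul0r subr0 expr0.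
rewrite exprS.
apply: (@le_trans _ _ ((1 - s) * (1 - k%:R * s))); last by rewrite ler_wpM2l ?subr_ge0.
by rewrite -natr1; have := mulr_ge0 (ler0n R k) (sqr_ge0 s); nra.
Qed.

End bump_profile.

End profiles.

(** * The bilinear form as an average over levels *)

Section bilinear_form.
Context {R : realType} {n : nat}.
Local Notation V := 'rV[R]_n.
Local Notation mu := (leb_rV n).
Local Notation leb := (@lebesgue_measure R).
Implicit Types (xi eta : V) (u tau : R) (phi psi : V -> R).

Lemma profile_mult_ball_eq u xi : 0 < u ->
  profile_mult ball_profile u xi = (dotp xi xi < u)%R%:R.
Proof.
by move=> u0; rewrite /profile_mult /ball_profile pos_invE// ltr_pdivrMr// mul1r.
Qed.

Lemma powR_profile_mult lam u xi : 1 < lam -> 0 < u ->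
  Num.max (u - dotp xi xi) 0 `^ (lam - 1) = u `^ (lam - 1) * profile_mult (bump_profile lam) u xi.
Proof.
move=> lam1 u0; rewrite /profile_mult /bump_profile pos_invE// -powRM ?(ltW u0)//.
  congr (_ `^ _); rewrite maxr_pMr ?(ltW u0)// mulr0 mulrBr mulr1.
  by rewrite mulrCA divff ?mulr1// gt_eqF.
by rewrite le_max lexx orbT.
Qed.

(** Here [tau] stands for [t^-2], and the homogeneous factor [t^(2 lam)] has been taken out of the
    multiplier. The real functions [phi] and [psi] will be components of modulated Fourier
    transforms at a fixed [x]. *)
Definition bilinear_form lam tau phi psi : R :=
  \int[mu]_eta \int[mu]_xi
    (Num.max (tau - (dotp xi xi + dotp eta eta)) 0 `^ lam * (phi xi * psi eta)).

Definition mult_integral om phi u : R := \int[mu]_xi (profile_mult om u xi * phi xi).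

(** An integrable function that is at least 1 on the ball [|xi|^2 < tau]. It replaces the indicator
    of that ball as a dominating function in Fubini's theorem. *)
Definition laplace_majorant tau xi : R := expR n%:R * laplace_rV (pos_rsqrt tau) xi.

Lemma laplace_majorant_ge0 tau xi : 0 <= laplace_majorant tau xi.
Proof. by rewrite mulr_ge0 ?expR_ge0 ?laplace_rV_ge0. Qed.

Lemma laplace_majorant_ge1 tau xi : 0 < tau -> dotp xi xi < tau -> 1 <= laplace_majorant tau xi.
Proof.
move=> tau0 qt; have := norm_profile_mult_le ball_profile_le1 ball_profile_supp xi tau0.
by rewrite profile_mult_ball_eq// qt normr1.
Qed.

Lemma integrable_laplace_majorant tau : 0 < tau ->
  mu.-integrable [set: V] (EFin \o laplace_majorant tau).
Proof.
move=> tau0.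
exact: (integrableZl measurableT (expR n%:R) (integrable_laplace_rV n (pos_rsqrt_gt0 tau0))).
Qed.

Section subordinated_form.
Variables (lam tau : R) (phi psi : V -> R) (M M' : R).
Hypothesis lam1 : 1 < lam.
Hypothesis tau0 : 0 < tau.
Hypothesis mphi : measurable_fun [set: V] phi.
Hypothesis mpsi : measurable_fun [set: V] psi.
Hypothesis phi_le : forall xi, `|phi xi| <= M.
Hypothesis psi_le : forall eta, `|psi eta| <= M'.

Local Notation mask u := ((0 < u < tau)%R%:R : R).
Local Notation bump := (bump_profile lam).
Local Notation ball := (@ball_profile R).

Let kern xi eta u : R := mask u * (u `^ (lam - 1) *
  (profile_mult bump u xi * profile_mult ball (tau - u) eta)).

Local Notation L := (laplace_majorant tau).

Let L_ge0 := laplace_majorant_ge0 tau.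

Let lt_L xi := @laplace_majorant_ge1 _ xi tau0.

Let iL := integrable_laplace_majorant tau0.

Let norm_bump u xi : 0 < u -> u < tau -> `|profile_mult bump u xi| <= L xi.
Proof.
move=> u0 ut; have [uq|qu] := leP u (dotp xi xi).
  by rewrite /profile_mult bump_profile_supp ?normr0// pos_invE// ler_pdivlMr// mul1r.
apply: le_trans (lt_L (lt_trans qu ut)).
by apply: bump_profile_le1 => //; rewrite mulr_ge0 ?dotp_ge0 ?pos_inv_ge0.
Qed.

Let norm_ball u eta : 0 < u -> u < tau -> `|profile_mult ball (tau - u) eta| <= L eta.
Proof.
move=> u0 ut; rewrite profile_mult_ball_eq ?subr_gt0//.
case: ltP => [h|_]; last by rewrite normr0.
rewrite normr1; apply: lt_L; apply: lt_trans h _.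
by rewrite ltrBlDr ltrDl.
Qed.

(** Outside [0 < u < tau] both sides vanish: [u - |xi|^2] is not positive for [u <= 0], and
    [u < tau - |eta|^2] fails for [u >= tau]. Inside, homogeneity extracts [u^(lam - 1)]. *)
Let kernE xi eta u :
  Num.max (u - dotp xi xi) 0 `^ (lam - 1) * (u < tau - dotp eta eta)%R%:R = kern xi eta u.
Proof.
have lam10 : 0 < lam - 1 by rewrite subr_gt0.
rewrite /kern; have [u0|u0] := leP u 0.
  rewrite /= mul0r max_r ?powR0 ?mul0r// ?gt_eqF//.
  by have := dotp_ge0 xi; lra.
rewrite powR_profile_mult//= ; have [ut|tu] := ltP u tau; last first.
  rewrite (_ : (u < tau - _) = false) ?mulr0 ?mul0r//.
  by apply/negbTE; rewrite -leNgt; have := dotp_ge0 eta; lra.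
rewrite mul1r profile_mult_ball_eq ?subr_gt0// -mulrA; congr (_ * (_ * _%:R)).
by congr nat_of_bool; apply/idP/idP => ?; lra.
Qed.

Let kern_ge0 xi eta u : 0 <= kern xi eta u.
Proof. by rewrite -kernE mulr_ge0 ?powR_ge0. Qed.

Let norm_kern xi eta u : kern xi eta u <= mask u * (tau `^ (lam - 1) * (L xi * L eta)).
Proof.
rewrite /kern; have [u0|u0] := ltP 0 u; last by rewrite !mul0r.
have [ut|ut] := ltP u tau; last by rewrite !mul0r.
rewrite !mul1r; apply: ler_pM => //; first exact: powR_ge0.
- by rewrite mulr_ge0// /profile_mult ?bump_profile_ge0// ler0n.
- by apply: ge0_ler_powR; rewrite ?nnegrE ?ltW// subr_gt0.
- apply: ler_pM; [exact: bump_profile_ge0|exact: ler0n| |].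
  + exact: le_trans (ler_norm _) (norm_bump _ _ _).
  + exact: le_trans (ler_norm _) (norm_ball _ _ _).
Qed.

Let mmask : measurable_fun [set: R] (fun u => mask u).
Proof.
rewrite (_ : (fun u : R => _) = (fun u => (0 < u)%R%:R * (u < tau)%R%:R)).
  by apply: measurable_funM; apply: measurable_lt_indic.
by apply/funext => u; case: (0 < u); case: (u < tau); rewrite ?mulr0 ?mul0r ?mulr1.
Qed.

Let mask_integrable : leb.-integrable [set: R] (EFin \o (fun u => mask u)).
Proof.
apply/integrableP; split; first exact/measurable_EFinP.
have -> : (\int[leb]_u `|(EFin \o (fun u => mask u)) u| = \int[leb]_(u in `]0%R, tau[) 1%:E)%E.
  rewrite integral_itv0E; apply: eq_integral => u _ /=.
  by rewrite mul1r ger0_norm.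
rewrite (integral_cst leb (measurable_itv _)) mul1e.
by rewrite [X in (X < _)%E](@lebesgue_measure_itv R `]0%R, tau[)/=; case: ifP => _; rewrite ?ltry.
Qed.

Let Rintegral_kern xi eta :
  Num.max (tau - (dotp xi xi + dotp eta eta)) 0 `^ lam = lam * \int[leb]_u kern xi eta u.
Proof.
have := integral_powR_subordination (dotp xi xi) (tau - dotp eta eta) lam1.
under eq_integral do rewrite kernE.
rewrite /Rintegral => -> /=.
by rewrite mulrC divfK ?gt_eqF ?(lt_trans ltr01)// opprD addrA [_ - _ - _]addrAC.
Qed.

Let measurable_kern d (T : measurableType d) (f g : T -> V) (w : T -> R) :
  measurable_fun [set: T] f -> measurable_fun [set: T] g -> measurable_fun [set: T] w ->
  measurable_fun [set: T] (fun z => kern (f z) (g z) (w z)).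
Proof.
move=> mf mg mw; apply: measurable_funM; first exact: (measurableT_comp mmask).
apply: measurable_funM; first exact: (measurableT_comp (measurable_powR _)).
apply: measurable_funM.
  by apply: measurable_profile_mult => //; exact: measurable_bump_profile.
apply: measurable_profile_mult => //; first exact: measurable_ball_profile.
exact: measurable_funB.
Qed.

Let A u : R := mult_integral bump phi u.

Let M0 : 0 <= M. Proof. exact: le_trans (normr_ge0 _) (phi_le 0). Qed.

Let measurable_A : measurable_fun [set: R] A.
Proof.
apply: (@measurable_fun_Rintegral _ _ _ _ _ mu (fun z : R * V =>
  profile_mult bump z.1 z.2 * phi z.2)).
apply: measurable_funM; last exact: (measurableT_comp mphi).
by apply: measurable_profile_mult => //; exact: measurable_bump_profile.
Qed.

Let norm_bump_phi u xi : 0 < u -> u < tau -> `|profile_mult bump u xi * phi xi| <= M * L xi.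
Proof. by move=> u0 ut; rewrite normrM mulrC ler_pM//; exact: norm_bump. Qed.

Let iML : mu.-integrable [set: V] (EFin \o (fun xi => M * L xi)).
Proof. exact: (integrableZl measurableT M iL). Qed.

Let integrable_bump_phi u : 0 < u -> u < tau ->
  mu.-integrable [set: V] (EFin \o (fun xi => profile_mult bump u xi * phi xi)).
Proof.
move=> u0 ut; apply: le_integrable iML => //.
  apply/measurable_EFinP; apply: measurable_funM => //.
  by apply: (@measurable_profile_mult _ _ _ (measurable_bump_profile lam) _ _ (fun=> u) id).
by move=> xi _ /=; rewrite lee_fin (le_trans (norm_bump_phi _ _ _))// ler_norm.
Qed.

Let norm_A u : 0 < u -> u < tau -> `|A u| <= M * \int[mu]_xi L xi.
Proof.
move=> u0 ut; have iP := integrable_bump_phi u0 ut.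
apply: (le_trans (le_normr_Rintegral measurableT iP)).
rewrite -RintegralZl//; apply: le_Rintegral => //; last by move=> xi _; exact: norm_bump_phi.
exact: integrable_norm iP.
Qed.

(** The triple integral over [eta], [xi] and [u] is rearranged by two exchanges of two variables:
    here [xi] with [u] at fixed [eta], and then [eta] with [u]. *)
Let inner_swap eta : \int[mu]_xi
    (Num.max (tau - (dotp xi xi + dotp eta eta)) 0 `^ lam * (phi xi * psi eta)) =
  lam * \int[leb]_u (mask u * (u `^ (lam - 1) *
     (A u * (profile_mult ball (tau - u) eta * psi eta)))).
Proof.
pose F (z : V * R) : R := kern z.1 eta z.2 * (phi z.1 * psi eta).
have mF : measurable_fun [set: V * R] F.
  apply: measurable_funM.
    by apply: measurable_kern.
  by apply: measurable_funM => //; exact: (measurableT_comp mphi).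
have iA : mu.-integrable [set: V] (EFin \o (fun xi => tau `^ (lam - 1) * L eta * (M * M') * L xi)).
  exact: (integrableZl measurableT _ iL).
have FAB xi u : `|F (xi, u)| <= (tau `^ (lam - 1) * L eta * (M * M') * L xi) * mask u.
  rewrite /F/= normrM (ger0_norm (kern_ge0 _ _ _)) normrM.
  apply: (@le_trans _ _ ((mask u * (tau `^ (lam - 1) * (L xi * L eta))) * (M * M'))).
    by apply: ler_pM; [exact: kern_ge0|exact: mulr_ge0|exact: norm_kern|exact: ler_pM].
  by rewrite le_eqVlt; apply/orP; left; apply/eqP; ring.
transitivity (lam * \int[mu]_xi \int[leb]_u F (xi, u)).
  rewrite -RintegralZl//; last exact: (@dominated_integrable_Rintegral2 _ _ _ _ _ mu leb F _ _ mF iA mask_integrable FAB).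
  apply: eq_Rintegral => xi _; rewrite Rintegral_kern -mulrA; congr (_ * _).
  rewrite -RintegralZr//.
  pose k (z : V * R) : R := kern z.1 eta z.2.
  have mk : measurable_fun [set: V * R] k by apply: measurable_kern.
  apply: (@dominated_integrable2 _ _ _ _ _ leb k (fun xi => tau `^ (lam - 1) * (L xi * L eta)) _ mk mask_integrable).
  by move=> xi' u; rewrite ger0_norm ?kern_ge0// mulrC; exact: norm_kern.
rewrite (@dominated_Fubini _ _ _ _ _ mu leb F _ _ mF iA mask_integrable FAB); congr (_ * _).
apply: eq_Rintegral => u _; rewrite /F/= /kern.
have [/andP[u0 ut]|_] := boolP (0 < u < tau); last first.
  rewrite mul0r; under eq_Rintegral do rewrite !mul0r.
  by rewrite /Rintegral integral0.
rewrite mul1r /A /mult_integral.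
transitivity (\int[mu]_xi (profile_mult bump u xi * phi xi *
    (u `^ (lam - 1) * (profile_mult ball (tau - u) eta * psi eta)))).
  by apply: eq_Rintegral => xi _; rewrite /= ?mul1r; ring.
by rewrite RintegralZr ?integrable_bump_phi//; ring.
Qed.

Lemma bilinear_form_subordination : bilinear_form lam tau phi psi =
  lam * \int[leb]_u (mask u * (u `^ (lam - 1) *
    (mult_integral bump phi u * mult_integral ball psi (tau - u)))).
Proof.
rewrite /bilinear_form; under eq_Rintegral do rewrite inner_swap.
pose F (z : V * R) : R := mask z.2 * (z.2 `^ (lam - 1) *
  (A z.2 * (profile_mult ball (tau - z.2) z.1 * psi z.1))).
have mball d (T : measurableType d) (f : T -> V) (g : T -> R) :
    measurable_fun [set: T] f -> measurable_fun [set: T] g ->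
    measurable_fun [set: T] (fun z => profile_mult ball (tau - g z) (f z)).
  move=> mf mg; apply: measurable_profile_mult => //; first exact: measurable_ball_profile.
  exact: measurable_funB.
have mF : measurable_fun [set: V * R] F.
  apply: measurable_funM; first exact: (measurableT_comp mmask).
  apply: measurable_funM; first exact: (measurableT_comp (measurable_powR _)).
  apply: measurable_funM; first exact: (measurableT_comp measurable_A).
  by apply: measurable_funM; [exact: mball|exact: (measurableT_comp mpsi)].
pose c := tau `^ (lam - 1) * (M * \int[mu]_xi L xi).
have iA : mu.-integrable [set: V] (EFin \o (fun eta => M' * c * L eta)).
  exact: (integrableZl measurableT _ iL).
have FAB eta u : `|F (eta, u)| <= M' * c * L eta * mask u.
  rewrite /F/=; have [/andP[u0 ut]|_] := boolP (0 < u < tau); last by rewrite !(mul0r, mulr0) normr0.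
  rewrite mul1r mulr1 !normrM (ger0_norm (powR_ge0 _ _)).
  apply: (@le_trans _ _ (tau `^ (lam - 1) * ((M * \int[mu]_xi L xi) * (L eta * M')))).
    apply: ler_pM => //; [exact: powR_ge0| |].
      by apply: ge0_ler_powR; rewrite ?nnegrE ?ltW// subr_gt0.
    by apply: ler_pM => //; [exact: norm_A|apply: ler_pM => //; exact: norm_ball].
  by rewrite /c le_eqVlt; apply/orP; left; apply/eqP; ring.
transitivity (\int[mu]_eta (lam * \int[leb]_u F (eta, u))); first by [].
have iF := @dominated_integrable_Rintegral2 _ _ _ _ _ mu leb F _ _ mF iA mask_integrable FAB.
rewrite (RintegralZl lam measurableT iF).
rewrite (@dominated_Fubini _ _ _ _ _ mu leb F _ _ mF iA mask_integrable FAB); congr (_ * _).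
apply: eq_Rintegral => u _; rewrite /F/=.
have [/andP[u0 ut]|_] := boolP (0 < u < tau); last first.
  rewrite mul0r; under eq_Rintegral do rewrite !mul0r.
  by rewrite /Rintegral integral0.
rewrite mul1r [in RHS]/mult_integral.
have iB : mu.-integrable [set: V] (EFin \o (fun eta => profile_mult ball (tau - u) eta * psi eta)).
  have iM'L : mu.-integrable [set: V] (EFin \o (fun xi => M' * L xi)).
    exact: (integrableZl measurableT M' iL).
  apply: le_integrable iM'L => //.
    by apply/measurable_EFinP; apply: measurable_funM => //; exact: (mball _ _ id (fun=> u)).
  move=> eta _ /=; rewrite lee_fin (le_trans _ (ler_norm _))//.
  by rewrite normrM mulrC ler_pM//; exact: norm_ball.
transitivity (\int[mu]_eta (u `^ (lam - 1) * A u * (profile_mult ball (tau - u) eta * psi eta))).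
  by apply: eq_Rintegral => eta _; rewrite /= ?mul1r; ring.
by rewrite RintegralZl// /A /mult_integral; ring.
Qed.

(** In the subordination formula [u^(lam - 1)] is at most [tau^(lam - 1)], Young's inequality
    separates the two factors, and the reflection [u |-> tau - u] brings the ball means back to
    level [u]. The power [tau^(lam - 1)] and the length [tau] of the interval combine to
    [tau^lam]. *)
Lemma bilinear_form_le (eps : R) (zphi zpsi : \bar R) : 0 < eps ->
  (0 <= zphi)%E -> (0 <= zpsi)%E ->
  (\int[leb]_(u in `]0%R, tau[) (mult_integral bump phi u ^+ 2)%:E <= tau%:E * zphi)%E ->
  (\int[leb]_(u in `]0%R, tau[) (mult_integral ball psi u ^+ 2)%:E <= tau%:E * zpsi)%E ->
  (`|bilinear_form lam tau phi psi|%:E <=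
    (lam * tau `^ lam)%:E * ((eps / 2)%:E * zphi + ((2 * eps)^-1)%:E * zpsi))%E.
Proof.
move=> eps0 zphi0 zpsi0 hphi hpsi.
rewrite bilinear_form_subordination normrM gtr0_norm ?(lt_trans ltr01)//.
pose B u := mult_integral ball psi u.
have mB : measurable_fun [set: R] B.
  apply: (@measurable_fun_Rintegral _ _ _ _ _ mu (fun z : R * V =>
    profile_mult ball z.1 z.2 * psi z.2)).
  apply: measurable_funM; last exact: (measurableT_comp mpsi).
  by apply: measurable_profile_mult => //; exact: measurable_ball_profile.
have mBt : measurable_fun [set: R] (fun u => B (tau - u)).
  by apply: (measurableT_comp mB); exact: measurable_funB.
have : (`|\int[leb]_u (mask u * (u `^ (lam - 1) * (A u * B (tau - u))))|%:E <=
  (tau `^ (lam - 1))%:E * \int[leb]_u ((mask u * `|A u|) * (mask u * `|B (tau - u)|))%:E)%E.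
  apply: (le_trans (le_EFin_Rintegral leb _)).
    apply: measurable_funM => //; apply: measurable_funM; first exact: measurable_powR.
    exact: measurable_funM.
  have mABm : measurable_fun [set: R] (fun u => (mask u * `|A u|) * (mask u * `|B (tau - u)|)).
    by apply: measurable_funM; apply: measurable_funM => //; exact: measurableT_comp.
  rewrite -[leRHS](ge0_integralZl_EFin leb measurableT _ _ (powR_ge0 tau (lam - 1))); last 2 first.
  - by move=> u _; rewrite lee_fin !mulr_ge0.
  - exact/measurable_EFinP.
  apply: ge0_le_integral => //.
  - apply/measurable_EFinP; apply: measurableT_comp => //.
    apply: measurable_funM => //; apply: measurable_funM; first exact: measurable_powR.
    exact: measurable_funM.
  - by apply/measurable_EFinP; apply: measurable_funM.
  - move=> u _; rewrite -EFinM lee_fin.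
    have [/andP[u0 ut]|_] := boolP (0 < u < tau); last by rewrite !(mul0r, mulr0) normr0.
    rewrite !mul1r !normrM (ger0_norm (powR_ge0 _ _)) ler_wpM2r ?mulr_ge0//.
    by apply: ge0_ler_powR; rewrite ?nnegrE ?ltW// subr_gt0.
have lam0 : 0 <= lam by rewrite ltW// (lt_trans ltr01).
have sq_mask (b v : R) : b = 0 \/ b = 1 -> (b * `|v|) ^+ 2 = v ^+ 2 * b.
  by case=> ->; rewrite ?mul0r ?mulr0 ?expr0n// mul1r mulr1 real_normK ?num_real.
have mask01 u : mask u = 0 \/ mask u = 1 by case: (_ && _); [right|left].
have mA' : measurable_fun [set: R] (fun u => mask u * `|A u|).
  by apply: measurable_funM => //; exact: measurableT_comp.
have mB' : measurable_fun [set: R] (fun u => mask u * `|B (tau - u)|).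
  by apply: measurable_funM => //; exact: measurableT_comp.
have ABI := integral_mul_le leb eps0 mA' mB' (fun u => mulr_ge0 (ler0n _ _) (normr_ge0 _))
  (fun u => mulr_ge0 (ler0n _ _) (normr_ge0 _)).
have IA : (\int[leb]_u ((mask u * `|A u|) ^+ 2)%:E <= tau%:E * zphi)%E.
  apply: le_trans hphi; rewrite integral_itv0E.
  by under eq_integral do rewrite sq_mask//.
have IB : (\int[leb]_u ((mask u * `|B (tau - u)|) ^+ 2)%:E <= tau%:E * zpsi)%E.
  apply: le_trans hpsi; rewrite integral_itv0E.
  rewrite -(@ge0_integral_reflect _ tau (fun u => (B u ^+ 2 * mask u)%:E)); last 2 first.
  - apply/measurable_EFinP; apply: measurable_funM; last exact: mmask.
    exact: (measurable_funX 2 mB).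
  - by move=> u; rewrite lee_fin mulr_ge0 ?sqr_ge0.
  under eq_integral do rewrite sq_mask//.
  rewrite le_eqVlt; apply/orP; left; apply/eqP; apply: eq_integral => u _.
  by rewrite subr_gt0 gtrBl andbC.
move=> /le_trans hJ.
rewrite EFinM -(mulr_powRB1 (ltW tau0) (lt_trans ltr01 lam1)) [(lam * _)%:E]EFinM -muleA.
rewrite lee_wpmul2l//; apply: hJ.
rewrite [(tau * _)%:E]EFinM [(tau%:E * _)%E]muleC -muleA lee_wpmul2l ?lee_fin ?powR_ge0//.
apply: (le_trans ABI).
have e1 : (0 <= (eps / 2)%:E :> \bar R)%E by rewrite lee_fin divr_ge0// ltW.
have e2 : (0 <= ((2 * eps)^-1)%:E :> \bar R)%E by rewrite lee_fin invr_ge0 mulr_ge0// ltW.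
have -> : (tau%:E * ((eps / 2)%:E * zphi + ((2 * eps)^-1)%:E * zpsi) =
    (eps / 2)%:E * (tau%:E * zphi) + ((2 * eps)^-1)%:E * (tau%:E * zpsi))%E.
  by rewrite (ge0_muleDr _ (mule_ge0 e1 zphi0) (mule_ge0 e2 zpsi0)) !(muleCA tau%:E).
by apply: leeD; apply: lee_wpmul2l.
Qed.

End subordinated_form.

End bilinear_form.

(** * Families of frequency functions with controlled averages *)

Section maximal_control.
Context {R : realType} {n : nat}.
Local Notation V := 'rV[R]_n.
Local Notation mu := (leb_rV n).
Local Notation leb := (@lebesgue_measure R).
Implicit Types (phi psi : V -> V -> R) (e : \bar R).
Context (om : R -> R).
Hypothesis mom : measurable_fun [set: R] om.
Hypothesis om_le1 : forall s, 0 <= s -> `|om s| <= 1.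
Hypothesis om_supp : forall s, 1 <= s -> om s = 0.

Lemma integrable_profile_mult (phi : V -> R) (M u : R) : 0 < u ->
  measurable_fun [set: V] phi -> (forall xi, `|phi xi| <= M) ->
  mu.-integrable [set: V] (EFin \o (fun xi => profile_mult om u xi * phi xi)).
Proof.
move=> u0 mphi phiM.
have M0 : 0 <= M by exact: le_trans (normr_ge0 _) (phiM 0).
have iL : mu.-integrable [set: V] (EFin \o (fun xi => M * laplace_majorant u xi)).
  exact: (integrableZl measurableT M (integrable_laplace_majorant u0)).
apply: le_integrable iL => //.
  apply/measurable_EFinP; apply: measurable_funM => //.
  by apply: (@measurable_profile_mult _ _ _ mom _ _ (fun=> u) id).
move=> xi _ /=; rewrite lee_fin [leRHS]ger0_norm; last by rewrite mulr_ge0// laplace_majorant_ge0.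
by rewrite normrM mulrC ler_pM//; exact: norm_profile_mult_le.
Qed.

Lemma measurable_mult_integral (phi : V -> R) : measurable_fun [set: V] phi ->
  measurable_fun [set: R] (mult_integral om phi).
Proof.
move=> mphi; apply: (@measurable_fun_Rintegral _ _ _ _ _ mu (fun z : R * V =>
  profile_mult om z.1 z.2 * phi z.2)).
apply: measurable_funM; last exact: (measurableT_comp mphi).
exact: measurable_profile_mult.
Qed.

(* [Z] is the square of a maximal function of the averages of [mult_integral om (phi x)],
   with integral at most [e]. *)
Definition maximal_control phi e :=
  [/\ forall x, measurable_fun [set: V] (phi x),
      exists M, forall x xi, `|phi x xi| <= M &
      exists Z : V -> \bar R, [/\ measurable_fun [set: V] Z, forall x, (0 <= Z x)%E,
        forall x tau, 0 < tau ->
          (\int[leb]_(u in `]0%R, tau[) (mult_integral om (phi x) u ^+ 2)%:E <=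
           tau%:E * Z x)%E &
        (\int[mu]_x Z x <= e)%E]].

Lemma maximal_control_le phi e e' :
  maximal_control phi e -> (e <= e')%E -> maximal_control phi e'.
Proof.
move=> [mphi phiM [Z [mZ Z0 hZ eZ]]] ee'; split=> //; exists Z; split=> //.
exact: le_trans eZ ee'.
Qed.

(** By [(a + b)^2 <= 2 a^2 + 2 b^2]. It assembles the four cosine terms that make up each component
    of a modulated Fourier transform. *)
Lemma maximal_controlD phi psi e e' :
  maximal_control phi e -> maximal_control psi e' ->
  maximal_control (fun x xi => phi x xi + psi x xi) (2%:E * e + 2%:E * e')%E.
Proof.
move=> [mphi [M phiM] [Z [mZ Z0 hZ eZ]]] [mpsi [M' psiM] [Z' [mZ' Z'0 hZ' eZ']]].
split; first by move=> x; exact: measurable_funD.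
  by exists (M + M') => x xi; rewrite (le_trans (ler_normD _ _))// lerD.
exists (fun x => 2%:E * Z x + 2%:E * Z' x)%E; split.
- by apply: emeasurable_funD; exact: measurable_funeM.
- by move=> x; rewrite adde_ge0 ?mule_ge0.
- move=> x tau tau0.
  have m2 (f : V -> R) : measurable_fun [set: V] f ->
      measurable_fun `]0%R, tau[ (fun u => (mult_integral om f u ^+ 2)%:E).
    move=> mf; apply: measurable_funTS; apply/measurable_EFinP.
    by apply: measurable_funX; exact: measurable_mult_integral.
  have i0 (f : V -> R) : (0 <= \int[leb]_(u in `]0%R, tau[) (mult_integral om f u ^+ 2)%:E)%E.
    by apply: integral_ge0 => u _; rewrite lee_fin sqr_ge0.
  apply: (@le_trans _ _ (\int[leb]_(u in `]0%R, tau[)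
    (2%:E * (mult_integral om (phi x) u ^+ 2)%:E + 2%:E * (mult_integral om (psi x) u ^+ 2)%:E)))%E.
    apply: ge0_le_integral => //.
    + by move=> u _; rewrite lee_fin sqr_ge0.
    + by apply: m2; exact: measurable_funD.
    + by apply: emeasurable_funD; apply: measurable_funeM; exact: m2.
    move=> u; rewrite /= in_itv/= => /andP[u0 _].
    rewrite -!EFinM -EFinD lee_fin.
    have -> : mult_integral om (fun xi => phi x xi + psi x xi) u =
        mult_integral om (phi x) u + mult_integral om (psi x) u.
      rewrite /mult_integral; under eq_Rintegral do rewrite mulrDr.
      by rewrite RintegralD//; [exact: integrable_profile_mult (phiM x)|exact: integrable_profile_mult (psiM x)].
    by have := sqr_ge0 (mult_integral om (phi x) u - mult_integral om (psi x) u); nra.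
  rewrite ge0_integralD//; last 4 first.
  + by move=> u _; rewrite -EFinM lee_fin mulr_ge0 ?sqr_ge0.
  + by apply: measurable_funeM; exact: m2.
  + by move=> u _; rewrite -EFinM lee_fin mulr_ge0 ?sqr_ge0.
  + by apply: measurable_funeM; exact: m2.
  rewrite (ge0_integralZl_EFin leb (measurable_itv _) _ (m2 _ (mphi x)))//; last first.
    by move=> u _; rewrite lee_fin sqr_ge0.
  rewrite (ge0_integralZl_EFin leb (measurable_itv _) _ (m2 _ (mpsi x)))//; last first.
    by move=> u _; rewrite lee_fin sqr_ge0.
  have -> : (tau%:E * (2%:E * Z x + 2%:E * Z' x) = 2%:E * (tau%:E * Z x) + 2%:E * (tau%:E * Z' x))%E.
    by rewrite ge0_muleDr ?mule_ge0// !(muleCA tau%:E).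
  by apply: leeD; apply: lee_wpmul2l => //; [exact: hZ|exact: hZ'].
- rewrite ge0_integralD//; last 4 first.
  + by move=> x _; rewrite mule_ge0.
  + exact: measurable_funeM.
  + by move=> x _; rewrite mule_ge0.
  + exact: measurable_funeM.
  rewrite !ge0_integralZl_EFin//.
  by apply: leeD; apply: lee_wpmul2l.
Qed.

Hypothesis (N : R).
Hypothesis om_near0 : forall s, 0 <= s -> s <= 1 -> `|1 - om s| <= N * s.

Lemma maximal_control_cos_transform th th' h (B : R) :
  mu.-integrable [set: V] (EFin \o h) -> (forall x, `|h x| <= B) ->
  maximal_control (fun x xi => cos_transform th h xi * cos (th' + 2 * pi * dotp x xi))
    ((2 * ((4 * (N ^+ 2 + n%:R ^+ 2) + 2) * pi) + 8 * 64 ^+ n)%:E * \int[mu]_x (h x ^+ 2)%:E).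
Proof.
move=> ih hB; have mh : measurable_fun [set: V] h.
  by apply/measurable_EFinP; exact: measurable_int ih.
split.
- move=> x; apply: measurable_funM; first exact: measurable_cos_transform.
  by apply: measurable_cos_dotp => //; exact: measurable_cst.
- exists (\int[mu]_y `|h y|) => x xi; rewrite normrM -[leRHS]mulr1 ler_pM//.
  + exact: norm_cos_transform_le.
  + by rewrite ler_norml cos_geN1 cos_le1.
- have [Z [mZ Z0 hZ eZ]] := averaged_profile_op mom om_le1 om_supp om_near0 th th' ih hB.
  by exists Z; split.
Qed.

End maximal_control.

(** * Schwartz functions *)

Section schwartz_functions.
Context {R : realType} {n : nat}.
Local Notation V := 'rV[R]_n.
Local Notation mu := (leb_rV n).
Local Notation normc := (@ComplexField.Normc.normc R).
Implicit Types (f g : V -> R[i]) (x xi : V).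

(** The integral of a nonnegative function is a supremum over simple functions below it, which makes
    monotonicity immediate. In this form it applies to [maximal_br], a supremum over an uncountable
    set of [t]. *)
Lemma ge0_le_integral_nonmeasurable d (T : measurableType d) (m : {measure set T -> \bar R})
    (u v : T -> \bar R) : (forall z, (0 <= u z)%E) -> (forall z, (u z <= v z)%E) ->
  (\int[m]_x u x <= \int[m]_x v x)%E.
Proof.
move=> u0 uv; rewrite !ge0_integralTE//; last first.
  by move=> x; exact: le_trans (u0 x) (uv x).
apply: le_ereal_sup => _ [h /= hu <-]; exists h => //= x.
exact: le_trans (hu x) (uv x).
Qed.

Lemma normcE (z : R[i]) : normc z = Num.sqrt (complex.Re z ^+ 2 + complex.Im z ^+ 2).
Proof. by case: z. Qed.

Lemma norm_Re_le_normc (z : R[i]) : `|complex.Re z| <= normc z.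
Proof. by rewrite normcE -sqrtr_sqr ler_sqrt ?addr_ge0 ?sqr_ge0// lerDl sqr_ge0. Qed.

Lemma norm_Im_le_normc (z : R[i]) : `|complex.Im z| <= normc z.
Proof. by rewrite normcE -sqrtr_sqr ler_sqrt ?addr_ge0 ?sqr_ge0// lerDr sqr_ge0. Qed.

Lemma normc_ge0 (z : R[i]) : 0 <= normc z.
Proof. by rewrite normcE sqrtr_ge0. Qed.

Lemma normc_le_normD (z : R[i]) : normc z <= `|complex.Re z| + `|complex.Im z|.
Proof.
rewrite normcE -[leRHS]ger0_norm ?addr_ge0// -sqrtr_sqr ler_sqrt ?sqr_ge0//.
rewrite sqrrD !real_normK ?num_real// addrAC lerDl mulrn_wge0// mulr_ge0//.
Qed.

Lemma sqr_normc (z : R[i]) : normc z ^+ 2 = complex.Re z ^+ 2 + complex.Im z ^+ 2.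
Proof. by rewrite normcE sqr_sqrtr// addr_ge0// sqr_ge0. Qed.

Lemma poisson_2pi (v : R) : poisson (2 * pi) v = (pi * (1 + v ^+ 2))^-1.
Proof.
rewrite /poisson; move: (@pi R) (@pi_gt0 R) => p p0.
have v0 : 0 < 1 + v ^+ 2 by rewrite ltr_wpDr ?sqr_ge0.
by field; rewrite !gt_eqF ?mulr_gt0//= ; nra.
Qed.

Lemma integrable_poisson_rV (r : R) : 0 < r -> mu.-integrable [set: V] (EFin \o poisson_rV r).
Proof.
move=> r0; have p0 x : 0 <= poisson_rV r x.
  by apply: prodr_ge0 => i _; rewrite ltW// poisson_gt0.
apply/integrableP; split.
  by apply/measurable_EFinP; apply: measurable_poisson_rV => //; exact: measurable_id.
under eq_integral do rewrite /= ger0_norm//.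
rewrite [X in (X < _)%E](_ : _ = 1%E) ?ltry// -(integral_poisson_rV (0 : V) r0).
by apply: eq_integral => x _; rewrite subr0.
Qed.

(* Expanding the product writes the left-hand factor as a sum of squared monomials. *)
Lemma schwartz_decay f : schwartz f ->
  exists C, forall x, normc (f x) <= C * poisson_rV (2 * pi) x.
Proof.
move=> [_ df].
have /choice[M hM] : forall J : {set 'I_n}, exists M : R, forall x,
    `|monomial (fun i => if i \in J then 2 else 0)%N x| * normc (f x) <= M.
  move=> J; have [M hM] := df (fun i => if i \in J then 2 else 0)%N [::].
  exists M => x; apply: le_trans (hM x).
  by rewrite ComplexField.Normc.normcM /= expr0n/= addr0 sqrtr_sqr.
exists (pi ^+ n * \sum_(J : {set 'I_n}) M J) => x.
have -> : poisson_rV (2 * pi) x = (pi ^+ n * \prod_(i < n) (1 + x ord0 i ^+ 2))^-1.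
  rewrite /poisson_rV; under eq_bigr do rewrite poisson_2pi.
  by rewrite prodfV big_split/= prodr_const card_ord.
have p0 : 0 < pi ^+ n :> R by rewrite exprn_gt0// pi_gt0.
have D0 : 0 < \prod_(i < n) (1 + x ord0 i ^+ 2).
  by apply: prodr_gt0 => i _; rewrite ltr_wpDr ?sqr_ge0.
rewrite invfM mulrACA divff ?gt_eqF// mul1r ler_pdivlMr// mulrC.
rewrite (eq_bigr (fun i => x ord0 i ^+ 2 + 1)); last by move=> i _; rewrite addrC.
rewrite bigA_distr mulr_suml; apply: ler_sum => J _; apply: le_trans (hM J x).
rewrite ler_wpM2r ?normc_ge0// (le_trans (ler_norm _))// /monomial.
rewrite le_eqVlt; apply/orP; left; apply/eqP; congr `|_|; apply: eq_bigr => i _.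
by case: ifP => _; rewrite ?expr0.
Qed.

Lemma schwartz_component_integrable (F : V -> R) (C : R) :
  measurable_fun [set: V] F -> (forall x, `|F x| <= C * poisson_rV (2 * pi) x) ->
  mu.-integrable [set: V] (EFin \o F).
Proof.
move=> mF hF; have r0 : 0 < 2 * pi :> R by rewrite mulr_gt0 ?pi_gt0.
apply: (le_integrable measurableT _ _ (integrableZl measurableT C (integrable_poisson_rV r0))).
  exact/measurable_EFinP.
by move=> x _ /=; rewrite lee_fin (le_trans (hF x))// ler_norm.
Qed.

(** From here on a Schwartz function enters the estimates only through its boundedness and the
    integrability of its components. *)
Lemma schwartz_regular f : schwartz f ->
  [/\ mu.-integrable [set: V] (EFin \o (fun x => complex.Re (f x))),
      mu.-integrable [set: V] (EFin \o (fun x => complex.Im (f x))) &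
      exists B, forall x, normc (f x) <= B].
Proof.
move=> sf; have [C hC] := schwartz_decay sf.
have [smf bf] := sf; have [[cre cim] _] := smf [::]; split.
- apply: (@schwartz_component_integrable _ C); first exact: continuous_rV_measurable.
  by move=> x; exact: le_trans (norm_Re_le_normc _) (hC x).
- apply: (@schwartz_component_integrable _ C); first exact: continuous_rV_measurable.
  by move=> x; exact: le_trans (norm_Im_le_normc _) (hC x).
- have [B hB] := bf (fun=> 0%N) [::]; exists B => x.
  by have := hB x; rewrite /monomial big1 ?mul1r// => i _; exact: expr0.
Qed.

Lemma fourier_Re f xi : schwartz f -> complex.Re (fourier f xi) =
  cos_transform 0 (fun x => complex.Re (f x)) xi +
  cos_transform (- (pi / 2)) (fun x => complex.Im (f x)) xi.
Proof.
move=> /schwartz_regular[ire iim _].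
rewrite /fourier /cintegral /cos_transform /= -RintegralD//; last 2 first.
- exact: integrable_mul_cos.
- exact: integrable_mul_cos.
apply: eq_Rintegral => x _; case: (f x) => a b /=.
move: (2 * pi * dotp x xi) => th.
by rewrite add0r cosN sinN [_ + th]addrC cosBpihalf mulrN opprK.
Qed.

Lemma fourier_Im f xi : schwartz f -> complex.Im (fourier f xi) =
  cos_transform 0 (fun x => complex.Im (f x)) xi +
  cos_transform (pi / 2) (fun x => complex.Re (f x)) xi.
Proof.
move=> /schwartz_regular[ire iim _].
rewrite /fourier /cintegral /cos_transform /= -RintegralD//; last 2 first.
- exact: integrable_mul_cos.
- exact: integrable_mul_cos.
apply: eq_Rintegral => x _; case: (f x) => a b /=.
move: (2 * pi * dotp x xi) => th.
by rewrite add0r cosN sinN [_ + th]addrC cosDpihalf addrC.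
Qed.

(** Each Fourier transform takes its own share of the exponential of [x . (xi + eta)], which reduces
    the bilinear integrand to a real multiplier times a product. *)
Definition modulated_fourier f x xi : R[i] := fourier f xi * cexpi (2 * pi * dotp x xi).

Lemma modulated_fourier_Re f x xi : schwartz f -> complex.Re (modulated_fourier f x xi) =
  (cos_transform 0 (fun x => complex.Re (f x)) xi * cos (0 + 2 * pi * dotp x xi) +
   cos_transform (- (pi / 2)) (fun x => complex.Im (f x)) xi * cos (0 + 2 * pi * dotp x xi)) +
  (cos_transform 0 (fun x => complex.Im (f x)) xi * cos (pi / 2 + 2 * pi * dotp x xi) +
   cos_transform (pi / 2) (fun x => complex.Re (f x)) xi * cos (pi / 2 + 2 * pi * dotp x xi)).
Proof.
move=> sf; rewrite -!mulrDl -fourier_Re// -fourier_Im// /modulated_fourier.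
by case: (fourier f xi) => a b /=; rewrite add0r [pi / 2 + _]addrC cosDpihalf mulrN.
Qed.

Lemma modulated_fourier_Im f x xi : schwartz f -> complex.Im (modulated_fourier f x xi) =
  (cos_transform 0 (fun x => complex.Re (f x)) xi * cos (- (pi / 2) + 2 * pi * dotp x xi) +
   cos_transform (- (pi / 2)) (fun x => complex.Im (f x)) xi * cos (- (pi / 2) + 2 * pi * dotp x xi)) +
  (cos_transform 0 (fun x => complex.Im (f x)) xi * cos (0 + 2 * pi * dotp x xi) +
   cos_transform (pi / 2) (fun x => complex.Re (f x)) xi * cos (0 + 2 * pi * dotp x xi)).
Proof.
move=> sf; rewrite -!mulrDl -fourier_Re// -fourier_Im// /modulated_fourier.
by case: (fourier f xi) => a b /=; rewrite add0r [- (pi / 2) + _]addrC cosBpihalf.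
Qed.

Lemma maximal_control_modulated_fourier (om : R -> R) (N : R) :
  measurable_fun [set: R] om -> (forall s, 0 <= s -> `|om s| <= 1) ->
  (forall s, 1 <= s -> om s = 0) -> (forall s, 0 <= s -> s <= 1 -> `|1 - om s| <= N * s) ->
  exists2 K : R, 0 < K & forall f, schwartz f ->
    maximal_control om (fun x xi => complex.Re (modulated_fourier f x xi))
      (K%:E * \int[mu]_x (normc (f x) ^+ 2)%:E) /\
    maximal_control om (fun x xi => complex.Im (modulated_fourier f x xi))
      (K%:E * \int[mu]_x (normc (f x) ^+ 2)%:E).
Proof.
move=> mom om_le1 om_supp om_near0.
pose c := 2 * ((4 * (N ^+ 2 + n%:R ^+ 2) + 2) * pi) + 8 * 64 ^+ n : R.
have c0 : 0 < c.
  rewrite /c ltr_wpDl// ?mulr_gt0 ?exprn_gt0// ?mulr_ge0// ?pi_ge0//.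
  by rewrite addr_ge0// mulr_ge0// addr_ge0// sqr_ge0.
(* Four terms, each of cost [c], are added in two rounds; each round doubles the costs and sums two
   of them, so the total is [16 c]. *)
exists (16 * c); first by rewrite mulr_gt0.
move=> f sf; have [ire iim [B hB]] := schwartz_regular sf.
have hre x : `|complex.Re (f x)| <= B by exact: le_trans (norm_Re_le_normc _) (hB x).
have him x : `|complex.Im (f x)| <= B by exact: le_trans (norm_Im_le_normc _) (hB x).
set Q : \bar R := (\int[mu]_x _)%E.
have leQ (F : V -> R) :
    (forall x, F x ^+ 2 <= normc (f x) ^+ 2) -> (c%:E * \int[mu]_x (F x ^+ 2)%:E <= c%:E * Q)%E.
  move=> hF; apply: lee_wpmul2l; first by rewrite lee_fin ltW.
  by apply: ge0_le_integral_nonmeasurable => x; rewrite lee_fin ?sqr_ge0.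
have sq_re x : complex.Re (f x) ^+ 2 <= normc (f x) ^+ 2 by rewrite sqr_normc lerDl sqr_ge0.
have sq_im x : complex.Im (f x) ^+ 2 <= normc (f x) ^+ 2 by rewrite sqr_normc lerDr sqr_ge0.
have Cre th th' := maximal_control_le (maximal_control_cos_transform mom om_le1 om_supp om_near0
  th th' ire hre) (leQ _ sq_re).
have Cim th th' := maximal_control_le (maximal_control_cos_transform mom om_le1 om_supp om_near0
  th th' iim him) (leQ _ sq_im).
have Q0 : (0 <= Q)%E by apply: integral_ge0 => x _; rewrite lee_fin sqr_ge0.
have -> : ((16 * c)%:E * Q = 2%:E * (2%:E * (c%:E * Q) + 2%:E * (c%:E * Q)) +
    2%:E * (2%:E * (c%:E * Q) + 2%:E * (c%:E * Q)))%E.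
  have d (z : \bar R) : (2%:E * z + 2%:E * z = 4%:E * z)%E.
    rewrite -ge0_muleDl ?lee_fin// -EFinD; congr (_%:E * _)%E; ring.
  by rewrite !d !muleA -!EFinM; congr (_%:E * _)%E; ring.
split.
- rewrite (_ : (fun x xi => _) = (fun x xi => (
    cos_transform 0 (fun x => complex.Re (f x)) xi * cos (0 + 2 * pi * dotp x xi) +
    cos_transform (- (pi / 2)) (fun x => complex.Im (f x)) xi * cos (0 + 2 * pi * dotp x xi)) +
   (cos_transform 0 (fun x => complex.Im (f x)) xi * cos (pi / 2 + 2 * pi * dotp x xi) +
    cos_transform (pi / 2) (fun x => complex.Re (f x)) xi * cos (pi / 2 + 2 * pi * dotp x xi)))).
    by do 2 apply: (maximal_controlD mom om_le1 om_supp).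
  by apply/funext => x; apply/funext => xi; exact: modulated_fourier_Re.
- rewrite (_ : (fun x xi => _) = (fun x xi => (
    cos_transform 0 (fun x => complex.Re (f x)) xi * cos (- (pi / 2) + 2 * pi * dotp x xi) +
    cos_transform (- (pi / 2)) (fun x => complex.Im (f x)) xi * cos (- (pi / 2) + 2 * pi * dotp x xi)) +
   (cos_transform 0 (fun x => complex.Im (f x)) xi * cos (0 + 2 * pi * dotp x xi) +
    cos_transform (pi / 2) (fun x => complex.Re (f x)) xi * cos (0 + 2 * pi * dotp x xi)))).
    by do 2 apply: (maximal_controlD mom om_le1 om_supp).
  by apply/funext => x; apply/funext => xi; exact: modulated_fourier_Im.
Qed.

End schwartz_functions.

(** * The bilinear maximal operator *)

Section bilinear_maximal_operator.
Context {R : realType} {n : nat}.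
Local Notation V := 'rV[R]_n.
Local Notation mu := (leb_rV n).
Local Notation normc := (@ComplexField.Normc.normc R).
Implicit Types (f g : V -> R[i]) (x xi eta : V) (phi psi : V -> R).

(** Real and imaginary parts of a product are combinations of two products, so the double integral
    must be split. Additivity of [Rintegral] asks for integrability, which comes from bounding the
    multiplier by [tau^lam] times a product of two majorants. *)
Lemma bilinear_form_lin (lam tau r s : R) phi1 phi2 psi1 psi2 (M1 M2 M1' M2' : R) :
  0 < lam -> 0 < tau ->
  measurable_fun [set: V] phi1 -> measurable_fun [set: V] phi2 ->
  measurable_fun [set: V] psi1 -> measurable_fun [set: V] psi2 ->
  (forall xi, `|phi1 xi| <= M1) -> (forall xi, `|phi2 xi| <= M2) ->
  (forall eta, `|psi1 eta| <= M1') -> (forall eta, `|psi2 eta| <= M2') ->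
  \int[mu]_eta \int[mu]_xi (Num.max (tau - (dotp xi xi + dotp eta eta)) 0 `^ lam *
    (r * (phi1 xi * psi1 eta) + s * (phi2 xi * psi2 eta))) =
  r * bilinear_form lam tau phi1 psi1 + s * bilinear_form lam tau phi2 psi2.
Proof.
move=> lam0 tau0 mphi1 mphi2 mpsi1 mpsi2 hphi1 hphi2 hpsi1 hpsi2.
pose L := laplace_majorant (n := n) tau.
have L0 := @laplace_majorant_ge0 R n tau.
have iL := @integrable_laplace_majorant R n tau tau0.
pose K xi eta : R := Num.max (tau - (dotp xi xi + dotp eta eta)) 0 `^ lam.
have KL xi eta : `|K xi eta| <= tau `^ lam * (L eta * L xi).
  rewrite ger0_norm ?powR_ge0// /K.
  have [q0 q0'] := (dotp_ge0 xi, dotp_ge0 eta).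
  have [h|h] := leP (tau - (dotp xi xi + dotp eta eta)) 0.
    by rewrite powR0 ?gt_eqF//; exact: mulr_ge0 (powR_ge0 _ _) (mulr_ge0 (L0 _) (L0 _)).
  rewrite -[leLHS]mulr1; apply: ler_pM; rewrite ?powR_ge0//.
    by apply: ge0_ler_powR; rewrite ?nnegrE ?(ltW lam0) ?(ltW tau0) ?(ltW h)//; lra.
  by rewrite -[leLHS]mulr1; apply: ler_pM => //; apply: laplace_majorant_ge1 => //; lra.
have mK : measurable_fun [set: V * V] (fun z => K z.2 z.1).
  apply: (measurableT_comp (@measurable_maxr0 R lam)); apply: measurable_funB => //.
  by apply: measurable_funD; apply: measurable_dotp.
pose F phi psi (z : V * V) : R := K z.2 z.1 * (phi z.2 * psi z.1).
have mF phi psi : measurable_fun [set: V] phi -> measurable_fun [set: V] psi ->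
    measurable_fun [set: V * V] (F phi psi).
  move=> mphi mpsi; apply: measurable_funM => //.
  by apply: measurable_funM; [exact: (measurableT_comp mphi)|exact: (measurableT_comp mpsi)].
have iA M M' : mu.-integrable [set: V] (EFin \o (fun eta => tau `^ lam * (M * M') * L eta)).
  exact: (integrableZl measurableT _ iL).
have FL phi psi M M' : (forall xi, `|phi xi| <= M) -> (forall eta, `|psi eta| <= M') ->
    forall eta xi, `|F phi psi (eta, xi)| <= tau `^ lam * (M * M') * L eta * L xi.
  move=> hphi hpsi eta xi; rewrite /F/= normrM normrM.
  apply: (@le_trans _ _ (tau `^ lam * (L eta * L xi) * (M * M'))).
    by apply: ler_pM; [exact: normr_ge0|exact: mulr_ge0|exact: KL|exact: ler_pM].
  by rewrite le_eqVlt; apply/orP; left; apply/eqP; ring.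
have i2 phi psi M M' mphi mpsi hphi hpsi := dominated_integrable2 (mF phi psi mphi mpsi) iL
  (@FL phi psi M M' hphi hpsi).
have i1 phi psi M M' mphi mpsi hphi hpsi := dominated_integrable_Rintegral2 (mF phi psi mphi mpsi)
  (iA M M') iL (@FL phi psi M M' hphi hpsi).
have iZ2 c phi psi M M' mphi mpsi hphi hpsi eta :=
  integrableZl measurableT c (i2 phi psi M M' mphi mpsi hphi hpsi eta).
have iZ1 c phi psi M M' mphi mpsi hphi hpsi :=
  integrableZl measurableT c (i1 phi psi M M' mphi mpsi hphi hpsi).
transitivity (\int[mu]_eta (r * \int[mu]_xi F phi1 psi1 (eta, xi) +
    s * \int[mu]_xi F phi2 psi2 (eta, xi))).
  apply: eq_Rintegral => eta _.
  rewrite -!RintegralZl//; [|exact: (i2 _ _ M2 M2')|exact: (i2 _ _ M1 M1')].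
  rewrite -RintegralD//; [|exact: (iZ2 _ _ _ M1 M1')|exact: (iZ2 _ _ _ M2 M2')].
  by apply: eq_Rintegral => xi _; rewrite /F/= /K; ring.
rewrite RintegralD//; [|exact: (iZ1 _ _ _ M1 M1')|exact: (iZ1 _ _ _ M2 M2')].
by rewrite !RintegralZl//; [exact: (i1 _ _ M2 M2')|exact: (i1 _ _ M1 M1')].
Qed.

Lemma cexpiD (a b : R) : cexpi (a + b) = cexpi a * cexpi b.
Proof. by rewrite /cexpi cosD sinD; simpc; congr (_ +i* _)%C; rewrite addrC. Qed.

Lemma br_multiplierZ (lam t : R) xi eta : 0 < t ->
  br_multiplier lam (t *: xi) (t *: eta) =
  (t ^+ 2) `^ lam * Num.max (t ^- 2 - (dotp xi xi + dotp eta eta)) 0 `^ lam.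
Proof.
move=> t0; have t20 : 0 < t ^+ 2 by rewrite exprn_gt0.
rewrite -powRM ?(ltW t20)//; last by rewrite le_max lexx orbT.
rewrite /br_multiplier maxr_pMr ?(ltW t20)// mulr0 mulrBr divff ?gt_eqF//.
have dotpZ v : dotp (t *: v) (t *: v) = t ^+ 2 * dotp v v :> R.
  by rewrite /dotp mulr_sumr; apply: eq_bigr => i _; rewrite !mxE; ring.
by rewrite !dotpZ mulrDr.
Qed.

Section fixed_time.
Variables (lam t : R) (f g : V -> R[i]) (x : V).
Hypothesis t0 : 0 < t.
Let F := modulated_fourier f x.
Let G := modulated_fourier g x.

Lemma bilinear_br_integrand xi eta :
  (br_multiplier lam (t *: xi) (t *: eta))%:C%C * fourier f xi * fourier g eta *
    cexpi (2 * pi * dotp x (xi + eta)) =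
  (((t ^+ 2) `^ lam * Num.max (t ^- 2 - (dotp xi xi + dotp eta eta)) 0 `^ lam)%:C)%C *
    (F xi * G eta).
Proof.
rewrite br_multiplierZ// /F /G /modulated_fourier dotpC dotpDl mulrDr cexpiD.
rewrite ![dotp _ x]dotpC.
move: (_%:C)%C (cexpi _) (cexpi _) (fourier f xi) (fourier g eta) => c a b u v.
by rewrite -!mulrA; congr (_ * (_ * _)); rewrite mulrCA.
Qed.

Hypothesis lam1 : 1 < lam.
Let tau := t ^- 2.
Let phi_re xi := complex.Re (F xi).
Let phi_im xi := complex.Im (F xi).
Let psi_re eta := complex.Re (G eta).
Let psi_im eta := complex.Im (G eta).

Hypothesis mphi_re : measurable_fun [set: V] phi_re.
Hypothesis mphi_im : measurable_fun [set: V] phi_im.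
Hypothesis mpsi_re : measurable_fun [set: V] psi_re.
Hypothesis mpsi_im : measurable_fun [set: V] psi_im.
Variables (M1 M2 M1' M2' : R).
Hypothesis phi_re_le : forall xi, `|phi_re xi| <= M1.
Hypothesis phi_im_le : forall xi, `|phi_im xi| <= M2.
Hypothesis psi_re_le : forall eta, `|psi_re eta| <= M1'.
Hypothesis psi_im_le : forall eta, `|psi_im eta| <= M2'.

Let tau0 : 0 < tau.
Proof. by rewrite invr_gt0 exprn_gt0. Qed.

Let lam0 : 0 < lam := lt_trans ltr01 lam1.

Lemma bilinear_br_Re : complex.Re (bilinear_br lam t f g x) =
  (t ^+ 2) `^ lam * bilinear_form lam tau phi_re psi_re -
  (t ^+ 2) `^ lam * bilinear_form lam tau phi_im psi_im.
Proof.
transitivity (\int[mu]_eta \int[mu]_xi complex.Re ((br_multiplier lam (t *: xi) (t *: eta))%:C%C *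
  fourier f xi * fourier g eta * cexpi (2 * pi * dotp x (xi + eta)))); first by [].
rewrite -mulNr -(bilinear_form_lin _ _ lam0 tau0 mphi_re mphi_im mpsi_re mpsi_im
  phi_re_le phi_im_le psi_re_le psi_im_le).
apply: eq_Rintegral => eta _; apply: eq_Rintegral => xi _.
rewrite bilinear_br_integrand /phi_re /phi_im /psi_re /psi_im -/tau.
by case: (F xi) => a b; case: (G eta) => c d /=; ring.
Qed.

Lemma bilinear_br_Im : complex.Im (bilinear_br lam t f g x) =
  (t ^+ 2) `^ lam * bilinear_form lam tau phi_re psi_im +
  (t ^+ 2) `^ lam * bilinear_form lam tau phi_im psi_re.
Proof.
transitivity (\int[mu]_eta \int[mu]_xi complex.Im ((br_multiplier lam (t *: xi) (t *: eta))%:C%C *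
  fourier f xi * fourier g eta * cexpi (2 * pi * dotp x (xi + eta)))); first by [].
rewrite -(bilinear_form_lin _ _ lam0 tau0 mphi_re mphi_im mpsi_im mpsi_re
  phi_re_le phi_im_le psi_im_le psi_re_le).
apply: eq_Rintegral => eta _; apply: eq_Rintegral => xi _.
rewrite bilinear_br_integrand /phi_re /phi_im /psi_re /psi_im -/tau.
by case: (F xi) => a b; case: (G eta) => c d /=; ring.
Qed.

Lemma normc_bilinear_br_le : normc (bilinear_br lam t f g x) <=
  ((t ^+ 2) `^ lam * `|bilinear_form lam tau phi_re psi_re| +
   (t ^+ 2) `^ lam * `|bilinear_form lam tau phi_im psi_im|) +
  ((t ^+ 2) `^ lam * `|bilinear_form lam tau phi_re psi_im| +
   (t ^+ 2) `^ lam * `|bilinear_form lam tau phi_im psi_re|).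
Proof.
apply: (le_trans (normc_le_normD _)); rewrite bilinear_br_Re bilinear_br_Im.
move: (bilinear_form _ _ _ _) (bilinear_form _ _ _ _) (bilinear_form _ _ _ _)
  (bilinear_form _ _ _ _) (powR_ge0 (t ^+ 2) lam) => a b c d tl0.
by apply: lerD; [apply: (le_trans (ler_normB _ _))|apply: (le_trans (ler_normD _ _))];
  rewrite !normrM (ger0_norm tl0).
Qed.

(** Four products of components occur, and each of [z1], [z2], [w1], [w2] appears in two of them,
    which doubles the weights [eps / 2] and [1 / (2 eps)]. As [tau = t^-2], the factor [(t^2)^lam]
    cancels [tau^lam], and the right side is free of [t]. *)
Lemma normc_bilinear_br_le_control (eps : R) (z1 z2 w1 w2 : \bar R) : 0 < eps ->
  (0 <= z1)%E -> (0 <= z2)%E -> (0 <= w1)%E -> (0 <= w2)%E ->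
  (forall s : R, (0 < s)%R -> (\int[lebesgue_measure]_(u in `]0%R, s[)
    (mult_integral (bump_profile lam) phi_re u ^+ 2)%:E <= s%:E * z1)%E) ->
  (forall s : R, (0 < s)%R -> (\int[lebesgue_measure]_(u in `]0%R, s[)
    (mult_integral (bump_profile lam) phi_im u ^+ 2)%:E <= s%:E * z2)%E) ->
  (forall s : R, (0 < s)%R -> (\int[lebesgue_measure]_(u in `]0%R, s[)
    (mult_integral (@ball_profile R) psi_re u ^+ 2)%:E <= s%:E * w1)%E) ->
  (forall s : R, (0 < s)%R -> (\int[lebesgue_measure]_(u in `]0%R, s[)
    (mult_integral (@ball_profile R) psi_im u ^+ 2)%:E <= s%:E * w2)%E) ->
  ((normc (bilinear_br lam t f g x))%:E <=
   lam%:E * ((eps%:E * (z1 + z2)) + (eps^-1)%:E * (w1 + w2)))%E.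
Proof.
move=> eps0 z10 z20 w10 w20 hz1 hz2 hw1 hw2.
have J phi psi N N' z w mphi mpsi hphi hpsi z0 w0 hz hw :=
  @bilinear_form_le R n lam tau phi psi N N' lam1 tau0 mphi mpsi hphi hpsi eps z w eps0 z0 w0 hz hw.
have tl0 : 0 <= (t ^+ 2) `^ lam by exact: powR_ge0.
have tl1 : (t ^+ 2) `^ lam * tau `^ lam = 1.
  by rewrite -powRM ?sqr_ge0 ?(ltW tau0)// divff ?powR1// expf_neq0// gt_eqF.
have J' phi psi z w :
    (`|bilinear_form lam tau phi psi|%:E <=
     (lam * tau `^ lam)%:E * ((eps / 2)%:E * z + ((2 * eps)^-1)%:E * w) ->
     ((t ^+ 2) `^ lam * `|bilinear_form lam tau phi psi|)%:E <=
     lam%:E * ((eps / 2)%:E * z + ((2 * eps)^-1)%:E * w))%E.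
  move=> hJ; rewrite EFinM; apply: (@le_trans _ _ (((t ^+ 2) `^ lam)%:E * ((lam * tau `^ lam)%:E *
    ((eps / 2)%:E * z + ((2 * eps)^-1)%:E * w))))%E; first exact: lee_wpmul2l.
  by rewrite muleA -EFinM mulrCA tl1 mulr1.
pose T z w := ((eps / 2)%:E * z + ((2 * eps)^-1)%:E * w)%E : \bar R.
have b11 := J' _ _ _ _ (J _ _ M1 M1' _ _ mphi_re mpsi_re phi_re_le psi_re_le z10 w10 (hz1 _ tau0) (hw1 _ tau0)).
have b22 := J' _ _ _ _ (J _ _ M2 M2' _ _ mphi_im mpsi_im phi_im_le psi_im_le z20 w20 (hz2 _ tau0) (hw2 _ tau0)).
have b12 := J' _ _ _ _ (J _ _ M1 M2' _ _ mphi_re mpsi_im phi_re_le psi_im_le z10 w20 (hz1 _ tau0) (hw2 _ tau0)).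
have b21 := J' _ _ _ _ (J _ _ M2 M1' _ _ mphi_im mpsi_re phi_im_le psi_re_le z20 w10 (hz2 _ tau0) (hw1 _ tau0)).
apply: (@le_trans _ _ ((lam%:E * T z1 w1 + lam%:E * T z2 w2) + (lam%:E * T z1 w2 + lam%:E * T z2 w1))%E).
  apply: le_trans (leeD (leeD b11 b22) (leeD b12 b21)).
  have := normc_bilinear_br_le; rewrite -lee_fin; apply.
have e1 : (0 <= (eps / 2)%:E :> \bar R)%E by rewrite lee_fin divr_ge0// ltW.
have e2 : (0 <= ((2 * eps)^-1)%:E :> \bar R)%E by rewrite lee_fin invr_ge0 mulr_ge0// ltW.
have T0 z w : (0 <= z)%E -> (0 <= w)%E -> (0 <= T z w)%E.
  by move=> z0 w0; rewrite adde_ge0 ?mule_ge0.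
rewrite -!ge0_muleDr; do ?[exact: T0|by rewrite adde_ge0 ?T0].
apply: lee_wpmul2l; first by rewrite lee_fin ltW.
have TD z z' w w' : (0 <= z)%E -> (0 <= z')%E -> (0 <= w)%E -> (0 <= w')%E ->
    (T z w + T z' w' = (eps / 2)%:E * (z + z') + ((2 * eps)^-1)%:E * (w + w'))%E.
  by move=> *; rewrite /T addeACA !ge0_muleDr.
rewrite (TD z1 z2 w1 w2)// (TD z1 z2 w2 w1)// [(w2 + w1)%E]addeC addeACA -!ge0_muleDl// -!EFinD.
rewrite le_eqVlt; apply/orP; left; apply/eqP; congr (_%:E * _ + _%:E * _)%E.
  by field.
by field; rewrite gt_eqF.
Qed.

End fixed_time.
End bilinear_maximal_operator.

(** * Integration in x and the choice of the weight *)

Section maximal_estimate.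
Context {R : realType} {n : nat}.
Local Notation V := 'rV[R]_n.
Local Notation mu := (leb_rV n).
Local Notation normc := (@ComplexField.Normc.normc R).
Implicit Types (f g : V -> R[i]) (x : V).

Lemma maximal_br_ge0 (lam : R) f g x : (0 <= maximal_br lam f g x)%E.
Proof.
apply: (@le_trans _ _ (normc (bilinear_br lam 1 f g x))%:E); first by rewrite lee_fin normc_ge0.
by apply: ereal_sup_ubound; exists 1 => //=; exact: ltr01.
Qed.

(** The weight [eps] is the same at all [x], and [C] does not depend on it, so that it can be
    optimised after integration, in terms of the norms of [f] and [g]. *)
Lemma maximal_br_weighted (lam : R) : 1 < lam ->
  exists2 C : R, 0 < C & forall f g, schwartz f -> schwartz g ->
    forall eps : R, 0 < eps ->
    (\int[mu]_x maximal_br lam f g x <=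
     C%:E * (eps%:E * \int[mu]_x (normc (f x) ^+ 2)%:E +
             (eps^-1)%:E * \int[mu]_x (normc (g x) ^+ 2)%:E))%E.
Proof.
move=> lam1; have lam0 : 0 < lam := lt_trans ltr01 lam1.
have [K K0 ctrl_f] := @maximal_control_modulated_fourier R n _ _ (measurable_bump_profile lam)
  (bump_profile_le1 lam1) (bump_profile_supp lam1) (bump_profile_near0 lam1).
have [K' K'0 ctrl_g] := @maximal_control_modulated_fourier R n _ _ (@measurable_ball_profile R)
  (@ball_profile_le1 R) (@ball_profile_supp R) (@ball_profile_near0 R).
exists (2 * lam * (K + K')); first by rewrite !mulr_gt0// addr_gt0.
move=> f g sf sg eps eps0.
have [[mf1 [M1 hM1] [Z1 [mZ1 Z10 hZ1 eZ1]]] [mf2 [M2 hM2] [Z2 [mZ2 Z20 hZ2 eZ2]]]] := ctrl_f f sf.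
have [[mg1 [N1 hN1] [W1 [mW1 W10 hW1 eW1]]] [mg2 [N2 hN2] [W2 [mW2 W20 hW2 eW2]]]] := ctrl_g g sg.
set Qf := (\int[mu]_x (normc (f x) ^+ 2)%:E)%E in eZ1 eZ2 *.
set Qg := (\int[mu]_x (normc (g x) ^+ 2)%:E)%E in eW1 eW2 *.
have Qf0 : (0 <= Qf)%E by apply: integral_ge0 => x _; rewrite lee_fin sqr_ge0.
have Qg0 : (0 <= Qg)%E by apply: integral_ge0 => x _; rewrite lee_fin sqr_ge0.
have ie0 : 0 <= eps^-1 by rewrite invr_ge0 ltW.
pose W x := (lam%:E * (eps%:E * (Z1 x + Z2 x) + (eps^-1)%:E * (W1 x + W2 x)))%E.
have maxW x : (maximal_br lam f g x <= W x)%E.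
  apply: ge_ereal_sup => _ [t /= t0 <-].
  apply: (@normc_bilinear_br_le_control R n lam t f g x t0 lam1 (mf1 x) (mf2 x) (mg1 x) (mg2 x)
    M1 M2 N1 N2 (hM1 x) (hM2 x) (hN1 x) (hN2 x) eps) => //.
  - by move=> s s0; exact: hZ1.
  - by move=> s s0; exact: hZ2.
  - by move=> s s0; exact: hW1.
  - by move=> s s0; exact: hW2.
apply: (le_trans (ge0_le_integral_nonmeasurable mu (maximal_br_ge0 lam f g) maxW)).
have iZ : (\int[mu]_x (Z1 x + Z2 x) <= (2 * K)%:E * Qf)%E.
  rewrite ge0_integralD//; apply: (le_trans (leeD eZ1 eZ2)).
  by rewrite -ge0_muleDl ?lee_fin ?(ltW K0)// -EFinD mulr_natl mulr2n.
have iW : (\int[mu]_x (W1 x + W2 x) <= (2 * K')%:E * Qg)%E.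
  rewrite ge0_integralD//; apply: (le_trans (leeD eW1 eW2)).
  by rewrite -ge0_muleDl ?lee_fin ?(ltW K'0)// -EFinD mulr_natl mulr2n.
have mZ : measurable_fun [set: V] (fun x => Z1 x + Z2 x)%E by exact: emeasurable_funD.
have mW : measurable_fun [set: V] (fun x => W1 x + W2 x)%E by exact: emeasurable_funD.
have Z0 x : (0 <= Z1 x + Z2 x)%E by exact: adde_ge0.
have W0 x : (0 <= W1 x + W2 x)%E by exact: adde_ge0.
rewrite /W ge0_integralZl_EFin//; last 3 first.
- by move=> x _; rewrite adde_ge0 ?mule_ge0// lee_fin ltW.
- by apply: emeasurable_funD; exact: measurable_funeM.
- exact: ltW.
rewrite ge0_integralD//; last 4 first.
- by move=> x _; rewrite mule_ge0// lee_fin ltW.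
- exact: measurable_funeM.
- by move=> x _; rewrite mule_ge0.
- exact: measurable_funeM.
rewrite !ge0_integralZl_EFin// ?(ltW eps0)//.
apply: (@le_trans _ _ (lam%:E * (eps%:E * ((2 * (K + K'))%:E * Qf) +
    (eps^-1)%:E * ((2 * (K + K'))%:E * Qg)))%E).
  apply: lee_wpmul2l; first by rewrite lee_fin ltW.
  apply: leeD; apply: lee_wpmul2l; rewrite ?lee_fin ?(ltW eps0)//.
  - by apply: (le_trans iZ); apply: lee_wpmul2r => //; rewrite lee_fin ler_wpM2l// lerDl ltW.
  - by apply: (le_trans iW); apply: lee_wpmul2r => //; rewrite lee_fin ler_wpM2l// lerDr ltW.
rewrite [X in (X + _)%E]muleCA [X in (_ + X)%E]muleCA -ge0_muleDr ?mule_ge0 ?lee_fin ?(ltW eps0)//.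
by rewrite muleA -EFinM mulrCA mulrA.
Qed.

(** The weight [eps = b / a] balances the two squares into [2 a b], which restores the product of
    norms. *)
Lemma le_of_weighted_bound (c a b : R) (I : \bar R) : 0 < c -> 0 <= a -> 0 <= b ->
  (forall eps : R, 0 < eps -> (I <= (c * (eps * a ^+ 2 + eps^-1 * b ^+ 2))%:E)%E) ->
  (I <= (2 * c * a * b)%:E)%E.
Proof.
move=> c0 a0 b0 hI; apply/lee_addgt0Pr => e e0.
(* Optimise with [a] and [b] replaced by [a + d] and [b + d] for a small [d], to cover the case
   where one of them vanishes. *)
pose d := Num.min 1 (e / (2 * c * (a + b + 1))).
have D0 : 0 < 2 * c * (a + b + 1) by rewrite !mulr_gt0//; lra.
have d0 : 0 < d by rewrite lt_min ltr01 divr_gt0.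
have d1 : d <= 1 by rewrite ge_min lexx.
have de : d * (2 * c * (a + b + 1)) <= e by rewrite -ler_pdivlMr// ge_min lexx orbT.
have ad0 : 0 < a + d by lra.
have bd0 : 0 < b + d by lra.
apply: (le_trans (hI ((b + d) / (a + d)) _)); first by rewrite divr_gt0.
rewrite -EFinD lee_fin.
apply: (@le_trans _ _ (2 * c * ((a + d) * (b + d)))).
  have -> : 2 * c * ((a + d) * (b + d)) = c * (2 * ((a + d) * (b + d))) by ring.
  rewrite ler_pM2l// invf_div.
  have h y z : 0 <= y -> 0 < y + d -> 0 < z -> z / (y + d) * y ^+ 2 <= (y + d) * z.
    move=> y0 yd0 z0; rewrite mulrAC ler_pdivrMr// [leRHS](_ : _ = z * (y + d) ^+ 2); last by ring.
    by rewrite ler_pM2l// ler_sqr ?nnegrE ?(ltW yd0)// lerDl ltW.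
  by have := h a _ a0 ad0 bd0; have := h b _ b0 bd0 ad0; lra.
apply: (@le_trans _ _ (2 * c * a * b + d * (2 * c * (a + b + 1)))); last by rewrite lerD2l.
rewrite -subr_ge0.
have -> : 2 * c * a * b + d * (2 * c * (a + b + 1)) - 2 * c * ((a + d) * (b + d)) =
  2 * c * d * (1 - d) by ring.
by rewrite mulr_ge0 ?subr_ge0// !mulr_ge0 ?(ltW c0) ?(ltW d0).
Qed.

(** Finiteness holds because [|f|^2] is at most a bound of [f] times the integrable function
    [|Re f| + |Im f|]. The norms can then be treated as real numbers. *)
Lemma schwartz_L2 f : schwartz f -> exists2 a : R, 0 <= a &
  (\int[mu]_x (normc (f x) ^+ 2)%:E = (a ^+ 2)%:E /\ cLnorm 2%:E f = a%:E)%E.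
Proof.
move=> sf; have [ire iim [B hB]] := schwartz_regular sf.
set Q : \bar R := (\int[mu]_x _)%E.
have Q0 : (0 <= Q)%E by apply: integral_ge0 => x _; rewrite lee_fin sqr_ge0.
have Qfin : (Q < +oo)%E.
  have i1 : mu.-integrable [set: V] (fun x => B%:E * (`|complex.Re (f x)|%:E + `|complex.Im (f x)|%:E))%E.
    apply: integrableZl => //; apply: integrableD => //; exact: integrable_norm.
  have /integrableP[_] := i1; apply: le_lt_trans.
  apply: ge0_le_integral_nonmeasurable => x; rewrite ?lee_fin ?sqr_ge0//=.
  rewrite [leRHS]ger0_norm.
    by rewrite expr2; apply: ler_pM; rewrite ?normc_ge0 ?normc_le_normD.
  by rewrite mulr_ge0 ?addr_ge0// (le_trans (normc_ge0 _) (hB x)).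
have [q Qq] : exists q, Q = q%:E by exists (fine Q); rewrite fineK// ge0_fin_numE.
have q0 : 0 <= q by rewrite -lee_fin -Qq.
exists (Num.sqrt q); first exact: sqrtr_ge0.
split; first by rewrite sqr_sqrtr.
rewrite /cLnorm unlock /Lnorm /=.
rewrite (_ : (\int[_]_x _)%E = Q).
  by rewrite Qq poweR_EFin powR12_sqrt.
apply: eq_integral => x _ /=.
by rewrite powR_mulrn// ger0_norm ?normc_ge0.
Qed.

End maximal_estimate.

Theorem theorem1p3 (R : realType) (n : nat) (hn : (0 < n)%N) (lam : R)
  (hlam : (4 * n%:R + 3) / 5 < lam) :
  exists C : R, forall f g : 'rV[R]_n -> R[i], schwartz f -> schwartz g ->
    ('N[lebesgue_rV n]_1[maximal_br lam f g]
       <= C%:E * cLnorm 2%:E f * cLnorm 2%:E g)%E.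
Proof.
(* For [n >= 1] the threshold [(4 n + 3) / 5] is at least [7 / 5]. *)
have lam1 : 1 < lam.
  have : 1 <= n%:R :> R by rewrite ler1n.
  lra.
have [C C0 hC] := @maximal_br_weighted R n lam lam1.
exists (2 * C) => f g sf sg.
have [a a0 [fa ->]] := schwartz_L2 sf; have [b b0 [gb ->]] := schwartz_L2 sg.
rewrite Lnorm1 -!EFinM.
under eq_integral do rewrite gee0_abs ?maximal_br_ge0//.
apply: le_of_weighted_bound => // eps eps0.
by have := hC f g sf sg eps eps0; rewrite fa gb -!EFinM.
Qed.
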